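(* Let $n\ge 1$, let $D=\{z\in\mathbb{C}^n:|z|<1\}$, let $\mathcal{F}$ be a family of holomorphic functions $f:D\to\mathbb{C}$, and let $\alpha,\beta$ be real numbers with $\alpha\ge 0$ and $\beta\ge\alpha+1$. Then $\mathcal{F}$ is not normal on $D$ if and only if there exist a real number $r$ with $0<r<1$, a sequence $\{z_j\}\subseteq D$ with $|z_j|<r$ for all $j$, a sequence $\{f_j\}\subseteq\mathcal{F}$, and a sequence $\{\rho_j\}\subset(0,1]$ with $\rho_j\to 0$, such that the sequence $$g_j(\zeta)=\rho_j^{-\alpha}f_j(z_j+\rho_j^{\beta}\zeta)$$ converges locally uniformly in $\mathbb{C}^n$ to a nonconstant entire function $g$ on $\mathbb{C}^n$.
   Context: $|\cdot|$ is the Euclidean norm on $\mathbb{C}^n$. A family $\mathcal{F}$ of holomorphic functions $f:D\to\mathbb{C}$ on a domain $D\subseteq\mathbb{C}^n$ is normal on $D$ if every sequence in $\mathcal{F}$ contains a subsequence that converges locally uniformly on $D$ to a limit function which is either holomorphic on $D$ or identically equal to $\infty$. An entire function on $\mathbb{C}^n$ is a holomorphic function $\mathbb{C}^n\to\mathbb{C}$. The function $g_j$ is defined on $\{\zeta\in\mathbb{C}^n: z_j+\rho_j^{\beta}\zeta\in D\}$; locally uniform convergence in $\mathbb{C}^n$ means that for every compact $K\subset\mathbb{C}^n$, $g_j$ is defined on $K$ for all sufficiently large $j$ and converges uniformly to $g$ on $K$. *)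

(* Defs.v *)
From HB Require Import structures.
From mathcomp Require Import all_boot all_order all_algebra.
From mathcomp Require Import all_classical all_reals all_analysis.
From mathcomp Require Import complex.

Set Implicit Arguments.
Unset Strict Implicit.
Unset Printing Implicit Defensive.

Import Order.TTheory GRing.Theory Num.Theory.
Import numFieldNormedType.Exports.

Local Open Scope classical_set_scope.
Local Open Scope ring_scope.

(* The library puts its canonical topology and norm on abstract numFieldTypes
   only, through the alias R^o; this does the same for the concrete R[i]. *)
#[non_forgetful_inheritance]
HB.instance Definition _ (R : realType) :=
  GRing.ComAlgebra.copy R[i] R[i]^o.
#[non_forgetful_inheritance]
HB.instance Definition _ (R : realType) := Vector.copy R[i] R[i]^o.
#[non_forgetful_inheritance]
HB.instance Definition _ (R : realType) := NormedModule.copy R[i] R[i]^o.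

Definition cabs (R : realType) (c : R[i]) : R := ComplexField.Normc.normc c.

(* The library norm of 'rV[R[i]]_n is the sup norm. It only serves to give C^n
   its topology, which is the Euclidean one; |.| itself is [enorm]. *)
Definition enorm (R : realType) (n : nat) (z : 'rV[R[i]]_n) : R :=
  Num.sqrt (\sum_(k < n) cabs (z ord0 k) ^+ 2).

Definition unit_ball (R : realType) (n : nat) : set 'rV[R[i]]_n :=
  [set z | enorm z < 1].

(* Functions on a subset of C^n are total functions of which only the values on
   that subset matter. The scalars being R[i], [differentiable] is complex
   Frechet differentiability; [D] is meant to be open. *)
Definition holomorphic_on (R : realType) (n : nat) (D : set 'rV[R[i]]_n)
    (f : 'rV[R[i]]_n -> R[i]) : Prop :=
  forall z, D z -> differentiable f z.

Definition entire (R : realType) (n : nat) (f : 'rV[R[i]]_n -> R[i]) : Prop :=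
  holomorphic_on setT f.

Definition cvg_loc_unif (R : realType) (n : nat) (D : set 'rV[R[i]]_n)
    (f_ : nat -> 'rV[R[i]]_n -> R[i]) (f : 'rV[R[i]]_n -> R[i]) : Prop :=
  forall K : set 'rV[R[i]]_n, compact K -> K `<=` D ->
    {uniform K, f_ @ \oo --> f}.

Definition cvg_loc_unif_infty (R : realType) (n : nat) (D : set 'rV[R[i]]_n)
    (f_ : nat -> 'rV[R[i]]_n -> R[i]) : Prop :=
  forall K : set 'rV[R[i]]_n, compact K -> K `<=` D ->
    forall M : R, \forall j \near \oo, forall z, K z -> M < cabs (f_ j z).

Definition normal_family (R : realType) (n : nat) (D : set 'rV[R[i]]_n)
    (F : set ('rV[R[i]]_n -> R[i])) : Prop :=
  forall f_ : nat -> 'rV[R[i]]_n -> R[i], (forall j, F (f_ j)) ->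
  exists2 s : nat -> nat, {homo s : i j / (i < j)%N} &
    (exists2 f, holomorphic_on D f & cvg_loc_unif D (f_ \o s) f) \/
    cvg_loc_unif_infty D (f_ \o s).

(* Locally uniform convergence in C^n of functions [g_ j], each defined only on
   [dom j]. *)
Definition cvg_loc_unif_partial (R : realType) (n : nat)
    (dom : nat -> set 'rV[R[i]]_n)
    (g_ : nat -> 'rV[R[i]]_n -> R[i]) (g : 'rV[R[i]]_n -> R[i]) : Prop :=
  forall K : set 'rV[R[i]]_n, compact K ->
    (\forall j \near \oo, K `<=` dom j) /\ {uniform K, g_ @ \oo --> g}.

(* Main.v *)
Require Import Defs.
From HB Require Import structures.
From mathcomp Require Import all_boot all_order all_algebra.
From mathcomp Require Import all_classical all_reals all_analysis.
From mathcomp Require Import complex.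
From mathcomp Require Import ring lra.

Set Implicit Arguments.
Unset Strict Implicit.
Unset Printing Implicit Defensive.

Import Order.TTheory GRing.Theory Num.Theory.
Import numFieldNormedType.Exports.

Local Open Scope classical_set_scope.
Local Open Scope ring_scope.
Local Open Scope complex_scope.

(** Put [gamma = alpha / beta < 1] and [t = rho^beta], so that the renormalized
    functions are [t^-gamma f (z + t zeta)]. The metric [|dw| / ((1 + |w|)
    (1 + ln (1 + |w|)))] on [C] is complete at infinity, so by Montel's theorem
    [F] is normal as soon as the lengths of the differentials of its members in
    this metric are locally bounded. If [F] is not normal, Zalcman's choice of
    centres and scales gives renormalized functions whose differentials have
    metric length at most 4 on growing balls and more than 1/4 at the origin.
    Landau's estimate [|g'| <= C |g| ln |g|] for functions with [|g| > 1] bounds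
    their values at the origin; Montel's theorem then provides the limit, and
    Cauchy's estimate at the origin shows that it is not constant.

    Conversely [beta - alpha >= 1] makes the renormalized functions of a
    sequence with a holomorphic limit [O (rho)]-Lipschitz, so that their limit
    is constant; if the sequence tends to infinity, then so do they. *)

(** The spherical metric of Zalcman's classical argument does not serve here: infinity lies at
    finite distance, so bounded lengths control no modulus. A density of order 1 / (s ln s) sits on
    the border line. It is large enough for the distance to infinity to diverge, like ln ln s, so
    that bounds on values propagate along segments; it is small enough for Landau's inequality to
    make the length small at a point where the value is large. Without the second property the
    renormalized functions could escape to infinity although their differentials have controlled
    length. The choice of scales moreover needs a weight that is monotone and doubling in t; this
    holds because t^(1 - gamma) increases and t^(- gamma) does not. The one-variable theory rests on
    a single inequality, Cauchy's bound for the derivative at the centre of a disc, obtained from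
    Goursat's theorem for real closed forms. Lipschitz and Taylor bounds and the holomorphy of the
    derivative follow by applying it to differences of translates, without integral formula or power
    series. Several variables enter by restriction to complex lines. *)

Definition contin (R : realType) (phi : R -> R) (a b : R) : Prop :=
  forall x, a <= x <= b -> {for x, continuous phi}.

Definition ri (R : realType) (phi : R -> R) (a b : R) : R :=
  \int[@lebesgue_measure R]_(x in `[a, b]) phi x.

(** * Comparison of integrals over a segment with increments *)

Section segment_integral.
Variable R : realType.
Implicit Types (phi G : R -> R) (a b : R).

Lemma contin_within phi a b :
  contin phi a b -> {within `[a, b], continuous phi}.
Proof.
move=> cphi; apply: continuous_in_subspaceT => x.
by rewrite inE/= in_itv/= => xab; exact: cphi.
Qed.

Lemma contin_integrable phi a b : contin phi a b ->
  (@lebesgue_measure R).-integrable `[a, b] (EFin \o phi).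
Proof.
move=> cphi; apply: continuous_compact_integrable; first exact: segment_compact.
exact: contin_within.
Qed.

Lemma ri_split phi a b c : a <= b -> b <= c -> contin phi a c ->
  ri phi a c = ri phi a b + ri phi b c.
Proof.
move=> ab bc cphi; have iphi := contin_integrable cphi.
have ibc : (@lebesgue_measure R).-integrable `[b, c] (EFin \o phi).
  apply: contin_integrable => x /andP[bx xc].
  by apply: cphi; rewrite (le_trans ab bx).
rewrite /ri -(@Rintegral_itv_obnd_cbnd _ b (BRight c)).
  have := @Rintegral_itvB R phi (BLeft a) (BRight c) b iphi.
  by rewrite !bnd_simp => /(_ ab bc) <-; ring.
by apply: integrableS ibc => //; by apply: subset_itvr; rewrite bnd_simp.
Qed.

(** The mean value theorem for [G] minus the primitive of [phi]; in this way [G'] itself never has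
    to be integrated. *)
Lemma ri_le phi G (G' : R -> R) a b : a <= b -> contin phi a b ->
  (forall x, a <= x <= b -> is_derive x 1 G (G' x)) ->
  (forall x, a <= x <= b -> phi x <= G' x) ->
  ri phi a b <= G b - G a.
Proof.
rewrite le_eqVlt => /predU1P[<-|ab] cphi dG le.
  by rewrite /ri set_itv1 Rintegral_set1 subrr.
pose F x := ri phi a x.
have iphi := contin_integrable cphi.
have dF x : x \in `]a, b[%R -> is_derive x 1 F (phi x).
  rewrite in_itv/= => /andP[ax xb].
  have [] := continuous_FTC1_closed xb iphi ax (cphi _ _).
    by rewrite (ltW ax) (ltW xb).
  by move=> dx; rewrite derive1E => <-; exact: DeriveDef.
have Fc : {within `[a, b], continuous F}.
  exact: (parameterized_integral_continuous (ltW ab) iphi).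
have Gc : {within `[a, b], continuous G}.
  apply: contin_within => x xab.
  by apply/differentiable_continuous/derivable1_diffP; have [] := dG x xab.
have [x|x|c cab] := @MVT R (G - F) (fun x => G' x - phi x) a b ab.
- move=> xab; have := dF x xab; have : is_derive x 1 G (G' x).
    by apply: dG; move: xab; rewrite in_itv/= => /andP[/ltW-> /ltW->].
  by move=> ? ?; exact: is_deriveB.
- by apply: cvgB; [exact: Gc|exact: Fc].
rewrite /= => e; have Fa : F a = 0 by rewrite /F /ri set_itv1 Rintegral_set1.
have : 0 <= (G' c - phi c) * (b - a).
  apply: mulr_ge0; last by rewrite subr_ge0 ltW.
  rewrite subr_ge0 le//; move: cab; rewrite in_itv/= => /andP[/ltW-> /ltW->//].
rewrite -e -[(G - F) b]/(G b - F b) -[(G - F) a]/(G a - F a) Fa.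
by rewrite /F; lra.
Qed.

Lemma ri_ge phi G (G' : R -> R) a b : a <= b -> contin phi a b ->
  (forall x, a <= x <= b -> is_derive x 1 G (G' x)) ->
  (forall x, a <= x <= b -> G' x <= phi x) ->
  G b - G a <= ri phi a b.
Proof.
rewrite le_eqVlt => /predU1P[<-|ab] cphi dG le.
  by rewrite /ri set_itv1 Rintegral_set1 subrr.
have cN : contin (- phi) a b by move=> x /cphi; exact: continuousN.
have dN x : a <= x <= b -> is_derive x 1 (- G) (- G' x).
  by move=> /dG ?; exact: is_deriveN.
have := ri_le (ltW ab) cN dN.
rewrite -[(- G) b]/(- G b) -[(- G) a]/(- G a).
have -> : ri (- phi) a b = - ri phi a b.
  rewrite /ri -[RHS]mulN1r -RintegralZl//; last exact: contin_integrable.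
  by apply: eq_Rintegral => x _; rewrite mulN1r.
move=> H; have : - ri phi a b <= - G b - - G a.
  by apply: H => x /le; rewrite -[(- phi) x]/(- phi x) lerN2.
lra.
Qed.

(** Adding the linear functions of slopes [e] and [- e] to [G] reduces this to the two one-sided
    comparisons. With [e = 0] it is the fundamental theorem of calculus. *)
Lemma ri_approx phi G (G' : R -> R) a b e : a <= b -> contin phi a b ->
  (forall x, a <= x <= b -> is_derive x 1 G (G' x)) ->
  (forall x, a <= x <= b -> `|phi x - G' x| <= e) ->
  `|ri phi a b - (G b - G a)| <= e * (b - a).
Proof.
move=> ab cphi dG le.
have lin c (x : R) : is_derive x (1 : R) (fun y : R => c * y) c.
  by apply: is_derive_eq; rewrite scaler1.
have dp (c : R) x : a <= x <= b ->
    is_derive x 1 (G + (fun y : R => c * y)) (G' x + c).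
  by move=> /dG ?; apply: is_deriveD; exact: lin.
have up := ri_le ab cphi (dp e).
have lo := ri_ge ab cphi (dp (- e)).
have {}up : ri phi a b <= (G b + e * b) - (G a + e * a).
  by apply: up => x /le; rewrite ler_norml; lra.
have {}lo : (G b + - e * b) - (G a + - e * a) <= ri phi a b.
  by apply: lo => x /le; rewrite ler_norml; lra.
by rewrite ler_norml; apply/andP; split; lra.
Qed.

End segment_integral.

(** * Counterclockwise circulation of [A dx + B dy] around rectangles, and Goursat's theorem *)

Definition loop (R : realType) (A B : R -> R -> R) (x1 x2 y1 y2 : R) : R :=
  ri (A^~ y1) x1 x2 + ri (B x2) y1 y2 - ri (A^~ y2) x1 x2 - ri (B x1) y1 y2.

(* Total differentiability of [A] and [B] at [(x, y)], with the common value
   [b] for [dA/dy] and [dB/dx]. *)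
Definition closed_form_at (R : realType) (A B : R -> R -> R) (x y : R) : Prop :=
  exists a b c : R, forall e, 0 < e -> exists2 d, 0 < d &
    forall h k, `|h| <= d -> `|k| <= d ->
      `|A (x + h) (y + k) - (A x y + a * h + b * k)| <= e * (`|h| + `|k|) /\
      `|B (x + h) (y + k) - (B x y + b * h + c * k)| <= e * (`|h| + `|k|).

Definition closed_form_on (R : realType) (A B : R -> R -> R) (x1 x2 y1 y2 : R)
  : Prop :=
  forall x y, x1 <= x <= x2 -> y1 <= y <= y2 -> closed_form_at A B x y.

Section real_goursat.
Variable R : realType.
Implicit Types (A B : R -> R -> R) (x y : R).

Lemma lin_approx_continuous (f : R -> R) (x a d e : R) : 0 < d -> 0 <= e ->
  (forall h, `|h| <= d -> `|f (x + h) - (f x + a * h)| <= e * `|h|) ->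
  {for x, continuous f}.
Proof.
move=> d0 e0 H; apply/cvgrPdist_le => eps eps0.
have K0 : 0 < e + `|a| + 1 by have := normr_ge0 a; lra.
have m0 : 0 < Num.min d (eps / (e + `|a| + 1)).
  by rewrite lt_min d0 divr_gt0.
near=> t; have htd : `|t - x| <= Num.min d (eps / (e + `|a| + 1)).
  near: t; exists (Num.min d (eps / (e + `|a| + 1))) => //= t /ltW.
  by rewrite /= distrC.
have := H (t - x); have -> : x + (t - x) = t by ring.
move=> /(_ _)/wrap[].
  by apply: le_trans htd _; rewrite ge_min lexx.
move: htd; rewrite le_min => /andP[_]; rewrite ler_pdivlMr// => ht H1.
rewrite distrC.
have -> : f t - f x = (f t - (f x + a * (t - x))) + a * (t - x) by ring.
apply: (le_trans (ler_normD _ _)); rewrite normrM.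
have := normr_ge0 (t - x); nra.
Unshelve. all: by end_near. Qed.

Lemma closed_form_continuous A B x y : closed_form_at A B x y ->
  {for x, continuous (A^~ y)} /\ {for y, continuous (B x)}.
Proof.
move=> [a [b [c /(_ 1 ltr01)[d d0 H]]]]; split.
- apply: (@lin_approx_continuous _ _ a d 1) => // h hd.
  have [|+ _] := H h 0 hd; first by rewrite normr0 ltW.
  by rewrite addr0 mulr0 addr0 normr0 addr0.
- apply: (@lin_approx_continuous _ _ c d 1) => // h hd.
  have [|_] := H 0 h _ hd; first by rewrite normr0 ltW.
  by rewrite addr0 mulr0 addr0 normr0 add0r.
Qed.

Lemma closed_form_contin A B x1 x2 y1 y2 : closed_form_on A B x1 x2 y1 y2 ->
  (forall y, y1 <= y <= y2 -> contin (A^~ y) x1 x2) /\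
  (forall x, x1 <= x <= x2 -> contin (B x) y1 y2).
Proof.
by move=> H; split=> [y hy x hx|x hx y hy];
  have [] := closed_form_continuous (H x y hx hy).
Qed.

Lemma closed_form_sub A B x1 x2 y1 y2 x1' x2' y1' y2' :
  x1 <= x1' -> x2' <= x2 -> y1 <= y1' -> y2' <= y2 ->
  closed_form_on A B x1 x2 y1 y2 -> closed_form_on A B x1' x2' y1' y2'.
Proof. by move=> ? ? ? ? H x y ? ?; apply: H; lra. Qed.

Lemma loop_splitx A B x1 x2 x3 y1 y2 : x1 <= x2 -> x2 <= x3 ->
  y1 <= y2 -> contin (A^~ y1) x1 x3 -> contin (A^~ y2) x1 x3 ->
  loop A B x1 x3 y1 y2 = loop A B x1 x2 y1 y2 + loop A B x2 x3 y1 y2.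
Proof.
move=> h12 h23 _ c1 c2.
by rewrite /loop (ri_split h12 h23 c1) (ri_split h12 h23 c2); ring.
Qed.

Lemma loop_splity A B x1 x2 y1 y2 y3 : x1 <= x2 -> y1 <= y2 ->
  y2 <= y3 -> contin (B x1) y1 y3 -> contin (B x2) y1 y3 ->
  loop A B x1 x2 y1 y3 = loop A B x1 x2 y1 y2 + loop A B x1 x2 y2 y3.
Proof.
move=> _ h12 h23 c1 c2.
by rewrite /loop (ri_split h12 h23 c1) (ri_split h12 h23 c2); ring.
Qed.

Lemma is_derive_quadratic (a b c p x : R) :
  is_derive x (1 : R) (fun t : R => a + b * (t - p) + c * (t - p) ^+ 2 / 2)
    (b + c * (x - p)).
Proof.
apply: is_derive_eq.
rewrite /GRing.scale/=. by field.
Qed.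

(** Up to an error [e L], with [L] half the perimeter, the form is the differential of the quadratic
    [Phi], whose increments cancel around the rectangle; [Phi] exists because the two cross
    derivatives share the value [b]. Integrating the error over the perimeter [2 L] gives
    [2 e L^2]. *)
Lemma loop_small A B p q : closed_form_at A B p q ->
  forall e, 0 < e -> exists2 d, 0 < d & forall x1 x2 y1 y2,
    closed_form_on A B x1 x2 y1 y2 -> x1 <= p <= x2 -> y1 <= q <= y2 ->
    x2 - x1 <= d -> y2 - y1 <= d ->
    `|loop A B x1 x2 y1 y2| <= 2 * e * ((x2 - x1) + (y2 - y1)) ^+ 2.
Proof.
move=> [a [b [c H]]] e e0; have [d d0 {}H] := H e e0.
exists d => // x1 x2 y1 y2 cf /andP[x1p px2] /andP[y1q qy2] dx dy.
have [cA cB] := closed_form_contin cf.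
have x12 : x1 <= x2 by lra.
have y12 : y1 <= y2 by lra.
set L := (x2 - x1) + (y2 - y1).
pose Phi x y := A p q * (x - p) + B p q * (y - q) + a * (x - p) ^+ 2 / 2
  + b * (x - p) * (y - q) + c * (y - q) ^+ 2 / 2.
have est x y : x1 <= x <= x2 -> y1 <= y <= y2 ->
   `|A x y - (A p q + b * (y - q) + a * (x - p))| <= e * L /\
   `|B x y - (B p q + b * (x - p) + c * (y - q))| <= e * L.
  move=> /andP[hx1 hx2] /andP[hy1 hy2].
  have hx : `|x - p| <= x2 - x1 by rewrite ler_norml; apply/andP; split; lra.
  have hy : `|y - q| <= y2 - y1 by rewrite ler_norml; apply/andP; split; lra.
  have [] := H (x - p) (y - q) (le_trans hx dx) (le_trans hy dy).
  have -> : p + (x - p) = x by ring.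
  have -> : q + (y - q) = y by ring.
  move=> HA HB.
  have le : e * (`|x - p| + `|y - q|) <= e * L.
    by rewrite ler_pM2l// lerD.
  split.
    apply: le_trans le; apply: le_trans HA; rewrite le_eqVlt; apply/orP; left.
    by apply/eqP; congr `|_|; ring.
  by apply: le_trans le; apply: le_trans HB.
have EA y : y1 <= y <= y2 ->
    `|ri (A^~ y) x1 x2 - (Phi x2 y - Phi x1 y)| <= e * L * (x2 - x1).
  move=> hy; pose G t := B p q * (y - q) + c * (y - q) ^+ 2 / 2 +
     (A p q + b * (y - q)) * (t - p) + a * (t - p) ^+ 2 / 2.
  have PG t : Phi t y = G t by rewrite /Phi /G; ring.
  rewrite !PG; apply: (@ri_approx _ _ G
      (fun x => (A p q + b * (y - q)) + a * (x - p))) => // [|x hx|x hx].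
  - exact: cA.
  - exact: is_derive_quadratic.
  by have [] := est x y hx hy.
have EB x : x1 <= x <= x2 ->
    `|ri (B x) y1 y2 - (Phi x y2 - Phi x y1)| <= e * L * (y2 - y1).
  move=> hx; pose G t := A p q * (x - p) + a * (x - p) ^+ 2 / 2 +
     (B p q + b * (x - p)) * (t - q) + c * (t - q) ^+ 2 / 2.
  have PG t : Phi x t = G t by rewrite /Phi /G; ring.
  rewrite !PG; apply: (@ri_approx _ _ G
      (fun y => (B p q + b * (x - p)) + c * (y - q))) => // [|y hy|y hy].
  - exact: cB.
  - exact: is_derive_quadratic.
  by have [] := est x y hx hy.
have := EA y1; rewrite lexx y12 => /(_ isT).
have := EA y2; rewrite lexx y12 => /(_ isT).
have := EB x1; rewrite lexx x12 => /(_ isT).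
have := EB x2; rewrite lexx x12 => /(_ isT).
rewrite /loop !ler_norml => /andP[? ?] /andP[? ?] /andP[? ?] /andP[? ?].
have -> : 2 * e * L ^+ 2 = 2 * (e * L * (x2 - x1)) + 2 * (e * L * (y2 - y1)).
  by rewrite /L; ring.
apply/andP; split; lra.
Qed.

Lemma nested_segments (u : nat -> R) (w : R) : 0 <= w ->
  (forall n, u n <= u n.+1 /\ u n.+1 + w / 2 ^+ n.+1 <= u n + w / 2 ^+ n) ->
  exists p, forall n, u n <= p <= u n + w / 2 ^+ n.
Proof.
move=> w0 H.
have up n m : u n <= u (n + m)%N.
  elim: m => [|m IH]; first by rewrite addn0.
  by rewrite addnS (le_trans IH)//; have [] := H (n + m)%N.
have down n m : u (n + m)%N + w / 2 ^+ (n + m) <= u n + w / 2 ^+ n.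
  elim: m => [|m IH]; first by rewrite addn0.
  by rewrite addnS (le_trans _ IH)//; have [] := H (n + m)%N.
have le m n : u m <= u n + w / 2 ^+ n.
  have wk k : 0 <= w / 2 ^+ k by rewrite divr_ge0// exprn_ge0.
  have [mn|/ltnW nm] := leqP m n.
    by rewrite (le_trans (up m (n - m)%N))// subnKC// lerDl.
  by have := down n (m - n)%N; rewrite subnKC//; have := wk m; lra.
have rub : has_ubound (range u).
  by exists (u 0%N + w / 2 ^+ 0) => _ [m _ <-].
exists (sup (range u)) => n; apply/andP; split.
  by apply: ub_le_sup => //; exists n.
apply: ge_sup; first by exists (u 0%N), 0%N.
by move=> _ [m _ <-].
Qed.

(** Bisection: some quarter of a rectangle keeps at least a quarter of its circulation, so
    [c / 4 ^+ n] survives after [n] steps, whereas [loop_small] at the common point bounds it by a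
    small multiple of the squared size, which shrinks by 4 at each step as well. *)
Lemma goursat A B x1 x2 y1 y2 : x1 <= x2 -> y1 <= y2 ->
  closed_form_on A B x1 x2 y1 y2 -> loop A B x1 x2 y1 y2 = 0.
Proof.
move=> x12 y12 cf; apply/eqP/negPn/negP => ne0.
set c := `|loop A B x1 x2 y1 y2|.
have c0 : 0 < c by rewrite normr_gt0.
pose w := x2 - x1; pose h := y2 - y1.
have w0 : 0 <= w by rewrite subr_ge0.
have h0 : 0 <= h by rewrite subr_ge0.
pose inside n (p : R * R) := [/\ x1 <= p.1, p.1 + w / 2 ^+ n <= x2,
  y1 <= p.2 & p.2 + h / 2 ^+ n <= y2].
pose big n (p : R * R) := inside n p /\ c / 4 ^+ n <=
  `|loop A B p.1 (p.1 + w / 2 ^+ n) p.2 (p.2 + h / 2 ^+ n)|.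
(* Outside [big] any pair will do; being total, the step can be turned into a function by
   [choice]. *)
have step np : exists p' : R * R, big np.1 np.2 -> big np.1.+1 p' /\
   [/\ np.2.1 <= p'.1,
     p'.1 + w / 2 ^+ np.1.+1 <= np.2.1 + w / 2 ^+ np.1,
     np.2.2 <= p'.2 & p'.2 + h / 2 ^+ np.1.+1 <= np.2.2 + h / 2 ^+ np.1].
  case: np => n [x y] /=.
  have [|nb] := pselect (big n (x, y)); last by exists (x, y).
  move=> [/= [/= i1 i2 i3 i4]]; rewrite /big /inside /=.
  set W := w / 2 ^+ n.+1; set H := h / 2 ^+ n.+1.
  have -> : w / 2 ^+ n = W + W.
    by rewrite /W exprS; field; rewrite expf_neq0.
  have -> : h / 2 ^+ n = H + H.
    by rewrite /H exprS; field; rewrite expf_neq0.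
  have WW : w / 2 ^+ n = W + W.
    by rewrite /W exprS; field; rewrite expf_neq0.
  have HH : h / 2 ^+ n = H + H.
    by rewrite /H exprS; field; rewrite expf_neq0.
  rewrite WW in i2; rewrite HH in i4.
  have W0 : 0 <= W by rewrite divr_ge0// exprn_ge0.
  have H0 : 0 <= H by rewrite divr_ge0// exprn_ge0.
  have -> : c / 4 ^+ n = 4 * (c / 4 ^+ n.+1).
    by rewrite exprS; field; rewrite expf_neq0.
  set C := c / 4 ^+ n.+1 => bg.
  have cf' : closed_form_on A B x (x + (W + W)) y (y + (H + H)).
    exact: closed_form_sub cf.
  have [cA cB] := closed_form_contin cf'.
  have cA' z u1 u2 : y <= z <= y + (H + H) -> x <= u1 -> u2 <= x + (W + W) ->
     contin (A^~ z) u1 u2.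
    by move=> hz h1 h2 t ht; apply: (cA z hz); lra.
  move: bg; rewrite (@loop_splitx _ _ x (x + W)); [|lra..| |]; last 2 first.
  - by apply: cA; lra.
  - by apply: cA; lra.
  rewrite (@loop_splity _ _ x _ y (y + H)); [|lra..| |]; last 2 first.
  - by apply: cB; lra.
  - by apply: cB; lra.
  rewrite (@loop_splity _ _ (x + W) _ y (y + H)); [|lra..| |]; last 2 first.
  - by apply: cB; lra.
  - by apply: cB; lra.
  move=> bg.
  set m1 := loop A B x (x + W) y (y + H) in bg.
  set m2 := loop A B x (x + W) (y + H) _ in bg.
  set m3 := loop A B (x + W) _ y (y + H) in bg.
  set m4 := loop A B (x + W) _ (y + H) _ in bg.
  clear -i1 i2 i3 i4 W0 H0 bg.
  have [b1|b1] := lerP C `|m1|.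
    exists (x, y) => _ /=; do ! split => //; lra.
  have [b2|b2] := lerP C `|m2|.
    exists (x, y + H) => _ /=.
    by do ! split => //; rewrite -?addrA //; lra.
  have [b3|b3] := lerP C `|m3|.
    exists (x + W, y) => _ /=.
    by do ! split => //; rewrite -?addrA //; lra.
  have [b4|b4] := lerP C `|m4|.
    exists (x + W, y + H) => _ /=.
    by do ! split => //; rewrite -?addrA //; lra.
  have := le_trans bg (ler_normD _ _); have := ler_normD m1 m2.
  have := ler_normD m3 m4; lra.
have [F HF] := choice step.
pose p := fix p n := if n is m.+1 then F (m, p m) else (x1, y1).
have bigp n : big n (p n).
  elim: n => [|n IH]; last by have [] := HF (n, p n) IH.
  split; first by split => //=; rewrite divr1 /w /h; lra.
  by rewrite /= !divr1 /w /h /c !subrKC.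
have [px hpx] : exists q, forall n, (p n).1 <= q <= (p n).1 + w / 2 ^+ n.
  by apply: nested_segments => // n; have [_ []] := HF (n, p n) (bigp n).
have [py hpy] : exists q, forall n, (p n).2 <= q <= (p n).2 + h / 2 ^+ n.
  by apply: nested_segments => // n; have [_ []] := HF (n, p n) (bigp n).
have cfp : closed_form_at A B px py.
  have := hpx 0%N; have := hpy 0%N; rewrite /= !divr1 /w /h => ? ?.
  by apply: cf; lra.
(* Makes [2 e (w + h)^2 < c]; the added 1 covers a rectangle reduced to a point. *)
pose e := c / (4 * (w + h + 1) ^+ 2).
have wh1 : 0 < w + h + 1 by lra.
have e0 : 0 < e by rewrite divr_gt0// mulr_gt0// exprn_gt0.
have [d d0 small] := loop_small cfp e0.
have [n hn] : exists n : nat, (w + h) / d < 2 ^+ n.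
  have hn := archi_boundP (divr_ge0 (addr_ge0 w0 h0) (ltW d0)).
  exists (Num.bound ((w + h) / d)); apply: (lt_le_trans hn).
  by rewrite -natrX ler_nat ltnW// ltn_expl.
have pow0 : (0 : R) < 2 ^+ n by rewrite exprn_gt0.
have whn : (w + h) / 2 ^+ n <= d.
  by rewrite ler_pdivrMr// mulrC -ler_pdivrMr// ltW.
have wn0 : 0 <= w / 2 ^+ n by rewrite divr_ge0// ltW.
have hn0 : 0 <= h / 2 ^+ n by rewrite divr_ge0// ltW.
have [[i1 i2 i3 i4] bg] := bigp n.
move: whn; rewrite mulrDl => whn.
have sm := small (p n).1 ((p n).1 + w / 2 ^+ n) (p n).2 ((p n).2 + h / 2 ^+ n).
have {}sm := sm (closed_form_sub i1 i2 i3 i4 cf) (hpx n) (hpy n).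
have {sm} := sm ltac:(lra) ltac:(lra).
move=> /(le_trans bg).
rewrite [_ + w / _]addrC addrK [_ + h / _]addrC addrK -mulrDl.
have -> : (4 : R) ^+ n = 2 ^+ n ^+ 2 by rewrite -exprM mulnC exprM; congr (_ ^+ n); ring.
rewrite expr_div_n mulrA ler_pM2r ?invr_gt0 ?exprn_gt0// leNgt => /negP; apply.
rewrite /e; set s := w + h + 1.
have -> : 2 * (c / (4 * s ^+ 2)) * (w + h) ^+ 2 = c * ((w + h) ^+ 2 / (2 * s ^+ 2)).
  by field; rewrite gt_eqF.
rewrite -[ltRHS]mulr1 ltr_pM2l// ltr_pdivrMr ?mulr_gt0 ?exprn_gt0//.
rewrite mul1r /s; nra.
Qed.

End real_goursat.

(** * The modulus as a real number *)

Section cabs_theory.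
Variable R : realType.
Implicit Types (a b z w : R[i]) (x y : R).

Lemma cabsE x y : cabs (x +i* y) = Num.sqrt (x ^+ 2 + y ^+ 2).
Proof. by []. Qed.

Lemma cabsM a b : cabs (a * b) = cabs a * cabs b.
Proof. exact: ComplexField.Normc.normcM. Qed.

Lemma cabsV a : cabs a^-1 = (cabs a)^-1.
Proof. exact: ComplexField.Normc.normcV. Qed.

Lemma cabs0 : cabs (0 : R[i]) = 0.
Proof. exact: ComplexField.Normc.normc0. Qed.

Lemma cabs1 : cabs (1 : R[i]) = 1.
Proof. exact: ComplexField.Normc.normc1. Qed.

Lemma cabs_ge0 a : 0 <= cabs a.
Proof. by case: a => x y; exact: sqrtr_ge0. Qed.

Lemma norm_cabs a : `|a| = (cabs a)%:C.
Proof. by case: a. Qed.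

Lemma cabsD a b : cabs (a + b) <= cabs a + cabs b.
Proof. by rewrite -lecR rmorphD/= -!norm_cabs ler_normD. Qed.

Lemma cabsN a : cabs (- a) = cabs a.
Proof. by apply: (@complexI R); rewrite -!norm_cabs normrN. Qed.

Lemma cabsB a b : cabs (a - b) <= cabs a + cabs b.
Proof. by rewrite -(cabsN b) cabsD. Qed.

Lemma cabsC a b : cabs (a - b) = cabs (b - a).
Proof. by rewrite -cabsN opprB. Qed.

Lemma cabs_subr a b : cabs a - cabs b <= cabs (a - b).
Proof. by have := cabsD (a - b) b; rewrite subrK; lra. Qed.

Lemma cabs_real x : cabs x%:C = `|x|.
Proof. by rewrite cabsE expr0n/= addr0 sqrtr_sqr. Qed.

Lemma cabs_eq0 a : (cabs a == 0) = (a == 0).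
Proof.
by apply/eqP/eqP => [/ComplexField.Normc.eq0_normc//|->]; exact: cabs0.
Qed.

Lemma cabs_gt0 a : (0 < cabs a) = (a != 0).
Proof. by rewrite lt_def cabs_ge0 andbT cabs_eq0. Qed.

Lemma cabsX a n : cabs (a ^+ n) = cabs a ^+ n.
Proof. by elim: n => [|n IH]; rewrite ?expr0 ?cabs1// !exprS cabsM IH. Qed.

Lemma cabs_sqr x y : cabs (x +i* y) ^+ 2 = x ^+ 2 + y ^+ 2.
Proof. by rewrite cabsE sqr_sqrtr// addr_ge0// sqr_ge0. Qed.

Lemma Re_le_cabs a : `|complex.Re a| <= cabs a.
Proof. by case: a => x y; rewrite cabsE -sqrtr_sqr ler_wsqrtr//= lerDl sqr_ge0. Qed.

Lemma Im_le_cabs a : `|complex.Im a| <= cabs a.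
Proof. by case: a => x y; rewrite cabsE -sqrtr_sqr ler_wsqrtr//= lerDr sqr_ge0. Qed.

Lemma cabs_le_norms x y : cabs (x +i* y) <= `|x| + `|y|.
Proof.
have := normr_ge0 x; have := normr_ge0 y => y0 x0.
rewrite -(@ler_pXn2r _ 2%N) ?nnegrE ?cabs_ge0 ?addr_ge0//.
by rewrite cabs_sqr -(real_normK (num_real x)) -(real_normK (num_real y)); nra.
Qed.

End cabs_theory.

(** * Complex derivatives in one variable, with real error bounds *)

Definition cderiv (R : realType) (f : R[i] -> R[i]) (z c : R[i]) : Prop :=
  forall e : R, 0 < e -> exists2 d : R, 0 < d & forall h, cabs h <= d ->
    cabs (f (z + h) - f z - c * h) <= e * cabs h.

Section cderiv_theory.
Variable R : realType.
Implicit Types (f g : R[i] -> R[i]) (z c : R[i]).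

Lemma cderiv_lip f z c : cderiv f z c ->
  exists2 d : R, 0 < d & forall h, cabs h <= d ->
    cabs (f (z + h) - f z) <= (cabs c + 1) * cabs h.
Proof.
move=> /(_ 1 ltr01)[d d0 H]; exists d => // h /H.
rewrite mul1r => {}H; rewrite mulrDl mul1r -cabsM.
by have := cabsD (f (z + h) - f z - c * h) (c * h); rewrite subrK; lra.
Qed.

Lemma cderiv_cst c z : cderiv (fun=> c) z 0.
Proof.
move=> e e0; exists 1 => // h _; rewrite subrr mul0r subr0 cabs0.
by rewrite mulr_ge0 ?cabs_ge0// ltW.
Qed.

Lemma cderiv_id z : cderiv (fun w => w) z 1.
Proof.
move=> e e0; exists 1 => // h _; have -> : z + h - z - 1 * h = 0 by ring.
rewrite cabs0.
by rewrite mulr_ge0 ?cabs_ge0// ltW.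
Qed.

Lemma cderivD f g z a b : cderiv f z a -> cderiv g z b ->
  cderiv (fun w => f w + g w) z (a + b).
Proof.
move=> df dg e e0; have e20 : 0 < e / 2 by rewrite divr_gt0.
have [d1 d10 H1] := df _ e20; have [d2 d20 H2] := dg _ e20.
exists (Num.min d1 d2); first by rewrite lt_min d10.
move=> h; rewrite le_min => /andP[/H1 {}H1 /H2 {}H2].
have -> : f (z + h) + g (z + h) - (f z + g z) - (a + b) * h =
  (f (z + h) - f z - a * h) + (g (z + h) - g z - b * h) by ring.
by apply: (le_trans (cabsD _ _)); lra.
Qed.

Lemma cderivM f g z a b : cderiv f z a -> cderiv g z b ->
  cderiv (fun w => f w * g w) z (a * g z + f z * b).
Proof.
move=> df dg e e0.
have [d3 d30 Lg] := cderiv_lip dg.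
(* A common bound for [|g (z + h)|] when [|h| <= d3], for [|f z|] and for [|a| (|b| + 1)], so that
   each of the three error terms is at most [e |h| / 3]. *)
set K := cabs (g z) + (cabs b + 1) * d3 + cabs (f z) + cabs a * (cabs b + 1) + 1.
have b1 : 0 <= cabs b + 1 by rewrite addr_ge0 ?cabs_ge0.
have K1 : 1 <= K.
  rewrite /K lerDr !addr_ge0 ?cabs_ge0// mulr_ge0 ?cabs_ge0//; exact: ltW.
have K0 : 0 < K by lra.
have eK0 : 0 < e / (3 * K) by rewrite divr_gt0// mulr_gt0.
have [d1 d10 H1] := df _ eK0; have [d2 d20 H2] := dg _ eK0.
set e' := e / (3 * K) in eK0 H1 H2.
exists (Num.min (Num.min d1 d2) (Num.min d3 e')).
  by rewrite !lt_min d10 d20 d30.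
move=> h; rewrite !le_min => /andP[/andP[/H1 {}H1 /H2 {}H2] /andP[h3 he]].
have {}Lg := Lg _ h3.
have -> : f (z + h) * g (z + h) - f z * g z - (a * g z + f z * b) * h =
  (f (z + h) - f z - a * h) * g (z + h) + f z * (g (z + h) - g z - b * h)
  + a * h * (g (z + h) - g z) by ring.
have h0 := cabs_ge0 h.
have gK : cabs (g (z + h)) <= K.
  have := cabsD (g (z + h) - g z) (g z); rewrite subrK => /le_trans; apply.
  rewrite /K; have : (cabs b + 1) * cabs h <= (cabs b + 1) * d3 by rewrite ler_wpM2l.
  have := cabs_ge0 (f z); have := mulr_ge0 (cabs_ge0 a) b1; lra.
have fK : cabs (f z) <= K.
  rewrite /K; have := cabs_ge0 (g z); have := mulr_ge0 (cabs_ge0 a) b1.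
  have := mulr_ge0 b1 (ltW d30); lra.
have aK : cabs a * (cabs b + 1) <= K.
  rewrite /K; have := cabs_ge0 (g z); have := cabs_ge0 (f z).
  have := mulr_ge0 b1 (ltW d30); lra.
have t1 : cabs ((f (z + h) - f z - a * h) * g (z + h)) <= e' * cabs h * K.
  by rewrite cabsM ler_pM ?cabs_ge0.
have t2 : cabs (f z * (g (z + h) - g z - b * h)) <= K * (e' * cabs h).
  by rewrite cabsM ler_pM ?cabs_ge0.
have t3 : cabs (a * h * (g (z + h) - g z)) <= K * (e' * cabs h).
  rewrite !cabsM.
  apply: (@le_trans _ _ (cabs a * cabs h * ((cabs b + 1) * cabs h))).
    by rewrite ler_wpM2l// mulr_ge0 ?cabs_ge0.
  have -> : cabs a * cabs h * ((cabs b + 1) * cabs h) =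
    (cabs a * (cabs b + 1)) * (cabs h * cabs h) by ring.
  by apply: ler_pM; rewrite ?mulr_ge0 ?cabs_ge0// ler_wpM2r.
apply: (le_trans (cabsD _ _)); apply: (@le_trans _ _ (3 * K * e' * cabs h)).
  by have := cabsD ((f (z + h) - f z - a * h) * g (z + h))
    (f z * (g (z + h) - g z - b * h)); lra.
by rewrite /e' [3 * K * _]mulrC divfK// gt_eqF// mulr_gt0.
Qed.

Lemma cderivV f z a : f z != 0 -> cderiv f z a ->
  cderiv (fun w => (f w)^-1) z (- a / f z ^+ 2).
Proof.
move=> fz0 df e e0; have m0 : 0 < cabs (f z) by rewrite cabs_gt0.
set m := cabs (f z) in m0.
have [d1 d10 Lf] := cderiv_lip df.
set L := cabs a + 1 in Lf.
have L0 : 0 < L by rewrite ltr_wpDl ?cabs_ge0.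
have e1 : 0 < e * m ^+ 2 / 4 by rewrite divr_gt0// mulr_gt0// exprn_gt0.
have [d2 d20 H2] := df _ e1.
(* Together with [|f (z + h)| >= m / 2], this keeps the quadratic remainder
   [(F - f z)^2 / (F (f z)^2)] below [e |h| / 2]. *)
set d4 := e * m ^+ 3 / (4 * L ^+ 2).
have d40 : 0 < d4 by rewrite divr_gt0 ?mulr_gt0 ?exprn_gt0.
exists (Num.min (Num.min d1 d2) (Num.min (m / (2 * L)) d4)).
  by rewrite !lt_min d10 d20 d40 divr_gt0// mulr_gt0.
move=> h; rewrite !le_min => /andP[/andP[/Lf {}Lf /H2 {}H2] /andP[h3 h4]].
have h0 := cabs_ge0 h.
have fh : m / 2 <= cabs (f (z + h)).
  move: h3; rewrite ler_pdivlMr ?mulr_gt0// => h3.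
  have := cabs_subr (f z) (f z - f (z + h)); rewrite subKr cabsC -/m; nra.
have fh0 : f (z + h) != 0 by rewrite -cabs_gt0; lra.
set F := f (z + h) in fh fh0 Lf H2 *.
have -> : F^-1 - (f z)^-1 - - a / f z ^+ 2 * h =
  (F - f z) ^+ 2 / (F * f z ^+ 2) - (F - f z - a * h) / f z ^+ 2.
  by field; rewrite fz0 fh0.
apply: (le_trans (cabsB _ _)).
have -> : cabs ((F - f z) ^+ 2 / (F * f z ^+ 2)) =
    cabs (F - f z) ^+ 2 / (cabs F * m ^+ 2).
  by rewrite cabsM cabsV [cabs (F * _)]cabsM !cabsX.
rewrite cabsM cabsV cabsX -/m.
have t1 : cabs (F - f z - a * h) / m ^+ 2 <= e / 4 * cabs h.
  rewrite ler_pdivrMr ?exprn_gt0//; apply: (le_trans H2).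
  by rewrite le_eqVlt; apply/orP; left; apply/eqP; field.
have t2 : cabs (F - f z) ^+ 2 / (cabs F * m ^+ 2) <= e / 2 * cabs h.
  rewrite ler_pdivrMr; last by rewrite mulr_gt0 ?exprn_gt0//; lra.
  apply: (@le_trans _ _ ((L * cabs h) ^+ 2)).
    by rewrite ler_pXn2r// nnegrE ?cabs_ge0// mulr_ge0// ltW.
  move: h4; rewrite /d4 ler_pdivlMr ?mulr_gt0 ?exprn_gt0// => h4.
  apply: (@le_trans _ _ (e / 2 * cabs h * (m / 2 * m ^+ 2))).
    have -> : (L * cabs h) ^+ 2 = cabs h * (cabs h * (4 * L ^+ 2)) / 4 by field.
    have -> : e / 2 * cabs h * (m / 2 * m ^+ 2) = cabs h * (e * m ^+ 3) / 4.
      by field.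
    by rewrite ler_pM2r ?invr_gt0//; apply: ler_wpM2l.
  apply: ler_wpM2l; first by rewrite mulr_ge0// ltW// divr_gt0.
  by rewrite ler_pM2r// exprn_gt0.
have := mulr_ge0 (ltW e0) h0; lra.
Qed.

Lemma cderiv_near f g z a : cderiv f z a ->
  (exists2 d : R, 0 < d & forall h, cabs h <= d -> f (z + h) = g (z + h)) ->
  cderiv g z a.
Proof.
move=> df [d d0 fg] e /df[d1 d10 H]; exists (Num.min d d1).
  by rewrite lt_min d0.
move=> h; rewrite le_min => /andP[hd /H]; rewrite (fg _ hd).
by have := fg 0; rewrite cabs0 addr0 => -> //; exact: ltW.
Qed.

(* [Im (q(z) dz) = Im q dx + Re q dy], and the Cauchy-Riemann equations say
   that this form is closed. *)
Lemma cderiv_closed_form (q : R[i] -> R[i]) x y c : cderiv q (x +i* y) c ->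
  closed_form_at (fun s t => complex.Im (q (s +i* t)))
                 (fun s t => complex.Re (q (s +i* t))) x y.
Proof.
case: c => al be dq; exists be, al, (- be) => e e0.
have [d d0 H] := dq e e0; exists (d / 2); first by rewrite divr_gt0.
move=> h k hd kd; have := H (h +i* k).
have le := cabs_le_norms h k.
move=> /(_ ltac:(lra)).
have -> : x +i* y + h +i* k = (x + h) +i* (y + k) :> R[i] by [].
set q1 := q _; set q0 := q _ => {}H.
have {}H : cabs (q1 - q0 - (al +i* be) * (h +i* k)) <= e * (`|h| + `|k|).
  by apply: (le_trans H); rewrite ler_pM2l.
split; last first.
  apply: le_trans H; apply: le_trans (Re_le_cabs _).
  rewrite le_eqVlt; apply/orP; left; apply/eqP; congr `|_|.
  by case: q1 => ? ?; case: q0 => ? ? /=; ring.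
apply: le_trans H; apply: le_trans (Im_le_cabs _).
rewrite le_eqVlt; apply/orP; left; apply/eqP; congr `|_|.
by case: q1 => ? ?; case: q0 => ? ? /=; ring.
Qed.

End cderiv_theory.

(** * Cauchy's estimate for the derivative at the origin *)

Section cauchy_estimate.
Variable R : realType.
Implicit Types (f g : R[i] -> R[i]) (z c : R[i]).

Lemma is_derive_linear (K x : R) : is_derive x (1 : R) (fun t : R => K * t) K.
Proof. by apply: is_derive_eq; rewrite scaler1. Qed.

Lemma ri_ub (phi : R -> R) a b K : a <= b -> contin phi a b ->
  (forall x, a <= x <= b -> phi x <= K) -> ri phi a b <= K * (b - a).
Proof.
move=> ab cphi le; rewrite mulrBr.
by apply: (@ri_le _ _ (fun t => K * t) (fun=> K)) => // x _; exact: is_derive_linear.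
Qed.

Lemma ri_lb (phi : R -> R) a b K : a <= b -> contin phi a b ->
  (forall x, a <= x <= b -> K <= phi x) -> K * (b - a) <= ri phi a b.
Proof.
move=> ab cphi le; rewrite mulrBr.
by apply: (@ri_ge _ _ (fun t => K * t) (fun=> K)) => // x _; exact: is_derive_linear.
Qed.

(** Cutting at [x = -s] and [x = s], then the middle strip at [y = -s] and [y = s], leaves four
    rectangles that avoid the origin, to which [goursat] applies. *)
Lemma loop_puncture (A B : R -> R -> R) (l s : R) : 0 < s -> s < l ->
  (forall x y, -l <= x <= l -> -l <= y <= l -> x != 0 \/ y != 0 ->
    closed_form_at A B x y) ->
  loop A B (-l) l (-l) l = loop A B (-s) s (-s) s.
Proof.
move=> s0 sl cf.
have cA y a b : -l <= y <= l -> y != 0 -> -l <= a -> b <= l -> contin (A^~ y) a b.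
  move=> yl y0 la bl x xab.
  by have [] := closed_form_continuous (cf x y ltac:(lra) yl (or_intror y0)).
have cB x a b : -l <= x <= l -> x != 0 -> -l <= a -> b <= l -> contin (B x) a b.
  move=> xl x0 la bl y yab.
  by have [] := closed_form_continuous (cf x y xl ltac:(lra) (or_introl x0)).
have sx x : s <= x -> x != 0 by move=> h; rewrite gt_eqF//; lra.
have sNx x : x <= -s -> x != 0 by move=> h; rewrite lt_eqF//; lra.
rewrite (@loop_splitx _ _ _ (-l) (-s) l); [|lra..| |]; last 2 first.
- by apply: cA; rewrite ?sNx//; lra.
- by apply: cA; rewrite ?sx//; lra.
rewrite (@loop_splitx _ _ _ (-s) s l); [|lra..| |]; last 2 first.
- by apply: cA; rewrite ?sNx//; lra.
- by apply: cA; rewrite ?sx//; lra.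
rewrite (@loop_splity _ _ _ (-s) s (-l) (-s) l); [|lra..| |]; last 2 first.
- by apply: cB; rewrite ?sNx//; lra.
- by apply: cB; rewrite ?sx//; lra.
rewrite (@loop_splity _ _ _ (-s) s (-s) s l); [|lra..| |]; last 2 first.
- by apply: cB; rewrite ?sNx//; lra.
- by apply: cB; rewrite ?sx//; lra.
rewrite [X in X + _]goursat; [|lra..|]; last first.
  by move=> x y hx hy; apply: cf; [lra|lra|left; apply: sNx; lra].
rewrite [X in _ + (X + _ + _)]goursat; [|lra..|]; last first.
  by move=> x y hx hy; apply: cf; [lra|lra|right; apply: sNx; lra].
rewrite [X in _ + (_ + (_ + X) + _)]goursat; [|lra..|]; last first.
  by move=> x y hx hy; apply: cf; [lra|lra|right; apply: sx; lra].
rewrite [X in _ + (_ + X)]goursat; [|lra..|]; last first.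
  by move=> x y hx hy; apply: cf; [lra|lra|left; apply: sx; lra].
by rewrite !add0r !addr0.
Qed.

Lemma cabs_square_lt (x y l : R) : 0 < l -> -l <= x <= l -> -l <= y <= l ->
  cabs (x +i* y) < 2 * l.
Proof.
move=> l0 hx hy; rewrite -(@ltr_pXn2r _ 2%N) ?nnegrE ?cabs_ge0//; last by lra.
by rewrite cabs_sqr; nra.
Qed.

(* If [f] were smaller than [l/2] on the square, [q(z) = (f z - z)/z^2] would be
   close to [-1/z] on its boundary and [Im q(z) dz] negative along each side;
   but the integral is the one along arbitrarily small squares, where it tends
   to 0 because [f z - z = o(z)]. *)
Lemma cauchy_estimate_unit f (l K : R) : 0 < l ->
  (forall z, cabs z < 2 * l -> exists c, cderiv f z c) ->
  f 0 = 0 -> cderiv f 0 1 -> (forall z, cabs z < 2 * l -> cabs (f z) <= K) ->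
  l / 2 <= K.
Proof.
move=> l0 df f0 df0 fK; rewrite leNgt; apply/negP => Kl.
pose q z := (f z - z) * (z ^+ 2)^-1.
have dq z : cabs z < 2 * l -> z != 0 -> exists c, cderiv q z c.
  move=> /df[c dc] z0; eexists; apply: cderivM.
    apply: cderivD; first exact: dc.
    pose m1 : R[i] := -1.
    apply: (@cderiv_near _ (fun w => m1 * w)); last first.
      by exists 1 => // h _; rewrite mulN1r.
    apply: cderivM; [exact: cderiv_cst|exact: cderiv_id].
  apply: cderivV; first by rewrite expf_neq0.
  exact: (cderivM (cderiv_id z) (cderiv_id z)).
pose A s t := complex.Im (q (s +i* t)).
pose B s t := complex.Re (q (s +i* t)).
have cf x y : -l <= x <= l -> -l <= y <= l -> x != 0 \/ y != 0 ->
    closed_form_at A B x y.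
  move=> hx hy nz; have [c dc] : exists c, cderiv q (x +i* y) c.
    apply: dq; first exact: cabs_square_lt.
    by rewrite eq_complex/= negb_and; case: nz => ->; rewrite ?orbT.
  exact: cderiv_closed_form dc.
have cA y a b : -l <= y <= l -> y != 0 -> -l <= a -> b <= l -> contin (A^~ y) a b.
  move=> yl y0 la bl x xab.
  by have [] := closed_form_continuous (cf x y ltac:(lra) yl (or_intror y0)).
have cB x a b : -l <= x <= l -> x != 0 -> -l <= a -> b <= l -> contin (B x) a b.
  move=> xl x0 la bl y yab.
  by have [] := closed_form_continuous (cf x y xl ltac:(lra) (or_introl x0)).
(* On the boundary [l^2 <= |z|^2 <= 2 l^2]: there [K / l^2] bounds [|f z / z^2|], while [-1/z]
   contributes, with orientation, at most [- l / |z|^2 <= - 1 / (2 l)] per unit length. That [M < 0]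
   is the assumption [K < l / 2]. *)
pose M := K / l ^+ 2 - (2 * l)^-1.
have l20 : 0 < l ^+ 2 by rewrite exprn_gt0.
have ln0 : (l != 0) * (- l != 0) by rewrite oppr_eq0 gt_eqF.
have M0 : M < 0.
  rewrite /M subr_lt0 ltr_pdivrMr// ltr_pdivlMl ?mulr_gt0//.
  by rewrite expr2; nra.
have bnd x y : -l <= x <= l -> -l <= y <= l -> `|x| = l \/ `|y| = l ->
    `|B x y + x / (x ^+ 2 + y ^+ 2)| <= K / l ^+ 2 /\
    `|A x y - y / (x ^+ 2 + y ^+ 2)| <= K / l ^+ 2 /\
    (2 * l)^-1 <= l / (x ^+ 2 + y ^+ 2).
  move=> hx hy hxy; set N := x ^+ 2 + y ^+ 2.
  have Nl : l ^+ 2 <= N.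
    rewrite /N; have [<-|<-] := hxy; rewrite real_normK ?num_real//.
      by rewrite lerDl sqr_ge0.
    by rewrite lerDr sqr_ge0.
  have N2l : N <= 2 * l ^+ 2 by rewrite /N !expr2; nra.
  have N0 : 0 < N by lra.
  set z := x +i* y.
  have z0 : z != 0.
    by rewrite -cabs_gt0 -(@ltr_pXn2r _ 2%N) ?nnegrE ?cabs_ge0// expr0n/= cabs_sqr.
  have zV : z^-1 = (x / N) +i* (- (y / N)) by [].
  have qz : q z + z^-1 = f z * (z ^+ 2)^-1 by rewrite /q; field.
  have qb : cabs (q z + z^-1) <= K / l ^+ 2.
    rewrite qz cabsM cabsV cabsX cabs_sqr -/N.
    apply: ler_pM; rewrite ?cabs_ge0 ?invr_ge0 ?(ltW N0)//.
      by apply: fK; exact: cabs_square_lt.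
    by rewrite lef_pV2.
  split; last split.
  - apply: le_trans qb; apply: le_trans (Re_le_cabs _); rewrite /B -/z zV.
    by case: (q z).
  - apply: le_trans qb; apply: le_trans (Im_le_cabs _); rewrite /A -/z zV.
    by case: (q z).
  - rewrite ler_pdivlMr// mulrC ler_pdivrMr ?mulr_gt0//.
    by move: N2l; rewrite expr2; lra.
have ll : -l <= l by lra.
have labs : `|l| = l /\ `|- l| = l by rewrite normrN gtr0_norm.
have [abl abNl] := labs.
have l_itv : (-l <= l <= l) && (-l <= -l <= l) by rewrite !lexx !ll.
have /andP[il iNl] := l_itv.
have big : loop A B (-l) l (-l) l <= 8 * l * M.
  have bot : ri (A^~ (-l)) (-l) l <= M * (l - - l).
    apply: (ri_ub ll) => [|x hx]; first by apply: cA; rewrite ?ln0 ?il ?iNl ?lexx.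
    have [_ []] := bnd x (-l) hx iNl (or_intror abNl).
    by rewrite ler_norml /M mulNr; lra.
  have right : ri (B l) (-l) l <= M * (l - - l).
    apply: (ri_ub ll) => [|y hy]; first by apply: cB; rewrite ?ln0 ?il ?iNl ?lexx.
    have [+ [_ +]] := bnd l y il hy (or_introl abl).
    by rewrite ler_norml /M; lra.
  have top : - M * (l - - l) <= ri (A^~ l) (-l) l.
    apply: (ri_lb ll) => [|x hx]; first by apply: cA; rewrite ?ln0 ?il ?iNl ?lexx.
    have [_ []] := bnd x l hx il (or_intror abl).
    by rewrite ler_norml /M; lra.
  have left : - M * (l - - l) <= ri (B (-l)) (-l) l.
    apply: (ri_lb ll) => [|y hy]; first by apply: cB; rewrite ?ln0 ?il ?iNl ?lexx.
    have [+ [_ +]] := bnd (-l) y iNl hy (or_introl abNl).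
    by rewrite ler_norml /M mulNr; lra.
  rewrite /loop; move: bot right top left; rewrite opprK.
  by clear; lra.
(* The small square then contributes at least [- 8 e = 4 l M], which exceeds the bound [8 l M] for
   the large one since [M < 0]. *)
pose e := - (l * M) / 2.
have e0 : 0 < e by rewrite /e; nra.
have [d d0 small] := df0 e e0.
pose s := Num.min (d / 2) (l / 2).
have s0 : 0 < s by rewrite lt_min !divr_gt0.
have sd : s <= d / 2 by rewrite ge_min lexx.
have sl2 : s <= l / 2 by rewrite ge_min lexx orbT.
have sl : s < l by lra.
have es0 : 0 < e / s by rewrite divr_gt0.
have qs x y : -s <= x <= s -> -s <= y <= s -> `|x| = s \/ `|y| = s ->
    `|A x y| <= e / s /\ `|B x y| <= e / s.
  move=> hx hy hxy; set z := x +i* y.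
  have zs : s <= cabs z.
    by case: hxy => <-; [exact: (Re_le_cabs z)|exact: (Im_le_cabs z)].
  have z0 : z != 0 by rewrite -cabs_gt0; lra.
  have zc : 0 < cabs z by rewrite cabs_gt0.
  have qz : cabs (q z) <= e / s.
    rewrite cabsM cabsV cabsX ler_pdivrMr ?exprn_gt0//.
    have := small z; rewrite add0r f0 subr0 mul1r => /(_ _)/wrap[].
      by have := cabs_square_lt s0 hx hy; rewrite -/z; lra.
    move/le_trans; apply.
    have -> : e / s * cabs z ^+ 2 = e * cabs z * (cabs z / s).
      by field; rewrite gt_eqF.
    apply: ler_peMr; last by rewrite ler_pdivlMr// mul1r.
    by rewrite mulr_ge0 ?(ltW e0) ?cabs_ge0.
  by split; apply: le_trans qz; [exact: Im_le_cabs|exact: Re_le_cabs].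
have ss : -s <= s by lra.
have lNs : -l <= -s by rewrite lerN2 ltW.
have sn0 : (s != 0) * (- s != 0) by rewrite oppr_eq0 gt_eqF.
have isl : (-l <= s <= l) && (-l <= -s <= l).
  by rewrite lNs (ltW sl) (le_trans lNs ss) (le_trans ss (ltW sl)).
have /andP[isl1 isl2] := isl.
have abs_s : `|s| = s by rewrite gtr0_norm.
have absNs : `|- s| = s by rewrite normrN gtr0_norm.
have is1 : -s <= s <= s by rewrite ss lexx.
have is2 : -s <= -s <= s by rewrite ss lexx.
have center : - (8 * e) <= loop A B (-s) s (-s) s.
  have bot : - (e / s) * (s - - s) <= ri (A^~ (-s)) (-s) s.
    apply: (ri_lb ss) => [|x hx].
      by apply: cA; rewrite ?sn0 ?isl1 ?isl2 ?lNs ?(ltW sl).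
    by have [+ _] := qs x (-s) hx is2 (or_intror absNs); rewrite ler_norml => /andP[].
  have right : - (e / s) * (s - - s) <= ri (B s) (-s) s.
    apply: (ri_lb ss) => [|y hy].
      by apply: cB; rewrite ?sn0 ?isl1 ?isl2 ?lNs ?(ltW sl).
    by have [_] := qs s y is1 hy (or_introl abs_s); rewrite ler_norml => /andP[].
  have top : ri (A^~ s) (-s) s <= e / s * (s - - s).
    apply: (ri_ub ss) => [|x hx].
      by apply: cA; rewrite ?sn0 ?isl1 ?isl2 ?lNs ?(ltW sl).
    by have [+ _] := qs x s hx is1 (or_intror abs_s); rewrite ler_norml => /andP[].
  have left : ri (B (-s)) (-s) s <= e / s * (s - - s).
    apply: (ri_ub ss) => [|y hy].
      by apply: cB; rewrite ?sn0 ?isl1 ?isl2 ?lNs ?(ltW sl).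
    by have [_] := qs (-s) y is2 hy (or_introl absNs); rewrite ler_norml => /andP[].
  have es : e / s * (s - - s) = 2 * e by field; rewrite gt_eqF.
  rewrite /loop; move: bot right top left; rewrite mulNr es.
  by clear; lra.
have eq := loop_puncture s0 sl cf.
move: big center; rewrite eq /e.
have : l * M < 0 by rewrite pmulr_rlt0.
by clear; lra.
Qed.

(** The normalised case applies to [(f - f 0) / c], bounded by [2 K / |c|], with [l = r / 2]. The
    resulting 8, where the sharp constant is 1, propagates into all later constants. *)
Lemma cauchy_estimate0 f (r K : R) c : 0 < r ->
  (forall z, cabs z < r -> exists c, cderiv f z c) ->
  cderiv f 0 c -> (forall z, cabs z < r -> cabs (f z) <= K) ->
  cabs c <= 8 * K / r.
Proof.
move=> r0 df dc fK; have [->|c0] := eqVneq c 0.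
  have := fK 0; rewrite cabs0 => /(_ r0) h.
  by rewrite divr_ge0 ?(ltW r0)// mulr_ge0// (le_trans _ h) ?cabs_ge0.
have cc : 0 < cabs c by rewrite cabs_gt0.
pose g z := c^-1 * (f z + - f 0).
have dg z a : cderiv f z a -> cderiv g z (0 * (f z + - f 0) + c^-1 * (a + 0)).
  move=> da; apply: (cderivM (cderiv_cst _ _)).
  by apply: (cderivD da); exact: cderiv_cst.
have r20 : 0 < r / 2 by rewrite divr_gt0.
have r2 : 2 * (r / 2) = r by field.
have := @cauchy_estimate_unit g (r / 2) ((cabs c)^-1 * (2 * K)) r20.
rewrite r2 => /(_ _)/wrap[].
  by move=> z /df[a /dg dga]; eexists; exact: dga.
move=> /(_ _)/wrap[]; first by rewrite /g subrr mulr0.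
move=> /(_ _)/wrap[].
  by have := dg _ _ dc; rewrite mul0r add0r addr0 mulVf.
move=> /(_ _)/wrap[].
  move=> z zr; rewrite /g cabsM cabsV ler_pM2l ?invr_gt0//.
  have := fK z zr; have := fK 0; rewrite cabs0 => /(_ r0).
  by have := cabsB (f z) (f 0); lra.
rewrite [X in _ <= X]mulrC ler_pdivlMr// => h; rewrite ler_pdivlMr//; lra.
Qed.

End cauchy_estimate.

(** * Lipschitz and Taylor bounds on a disc; holomorphy of the derivative *)

Section holomorphic_disc.
Variable R : realType.
Implicit Types (f g : R[i] -> R[i]) (z w c : R[i]).

Lemma lin_approx_is_derive (phi : R -> R) (x a : R) :
  (forall e, 0 < e -> exists2 d, 0 < d & forall h, `|h| <= d ->
    `|phi (x + h) - phi x - a * h| <= e * `|h|) ->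
  is_derive x (1 : R) phi a.
Proof.
move=> H; have cvg_phi :
    (fun h => h^-1 *: ((phi \o shift x) (h *: (1 : R)) - phi x)) @ 0^' --> a.
  apply/cvgrPdist_le => e e0; have [d d0 {}H] := H e e0.
  near=> h; have h0 : h != 0 by near: h; exact: nbhs_dnbhs_neq.
  have hd : `|h| <= d.
    near: h; exists d => //= h /=; rewrite sub0r normrN => /ltW + _.
    exact.
  have := H h hd.
  have -> : phi (x + h) = (phi \o shift x) (h *: (1 : R)).
    by rewrite /= /GRing.scale/= mulr1 addrC.
  set D := (_ \o _) _ => {}H; rewrite /GRing.scale/= distrC.
  have -> : h^-1 * (D - phi x) - a = (D - phi x - a * h) / h by field.
  by rewrite normrM normfV ler_pdivrMr// normr_gt0.
apply: DeriveDef; first by apply/cvg_ex; exists a.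
exact: cvg_lim cvg_phi.
Unshelve. all: by end_near. Qed.

Lemma cderiv_line f z h (t : R) c : cderiv f (z + t%:C * h) c ->
  forall e, 0 < e -> exists2 d : R, 0 < d & forall s : R, `|s| <= d ->
    cabs (f (z + (t + s)%:C * h) - f (z + t%:C * h) - c * h * s%:C) <= e * `|s|.
Proof.
move=> df e e0; have h1 : 0 < cabs h + 1 by rewrite ltr_wpDl ?cabs_ge0.
have [d d0 H] := df (e / (cabs h + 1)) (divr_gt0 e0 h1).
exists (d / (cabs h + 1)); first exact: divr_gt0.
move=> s; rewrite ler_pdivlMr// => sd.
have hs : cabs (s%:C * h) <= `|s| * (cabs h + 1).
  by rewrite cabsM cabs_real ler_wpM2l// lerDl.
have := H (s%:C * h) (le_trans hs sd).
have -> : z + t%:C * h + s%:C * h = z + (t + s)%:C * h by rewrite rmorphD/=; ring.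
have -> : c * (s%:C * h) = c * h * s%:C by ring.
move/le_trans; apply; rewrite -mulrA ler_pM2l//.
by rewrite ler_pdivrMl// [leRHS]mulrC.
Qed.

Lemma Re_lin_approx (b c : R[i]) (s : R) :
  complex.Re b - complex.Re c * s = complex.Re (b - c * s%:C).
Proof. by case: b => ? ?; case: c => ? ? /=; ring. Qed.

Lemma Im_lin_approx (b c : R[i]) (s : R) :
  complex.Im b - complex.Im c * s = complex.Im (b - c * s%:C).
Proof. by case: b => ? ?; case: c => ? ? /=; ring. Qed.

Lemma ReB b c : complex.Re (b - c) = complex.Re b - complex.Re c :> R.
Proof. by case: b => ? ?; case: c. Qed.

Lemma ImB b c : complex.Im (b - c) = complex.Im b - complex.Im c :> R.
Proof. by case: b => ? ?; case: c. Qed.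

Lemma cderiv_is_derive_Re f z h (t : R) c : cderiv f (z + t%:C * h) c ->
  is_derive t (1 : R) (fun s : R => complex.Re (f (z + s%:C * h)))
    (complex.Re (c * h)).
Proof.
move=> /cderiv_line H; apply: lin_approx_is_derive => e /H[d d0 {}H].
exists d => // s /H; apply: le_trans.
by rewrite -ReB Re_lin_approx Re_le_cabs.
Qed.

Lemma cderiv_is_derive_Im f z h (t : R) c : cderiv f (z + t%:C * h) c ->
  is_derive t (1 : R) (fun s : R => complex.Im (f (z + s%:C * h)))
    (complex.Im (c * h)).
Proof.
move=> /cderiv_line H; apply: lin_approx_is_derive => e /H[d d0 {}H].
exists d => // s /H; apply: le_trans.
by rewrite -ImB Im_lin_approx Im_le_cabs.
Qed.

Lemma is_derive_contin (phi phi' : R -> R) (a b : R) :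
  (forall x : R, a <= x <= b -> is_derive x (1 : R) phi (phi' x)) ->
  contin phi a b.
Proof.
move=> H x /H[dx _]; apply/differentiable_continuous.
exact/derivable1_diffP.
Qed.

Lemma real_mvt (phi phi' : R -> R) :
  (forall x : R, 0 <= x <= 1 -> is_derive x (1 : R) phi (phi' x)) ->
  exists2 x, 0 <= x <= 1 & phi 1 - phi 0 = phi' x.
Proof.
move=> H; have [x|x|x] := @MVT R phi phi' 0 1 ltr01.
- by rewrite in_itv/= => /andP[/ltW x0 /ltW x1]; apply: H; rewrite x0 x1.
- exact: (contin_within (is_derive_contin H)).
- rewrite in_itv/= => /andP[/ltW x0 /ltW x1] ->; exists x; first by rewrite x0 x1.
  by rewrite subr0 mulr1.
Qed.

(** A complex-valued function need not have a mean value point, so the real theorem is applied to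
    [Re (u * f)] with [u] the conjugate of the increment [D]: the increment of that function is
    [|D|^2]. *)
Lemma mean_value f (f' : R[i] -> R[i]) z h (K : R) :
  (forall t : R, 0 <= t <= 1 ->
    cderiv f (z + t%:C * h) (f' (z + t%:C * h)) /\
    cabs (f' (z + t%:C * h)) <= K) ->
  cabs (f (z + h) - f z) <= K * cabs h.
Proof.
move=> H; set D := f (z + h) - f z.
have [->|D0] := eqVneq (cabs D) 0.
  rewrite mulr_ge0 ?cabs_ge0//; have [|_] := H 0; first by rewrite lexx ler01.
  exact/le_trans/cabs_ge0.
have Dp : 0 < cabs D by rewrite lt_def D0 cabs_ge0.
pose u : R[i] := D^*%C.
have [t ht] := @real_mvt (fun s : R => complex.Re (u * f (z + s%:C * h)))
  (fun s => complex.Re ((0 * f (z + s%:C * h) + u * f' (z + s%:C * h)) * h))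
  (fun s hs => cderiv_is_derive_Re (cderivM (cderiv_cst u _) (proj1 (H s hs)))).
rewrite -ReB mul1r mul0r addr0 mul0r add0r -mulrBr -/D.
have -> : complex.Re (u * D) = cabs D ^+ 2.
  by rewrite /u; case: (D) => x y; rewrite cabs_sqr /=; ring.
move=> E; have cu : cabs u = cabs D.
  by rewrite /u; case: (D) => x y; rewrite !cabsE sqrrN.
have : cabs D ^+ 2 <= cabs D * (K * cabs h).
  rewrite E; apply: (le_trans (ler_norm _)); apply: (le_trans (Re_le_cabs _)).
  rewrite !cabsM cu -mulrA ler_pM2l// ler_wpM2r ?cabs_ge0//.
  by have [] := H t ht.
by rewrite expr2 ler_pM2l.
Qed.

Lemma cderiv_shift f a z c : cderiv f (a + z) c -> cderiv (fun w => f (a + w)) z c.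
Proof.
by move=> df e /df[d d0 H]; exists d => // h /H; rewrite addrA.
Qed.

Lemma cderiv_shift_right f a z c :
  cderiv f (z + a) c -> cderiv (fun w => f (w + a)) z c.
Proof.
move=> df e /df[d d0 H]; exists d => // h /H.
by have -> : z + h + a = z + a + h by rewrite addrAC.
Qed.

Lemma cauchy_estimate f (f' : R[i] -> R[i]) a (r K : R) : 0 < r ->
  (forall z, cabs (z - a) < r -> cderiv f z (f' z)) ->
  (forall z, cabs (z - a) < r -> cabs (f z) <= K) ->
  cabs (f' a) <= 8 * K / r.
Proof.
move=> r0 df fK.
apply: (@cauchy_estimate0 _ (fun w => f (a + w)) r K) => //.
- move=> z zr; exists (f' (a + z)); apply/cderiv_shift/df.
  by rewrite addrC addKr.
- by apply: cderiv_shift; rewrite addr0; apply: df; rewrite subrr cabs0.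
- by move=> z zr; apply: fK; rewrite addrC addKr.
Qed.

Lemma cauchy_lipschitz f (f' : R[i] -> R[i]) a (r K : R) : 0 < r ->
  (forall z, cabs (z - a) < r -> cderiv f z (f' z)) ->
  (forall z, cabs (z - a) < r -> cabs (f z) <= K) ->
  forall z h, cabs (z - a) <= r / 2 -> cabs (z + h - a) <= r / 2 ->
    cabs (f (z + h) - f z) <= 16 * K / r * cabs h.
Proof.
move=> r0 df fK z h hz hzh; apply: (mean_value (f' := f')) => t /andP[t0 t1].
set w := z + t%:C * h.
have wr : cabs (w - a) <= r / 2.
  have -> : w - a = (1 - t)%:C * (z - a) + t%:C * (z + h - a).
    by rewrite /w rmorphB/= rmorph1; ring.
  apply: (le_trans (cabsD _ _)); rewrite !cabsM !cabs_real.
  rewrite !ger0_norm ?subr_ge0//.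
  have : (1 - t) * cabs (z - a) <= (1 - t) * (r / 2) by rewrite ler_wpM2l ?subr_ge0.
  have : t * cabs (z + h - a) <= t * (r / 2) by rewrite ler_wpM2l.
  lra.
have sub v : cabs (v - w) < r / 2 -> cabs (v - a) < r.
  by move=> vw; have := cabsD (v - w) (w - a); rewrite addrA subrK; lra.
split; first by apply: df; lra.
have := @cauchy_estimate f f' w (r / 2) K ltac:(lra).
have -> : 8 * K / (r / 2) = 16 * K / r by field; rewrite gt_eqF.
apply=> v /sub; [exact: df|exact: fK].
Qed.

(** Nothing is known yet about the smoothness of [f']. Its Lipschitz bound at [a] is Cauchy's
    estimate for [w |-> f (w + k) - f w] on a disc of radius [r / 4], where [cauchy_lipschitz] gives
    [16 K |k| / r]; hence 512, which is 8 times 16 times 4. The mean value inequality for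
    [f w - f' a * w] concludes. *)
Lemma cauchy_taylor f (f' : R[i] -> R[i]) a (r K : R) : 0 < r ->
  (forall z, cabs (z - a) < r -> cderiv f z (f' z)) ->
  (forall z, cabs (z - a) < r -> cabs (f z) <= K) ->
  forall h, cabs h <= r / 4 ->
    cabs (f (a + h) - f a - f' a * h) <= 512 * K / r ^+ 2 * cabs h ^+ 2.
Proof.
move=> r0 df fK h hr.
have lip := cauchy_lipschitz r0 df fK.
have f'lip k : cabs k <= r / 4 ->
    cabs (f' (a + k) - f' a) <= 512 * K / r ^+ 2 * cabs k.
  move=> kr; have r40 : 0 < r / 4 by lra.
  have near v : cabs (v - a) < r / 4 -> cabs (v + k - a) <= r / 2.
    by move=> va; have := cabsD (v - a) k; rewrite addrAC; lra.
  have := @cauchy_estimate (fun w => f (w + k) + (- 1) * f w)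
    (fun w => f' (w + k) + (0 * f w + (- 1) * f' w)) a (r / 4)
    (16 * K / r * cabs k) r40.
  rewrite mul0r add0r mulN1r.
  have -> : 8 * (16 * K / r * cabs k) / (r / 4) = 512 * K / r ^+ 2 * cabs k.
    by field; rewrite gt_eqF.
  apply=> v va; have := near v va => vk.
    apply: cderivD; first by apply/cderiv_shift_right/df; lra.
    by apply: cderivM; [exact: cderiv_cst|apply: df; lra].
  by rewrite mulN1r; apply: lip => //; lra.
have := @mean_value (fun w => f w + (- f' a) * w)
  (fun w => f' w + (0 * w + (- f' a) * 1)) a h (512 * K / r ^+ 2 * cabs h).
have -> : f (a + h) + - f' a * (a + h) - (f a + - f' a * a) =
  f (a + h) - f a - f' a * h by ring.
have -> : 512 * K / r ^+ 2 * cabs h * cabs h = 512 * K / r ^+ 2 * cabs h ^+ 2.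
  by rewrite expr2 mulrA.
apply=> t /andP[t0 t1].
have th : cabs (t%:C * h) <= cabs h.
  by rewrite cabsM cabs_real ger0_norm// ler_piMl ?cabs_ge0.
split.
  apply: cderivD; first by apply: df; rewrite addrC addKr; lra.
  by apply: cderivM; [exact: cderiv_cst|exact: cderiv_id].
rewrite mul0r add0r mulr1; apply: (le_trans (f'lip _ (le_trans th hr))).
apply: ler_wpM2l; last exact: th.
apply: divr_ge0; last by rewrite exprn_ge0// ltW.
apply: mulr_ge0; first exact: ler0n.
by apply: le_trans (cabs_ge0 (f a)) (fK a _); rewrite subrr cabs0.
Qed.

(** Completeness through a supremum: for the real and the imaginary part [p] of [D], every
    [p h - C |h|] lies below every [p k + C |k|]. Adding the two parts costs the factor 2. *)
Lemma difference_quotient_limit (D : R[i] -> R[i]) (d C : R) : 0 < d ->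
  (forall h k, 0 < cabs h <= d -> 0 < cabs k <= d ->
    cabs (D h - D k) <= C * (cabs h + cabs k)) ->
  exists L, forall h, 0 < cabs h <= d -> cabs (D h - L) <= 2 * C * cabs h.
Proof.
move=> d0 H.
have real_limit (p : R[i] -> R) :
    (forall h k, 0 < cabs h <= d -> 0 < cabs k <= d ->
      `|p h - p k| <= C * (cabs h + cabs k)) ->
    exists l, forall h, 0 < cabs h <= d -> `|p h - l| <= C * cabs h.
  move=> Hp; pose S := [set p h - C * cabs h | h in [set h | 0 < cabs h <= d]].
  have dd : 0 < cabs d%:C <= d by rewrite cabs_real gtr0_norm ?d0 ?lexx.
  have ubS k : 0 < cabs k <= d -> ubound S (p k + C * cabs k).
    by move=> kd _ [h hd <-]; have := Hp h k hd kd; rewrite ler_norml; lra.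
  exists (sup S) => h hd; rewrite ler_norml; apply/andP; split.
    have : sup S <= p h + C * cabs h; last by lra.
    by apply: ge_sup; [exists (p d%:C - C * cabs d%:C), d%:C|exact: ubS].
  have : p h - C * cabs h <= sup S; last by lra.
  by apply: ub_le_sup; [exists (p d%:C + C * cabs d%:C); exact: ubS|exists h].
have [l1 H1] : exists l, forall h, 0 < cabs h <= d ->
    `|complex.Re (D h) - l| <= C * cabs h.
  apply: real_limit => h k hd kd; apply: le_trans (H h k hd kd).
  by rewrite -ReB Re_le_cabs.
have [l2 H2] : exists l, forall h, 0 < cabs h <= d ->
    `|complex.Im (D h) - l| <= C * cabs h.
  apply: real_limit => h k hd kd; apply: le_trans (H h k hd kd).
  by rewrite -ImB Im_le_cabs.
exists (l1 +i* l2) => h hd; have := H1 h hd; have := H2 h hd.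
case: (D h) => x y /= ? ?; apply: (le_trans (cabs_le_norms _ _)); lra.
Qed.

(** [D h - D k] is the derivative at [a] of [psi h - psi k], a difference of difference quotients of
    [f], which is [O (|h| + |k|)] by Taylor's bound. Cauchy's estimate hands this order on to the
    derivative, so the quotients [D h] of [f'] converge. *)
Lemma cderiv_derivative f (f' : R[i] -> R[i]) a (r K : R) : 0 < r ->
  (forall z, cabs (z - a) < r -> cderiv f z (f' z)) ->
  (forall z, cabs (z - a) < r -> cabs (f z) <= K) ->
  exists c, cderiv f' a c.
Proof.
move=> r0 df fK.
pose C := 512 * K / (r / 2) ^+ 2.
have r20 : 0 < r / 2 by lra.
have sub v w : cabs (w - a) < r / 2 -> cabs (v - w) < r / 2 -> cabs (v - a) < r.
  by move=> wa vw; have := cabsD (v - w) (w - a); rewrite addrA subrK; lra.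
pose psi h w := h^-1 * (f (w + h) - f w).
have psi_est h w : 0 < cabs h <= r / 8 -> cabs (w - a) < r / 2 ->
    cabs (psi h w - f' w) <= C * cabs h.
  move=> /andP[h0 hr] wa.
  have := @cauchy_taylor f f' w (r / 2) K r20
    (fun v vw => df v (sub v w wa vw)) (fun v vw => fK v (sub v w wa vw)) h.
  rewrite -/C => /(_ ltac:(lra)) H.
  have hn0 : h != 0 by rewrite -cabs_gt0.
  have -> : psi h w - f' w = (f (w + h) - f w - f' w * h) / h.
    by rewrite /psi; field.
  rewrite cabsM cabsV ler_pdivrMr//; apply: (le_trans H).
  by rewrite expr2 mulrA.
pose D h := h^-1 * (f' (a + h) - f' a).
have [L HL] : exists L, forall h, 0 < cabs h <= r / 8 ->
    cabs (D h - L) <= 2 * (16 * C / r) * cabs h.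
  apply: difference_quotient_limit; first by lra.
  move=> h k hr kr.
  have := @cauchy_estimate
    (fun w => h^-1 * (f (w + h) + (-1) * f w)
              + (- k^-1) * (f (w + k) + (-1) * f w))
    (fun w => (0 * (f (w + h) + (-1) * f w)
               + h^-1 * (f' (w + h) + (0 * f w + (-1) * f' w)))
              + (0 * (f (w + k) + (-1) * f w)
               + (- k^-1) * (f' (w + k) + (0 * f w + (-1) * f' w))))
    a (r / 2) (C * (cabs h + cabs k)) r20.
  have -> : 8 * (C * (cabs h + cabs k)) / (r / 2) =
    16 * C / r * (cabs h + cabs k) by field; rewrite gt_eqF.
  have -> : 0 * (f (a + h) + -1 * f a) + h^-1 * (f' (a + h) +
    (0 * f a + -1 * f' a)) + (0 * (f (a + k) + -1 * f a)
    + - k^-1 * (f' (a + k) + (0 * f a + -1 * f' a))) = D h - D k.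
    by rewrite /D; ring.
  apply=> v va.
    have dv l : 0 < cabs l <= r / 8 -> cderiv (fun w => f (w + l) + (-1) * f w) v
        (f' (v + l) + (0 * f v + (-1) * f' v)).
      move=> lr; apply: cderivD.
        apply/cderiv_shift_right/df.
        by have := cabsD (v - a) l; rewrite addrAC; lra.
      by apply: cderivM; [exact: cderiv_cst|apply: df; lra].
    by apply: cderivD; apply: cderivM; do ?exact: cderiv_cst; exact: dv.
  have -> : h^-1 * (f (v + h) + -1 * f v) + - k^-1 * (f (v + k) + -1 * f v) =
    (psi h v - f' v) - (psi k v - f' v) by rewrite /psi; ring.
  apply: (le_trans (cabsB _ _)); rewrite mulrDr.
  by apply: lerD; exact: psi_est.
exists L => e e0; set C' := 2 * (16 * C / r) in HL.
have C'1 : 0 < `|C'| + 1 by rewrite ltr_wpDl.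
exists (Num.min (r / 8) (e / (`|C'| + 1))).
  by rewrite lt_min divr_gt0// divr_gt0.
move=> h; rewrite le_min => /andP[hr]; rewrite ler_pdivlMr// => he.
have [->|h0] := eqVneq h 0.
  by rewrite addr0 subrr mulr0 subr0 cabs0 mulr0.
have hp : 0 < cabs h by rewrite cabs_gt0.
have := HL h; rewrite hp hr => /(_ isT) HLh.
have -> : f' (a + h) - f' a - L * h = (D h - L) * h by rewrite /D; field.
rewrite cabsM ler_pM2r//; apply: (le_trans HLh).
have := ler_norm C'; nra.
Qed.

End holomorphic_disc.

(** * Primitives on a disc and Landau's estimate *)

Section landau_estimate.
Variable R : realType.
Implicit Types (f g : R[i] -> R[i]) (z w c : R[i]).

Lemma riB (phi psi : R -> R) (a b : R) : contin phi a b -> contin psi a b ->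
  ri (fun t => phi t - psi t) a b = ri phi a b - ri psi a b.
Proof. by move=> cphi cpsi; apply: RintegralB => //; exact: contin_integrable. Qed.

(** The path integral of [q] along the radius to [z]: for holomorphic [q], the primitive that
    vanishes at 0. *)
Definition ray_integral (q : R[i] -> R[i]) z : R[i] :=
  ri (fun t : R => complex.Re (q (t%:C * z) * z)) 0 1 +i*
  ri (fun t : R => complex.Im (q (t%:C * z) * z)) 0 1.

Lemma cabs_ray (t : R) z : 0 <= t <= 1 -> cabs (t%:C * z) <= cabs z.
Proof.
by move=> /andP[t0 t1]; rewrite cabsM cabs_real ger0_norm// ler_piMl ?cabs_ge0.
Qed.

Lemma cderiv_scale q (t : R) z w c : cderiv q (t%:C * z) c ->
  cderiv (fun v => q v * w) (0 + t%:C * z) (c * w + q (t%:C * z) * 0).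
Proof. by move=> dq; rewrite add0r; apply: cderivM => //; exact: cderiv_cst. Qed.

Lemma ray_contin (q q' : R[i] -> R[i]) z w :
  (forall v, cabs v <= cabs z -> cderiv q v (q' v)) ->
  contin (fun t : R => complex.Re (q (t%:C * z) * w)) 0 1 /\
  contin (fun t : R => complex.Im (q (t%:C * z) * w)) 0 1.
Proof.
move=> dq; split.
  apply: (@is_derive_contin _ _ (fun t : R =>
    complex.Re ((q' (t%:C * z) * w + q (t%:C * z) * 0) * z))) => t ht.
  have := cderiv_is_derive_Re (cderiv_scale w (dq _ (cabs_ray z ht))).
  by under eq_fun do rewrite add0r.
apply: (@is_derive_contin _ _ (fun t : R =>
  complex.Im ((q' (t%:C * z) * w + q (t%:C * z) * 0) * z))) => t ht.
have := cderiv_is_derive_Im (cderiv_scale w (dq _ (cabs_ray z ht))).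
by under eq_fun do rewrite add0r.
Qed.

(* Differentiating under the integral sign gives the integrand
   [d/dt (t q(tz))]. *)
Lemma cderiv_ray_integral (q q' : R[i] -> R[i]) (r K : R) : 0 < r ->
  (forall z, cabs z < 2 * r -> cderiv q z (q' z)) ->
  (forall z, cabs z < 2 * r -> cabs (q z) <= K) ->
  forall z, cabs z < r -> cderiv (ray_integral q) z (q z).
Proof.
move=> r0 dq qK z zr.
have zr2 : cabs z < 2 * r by lra.
have sub v w : cabs w < r -> cabs (v - w) < r -> cabs v < 2 * r.
  by move=> wr vw; have := cabsD (v - w) w; rewrite subrK; lra.
have K0 : 0 <= K.
  by apply: le_trans (cabs_ge0 (q 0)) (qK _ _); rewrite cabs0; lra.
have q'K w : cabs w < r -> cabs (q' w) <= 8 * K / r.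
  by move=> wr; apply: (@cauchy_estimate _ q q' w r K) => // v vw;
    [apply: dq|apply: qK]; exact: (sub v w).
have taylor w k : cabs w < r -> cabs k <= r / 4 ->
    cabs (q (w + k) - q w - q' w * k) <= 512 * K / r ^+ 2 * cabs k ^+ 2.
  by move=> wr kr; apply: (@cauchy_taylor _ q q' w r K) => // v vw;
    [apply: dq|apply: qK]; exact: (sub v w).
set C1 := 8 * K / r in q'K; set C2 := 512 * K / r ^+ 2 in taylor.
have C10 : 0 <= C1.
  by apply: divr_ge0; [apply: mulr_ge0; rewrite ?ler0n|exact: ltW].
have C20 : 0 <= C2.
  by apply: divr_ge0; [apply: mulr_ge0; rewrite ?ler0n|rewrite exprn_ge0// ltW].
(* Second-order error of the integrand: Taylor's remainder of [q] times [|z + k| <= 2 r], plus the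
   cross term [q' (t z) t k^2]. *)
pose C := C2 * (2 * r) + C1.
have C0 : 0 <= C by rewrite /C; nra.
have main k (t : R) : cabs k <= r / 4 -> 0 <= t <= 1 ->
    cabs (q (t%:C * (z + k)) * (z + k) - q (t%:C * z) * z
      - (q (t%:C * z) + t%:C * q' (t%:C * z) * z) * k) <= C * cabs k ^+ 2.
  move=> kr ht; have tz := cabs_ray z ht; have tk := cabs_ray k ht.
  have := taylor (t%:C * z) (t%:C * k) ltac:(lra) ltac:(lra).
  rewrite -mulrDr; set E := _ - _ - _ => HE.
  have -> : q (t%:C * (z + k)) * (z + k) - q (t%:C * z) * z
      - (q (t%:C * z) + t%:C * q' (t%:C * z) * z) * k =
    E * (z + k) + q' (t%:C * z) * (t%:C * k) * k by rewrite /E; ring.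
  have k0 := cabs_ge0 k.
  have k2 : cabs (t%:C * k) ^+ 2 <= cabs k ^+ 2.
    by rewrite ler_pXn2r// nnegrE cabs_ge0.
  have h1 : cabs (E * (z + k)) <= C2 * cabs k ^+ 2 * (2 * r).
    rewrite cabsM; apply: ler_pM; rewrite ?cabs_ge0//.
      by apply: (le_trans HE); exact: ler_wpM2l.
    by have := cabsD z k; lra.
  have h2 : cabs (q' (t%:C * z) * (t%:C * k) * k) <= C1 * cabs k ^+ 2.
    rewrite !(cabsM (_ * _) k) (cabsM (q' _)) expr2 mulrA.
    apply: ler_wpM2r => //; apply: ler_pM; rewrite ?cabs_ge0//.
    by apply: q'K; lra.
  by apply: (le_trans (cabsD _ _)); rewrite /C; lra.
have est k : cabs k <= r / 4 -> cabs (z + k) < 2 * r ->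
    cabs (ray_integral q (z + k) - ray_integral q z - q z * k)
      <= 2 * C * cabs k ^+ 2.
  move=> kr zkr.
  have [cR1 cI1] := @ray_contin q q' (z + k) (z + k)
    (fun v vz => dq v (le_lt_trans vz zkr)).
  have [cR2 cI2] := @ray_contin q q' z z
    (fun v vz => dq v (le_lt_trans vz zr2)).
  (* The part of the integrand linear in [k] is the derivative of [t q (t z) k], which grows from 0
     to [q z * k]. *)
  pose P v := v * q (v * z) * k.
  have dP (t : R) : 0 <= t <= 1 -> cderiv P (0 + t%:C * 1)
      ((q (t%:C * z) + t%:C * q' (t%:C * z) * z) * k).
    move=> ht; rewrite add0r mulr1.
    have dqz : cderiv (fun v => q (v * z)) t%:C (q' (t%:C * z) * z).
      have [->|z0] := eqVneq z 0.
        rewrite mulr0; apply: (@cderiv_near _ (fun=> q 0)); first exact: cderiv_cst.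
        by exists 1 => // h _; rewrite mulr0.
      have zp : 0 < cabs z by rewrite cabs_gt0.
      have tz := cabs_ray z ht.
      move=> e e0; have [d d0 H] := dq _ (le_lt_trans tz zr2) _ (divr_gt0 e0 zp).
      exists (d / cabs z); first exact: divr_gt0.
      move=> h; rewrite ler_pdivlMr// => hd.
      have := H (h * z); rewrite cabsM => /(_ hd).
      have -> : e / cabs z * (cabs h * cabs z) = e * cabs h by field; rewrite gt_eqF.
      by rewrite mulrDl -[q' _ * z * h]mulrA [z * h]mulrC.
    have := cderivM (cderivM (cderiv_id t%:C) dqz) (cderiv_cst k _).
    by rewrite mul1r mulr0 addr0 [t%:C * (_ * z)]mulrA.
  have P1 : P (0 + (1 : R)%:C * 1) - P (0 + (0 : R)%:C * 1) = q z * k.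
    by rewrite /P !add0r !mulr1 rmorph1 rmorph0 !mul0r subr0 !mul1r.
  set I := ray_integral q (z + k) - ray_integral q z - q z * k.
  have reI : `|complex.Re I| <= C * cabs k ^+ 2.
    have := @ri_approx R (fun t => complex.Re (q (t%:C * (z + k)) * (z + k))
       - complex.Re (q (t%:C * z) * z))
      (fun t : R => complex.Re (P (0 + t%:C * 1))) _ 0 1 (C * cabs k ^+ 2) ler01 _
      (fun t ht => cderiv_is_derive_Re (dP t ht)).
    rewrite riB// -ReB P1 subr0 mulr1 /I ReB ReB; apply.
      by move=> t ht; apply: continuousB; [exact: cR1|exact: cR2].
    move=> t ht; apply: le_trans (main k t kr ht); apply: le_trans (Re_le_cabs _).
    by rewrite mulr1 !ReB.
  have imI : `|complex.Im I| <= C * cabs k ^+ 2.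
    have := @ri_approx R (fun t => complex.Im (q (t%:C * (z + k)) * (z + k))
       - complex.Im (q (t%:C * z) * z))
      (fun t : R => complex.Im (P (0 + t%:C * 1))) _ 0 1 (C * cabs k ^+ 2) ler01 _
      (fun t ht => cderiv_is_derive_Im (dP t ht)).
    rewrite riB// -ImB P1 subr0 mulr1 /I ImB ImB; apply.
      by move=> t ht; apply: continuousB; [exact: cI1|exact: cI2].
    move=> t ht; apply: le_trans (main k t kr ht); apply: le_trans (Im_le_cabs _).
    by rewrite mulr1 !ImB.
  case: (I) reI imI => x y /= hx hy.
  by apply: (le_trans (cabs_le_norms _ _)); lra.
move=> e e0; have C21 : 0 < 2 * C + 1 by lra.
exists (Num.min (r / 4) (e / (2 * C + 1))).
  by rewrite lt_min !divr_gt0.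
move=> h; rewrite le_min => /andP[hr]; rewrite ler_pdivlMr// => he.
have h0 := cabs_ge0 h.
apply: (le_trans (est h hr _)).
  by have := cabsD z h; lra.
by rewrite expr2; nra.
Qed.

Lemma sqr_cabs c : cabs c ^+ 2 = complex.Re c ^+ 2 + complex.Im c ^+ 2.
Proof. by case: c => x y; rewrite cabs_sqr. Qed.

Lemma Re_quotient c z w : complex.Re (c / z * w) =
  (complex.Re z * complex.Re (c * w) + complex.Im z * complex.Im (c * w))
  / (complex.Re z ^+ 2 + complex.Im z ^+ 2).
Proof. by case: c => ? ?; case: z => ? ?; case: w => ? ? /=; ring. Qed.

(** [ln |g|] is written through [|g|^2], a polynomial in the real and imaginary parts; its
    derivative is the real part of the logarithmic derivative. *)
Lemma is_derive_ln_cabs g z w (t : R) c : cderiv g (z + t%:C * w) c ->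
  g (z + t%:C * w) != 0 ->
  is_derive t (1 : R) (fun s : R => ln (cabs (g (z + s%:C * w)) ^+ 2) / 2)
    (complex.Re (c / g (z + t%:C * w) * w)).
Proof.
move=> dg g0.
have dR := cderiv_is_derive_Re dg; have dI := cderiv_is_derive_Im dg.
under eq_fun do rewrite sqr_cabs.
have N0 : 0 < complex.Re (g (z + t%:C * w)) ^+ 2 +
    complex.Im (g (z + t%:C * w)) ^+ 2.
  by rewrite -sqr_cabs exprn_gt0// cabs_gt0.
set a := fun s : R => complex.Re (g (z + s%:C * w)) in dR *.
set b := fun s : R => complex.Im (g (z + s%:C * w)) in dI *.
have N0' : 0 < a t ^+ 2 + b t ^+ 2 by exact: N0.
have dN : is_derive t (1 : R) (fun s => a s ^+ 2 + b s ^+ 2)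
    (2 * (a t * complex.Re (c * w)) + 2 * (b t * complex.Im (c * w))).
  apply: is_derive_eq.
  by rewrite /GRing.scale/=; ring.
have dlnN := is_derive1_ln N0'.
have dL : is_derive t (1 : R) (fun s => ln (a s ^+ 2 + b s ^+ 2))
    ((a t ^+ 2 + b t ^+ 2)^-1 *
     (2 * (a t * complex.Re (c * w)) + 2 * (b t * complex.Im (c * w)))).
  exact: (@is_derive1_comp _ _ (fun s => a s ^+ 2 + b s ^+ 2)).
apply: is_derive_eq.
rewrite /GRing.scale/= !mulr0 add0r Re_quotient.
by rewrite -/(a t) -/(b t); field; rewrite gt_eqF.
Qed.

(* A holomorphic branch [L] of [log g], normalised to be real at 0, has positive
   real part; the estimate is Cauchy's for [(L - L 0) / (L + L 0)]. *)
Lemma landau_estimate g (g' : R[i] -> R[i]) (r M : R) : 0 < r ->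
  (forall z, cabs z < r -> cderiv g z (g' z)) ->
  (forall z, cabs z < r -> 1 < cabs (g z) <= M) ->
  cabs (g' 0) <= 64 * (cabs (g 0) * ln (cabs (g 0))) / r.
Proof.
move=> r0 dg gM.
have g0 z : cabs z < r -> g z != 0.
  by move=> /gM/andP[g1 _]; rewrite -cabs_gt0; lra.
have sub v w : cabs w < r / 2 -> cabs (v - w) < r / 2 -> cabs v < r.
  by move=> wr vw; have := cabsD (v - w) w; rewrite subrK; lra.
have r20 : 0 < r / 2 by lra.
pose q z := g' z * (g z)^-1.
have dq z : exists c, cabs z < r / 2 -> cderiv q z c.
  have [zr|zr] := ltP (cabs z) (r / 2); last by exists 0.
  have [c dc] := @cderiv_derivative _ g g' z (r / 2) M r20
    (fun v vz => dg v (sub v z zr vz))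
    (fun v vz => proj2 (andP (gM v (sub v z zr vz)))).
  eexists => _; apply: (cderivM dc); apply: cderivV.
    by apply: g0; lra.
  by apply: dg; lra.
have [q' {}dq] := choice dq.
(* [M] makes [q] differentiable and bounded, hence provides its primitive; it leaves no trace in the
   final constant. *)
have qK z : cabs z < r / 2 -> cabs (q z) <= 16 * M / r.
  move=> zr; have /andP[g1 _] : 1 < cabs (g z) <= M by apply: gM; lra.
  rewrite cabsM cabsV ler_pdivrMr; last by lra.
  have := @cauchy_estimate _ g g' z (r / 2) M r20
    (fun v vz => dg v (sub v z zr vz))
    (fun v vz => proj2 (andP (gM v (sub v z zr vz)))).
  have -> : 8 * M / (r / 2) = 16 * M / r by field; rewrite gt_eqF.
  move/le_trans; apply; rewrite ler_peMr ?(ltW g1)//.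
  have /andP[gM1 gM2] := gM z ltac:(lra).
  by rewrite divr_ge0 ?mulr_ge0 ?(ltW r0)//; lra.
have r40 : 0 < r / 4 by lra.
have r42 : 2 * (r / 4) = r / 2 by field.
have dL z : cabs z < r / 4 -> cderiv (ray_integral q) z (q z).
  by move=> zr; apply: (@cderiv_ray_integral q q' (r / 4) (16 * M / r) r40)
    => //; rewrite r42.
pose s := ln (cabs (g 0)).
have g01 : 1 < cabs (g 0) by have /andP[] := gM 0 ltac:(rewrite cabs0; lra).
have s0 : 0 < s by rewrite ln_gt0.
have ReL z : cabs z < r / 4 -> 0 < s + complex.Re (ray_integral q z).
  move=> zr; have zt (t : R) : 0 <= t <= 1 -> cabs (t%:C * z) < r.
    by move=> /(cabs_ray z); lra.
  have lnE v : cabs v < r -> ln (cabs (g v) ^+ 2) / 2 = ln (cabs (g v)).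
    move=> vr; rewrite lnXn; last by have /andP[] := gM v vr; lra.
    by rewrite -[ln _ *+ 2]mulr_natr mulfK.
  have [cR _] := @ray_contin q q' z z (fun v vz => dq v ltac:(lra)).
  have dln (t : R) (ht : 0 <= t <= 1) := @is_derive_ln_cabs g 0 z t
    (g' (0 + t%:C * z)) ltac:(rewrite add0r; exact: (dg _ (zt t ht)))
    ltac:(rewrite add0r; exact: (g0 _ (zt t ht))).
  (* With error 0: the real part of the primitive at [z] is [ln |g z| - ln |g 0|], and
     [ln |g z| > 0]. *)
  have := @ri_approx R _ _ _ 0 1 0 ler01 cR dln.
  move=> /(_ _)/wrap[]; first by move=> t ht; rewrite add0r subrr normr0.
  rewrite [leRHS]mul0r normr_le0 subr_eq0 => /eqP E.
  have -> : complex.Re (ray_integral q z) = ln (cabs (g z)) - s.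
    rewrite /= E !add0r rmorph1 rmorph0 mul1r mul0r !lnE ?cabs0//.
    by lra.
  rewrite addrC subrK ln_gt0//.
  by have /andP[] := gM z ltac:(lra).
pose L z := ray_integral q z + s%:C.
have dL' z : cabs z < r / 4 -> cderiv L z (q z + 0).
  by move=> /dL dLz; apply: (cderivD dLz); exact: cderiv_cst.
have L0 z : cabs z < r / 4 -> L z + s%:C != 0.
  move=> /ReL; rewrite /L; case: (ray_integral q z) => x y /= h.
  rewrite eq_complex/= negb_and; apply/orP; left.
  by rewrite gt_eqF//; lra.
pose W z := (L z + (- s%:C)) * (L z + s%:C)^-1.
have dW z : cabs z < r / 4 -> cderiv W z ((q z + 0 + 0) * (L z + s%:C)^-1
    + (L z + (- s%:C)) * (- (q z + 0 + 0) / (L z + s%:C) ^+ 2)).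
  move=> zr; apply: cderivM; last apply: cderivV; rewrite ?L0//;
    by apply: cderivD; [exact: dL'|exact: cderiv_cst].
have W1 z : cabs z < r / 4 -> cabs (W z) <= 1.
  move=> zr; have := ReL z zr; have := L0 z zr.
  rewrite /W cabsM cabsV /L; case: (ray_integral q z) => x y.
  rewrite -cabs_gt0 => p; rewrite -[complex.Re _]/x => h.
  rewrite ler_pdivrMr// mul1r -(@ler_pXn2r _ 2%N) ?nnegrE ?cabs_ge0//.
  by rewrite !sqr_cabs /=; nra.
have := @cauchy_estimate _ W _ 0 (r / 4) 1 r40 (fun z zr => dW z ltac:(rewrite subr0 in zr; exact: zr))
  (fun z zr => W1 z ltac:(rewrite subr0 in zr; exact: zr)).
have -> : L 0 = s%:C.
  rewrite /L /ray_integral.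
  have -> : (fun t : R => complex.Re (q (t%:C * 0) * 0)) = fun=> 0.
    by apply/funext => t; rewrite mulr0.
  have -> : (fun t : R => complex.Im (q (t%:C * 0) * 0)) = fun=> 0.
    by apply/funext => t; rewrite mulr0.
  rewrite /ri; have -> : \int[@lebesgue_measure R]_(x in `[(0:R), 1]) (0 : R) = 0.
    by rewrite Rintegral_cst// mul0r.
  by rewrite -[0 +i* 0]/(0 : R[i]) add0r.
have -> : s%:C + s%:C = (s + s)%:C by rewrite rmorphD.
rewrite subrr mul0r !addr0 cabsM cabsV cabs_real gtr0_norm; last by lra.
rewrite /q cabsM cabsV.
set G := cabs (g 0) in g01 *; set G' := cabs (g' 0).
have G0 : 0 < G by lra.
rewrite -/s.
(* The derivative of [W] at 0 is [q 0 / (2 s)]; the factor [2 s] turns 32 into 64. *)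
have -> : 8 * 1 / (r / 4) = 32 / r by field; rewrite gt_eqF.
rewrite ler_pdivrMr; last by lra.
rewrite ler_pdivrMr// => /le_trans; apply.
by rewrite le_eqVlt; apply/orP; left; apply/eqP; rewrite -/s; field; rewrite gt_eqF.
Qed.

End landau_estimate.

(** * The Euclidean norm and its comparison with the sup norm *)

Section euclidean_norm.
Variables (R : realType) (n : nat).
Implicit Types (z w h v : 'rV[R[i]]_n) (c : R[i]).

Lemma enorm_sum_ge0 z : 0 <= \sum_(k < n) cabs (z ord0 k) ^+ 2.
Proof. by apply: sumr_ge0 => k _; rewrite sqr_ge0. Qed.

Lemma enorm_ge0 z : 0 <= enorm z.
Proof. exact: sqrtr_ge0. Qed.

Lemma sqr_enorm z : enorm z ^+ 2 = \sum_(k < n) cabs (z ord0 k) ^+ 2.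
Proof. by rewrite sqr_sqrtr// enorm_sum_ge0. Qed.

Lemma cabs_le_enorm z k : cabs (z ord0 k) <= enorm z.
Proof.
rewrite -(@ler_pXn2r _ 2%N) ?nnegrE ?cabs_ge0 ?enorm_ge0// sqr_enorm.
rewrite (bigD1 k)//= lerDl sumr_ge0// => j _; exact: sqr_ge0.
Qed.

Lemma enorm0 : enorm (0 : 'rV[R[i]]_n) = 0.
Proof.
by rewrite /enorm big1 ?sqrtr0// => k _; rewrite mxE cabs0 expr0n.
Qed.

Lemma enormZ c z : enorm (c *: z) = cabs c * enorm z.
Proof.
rewrite /enorm -[cabs c]ger0_norm ?cabs_ge0// -sqrtr_sqr -sqrtrM ?sqr_ge0//.
congr Num.sqrt; rewrite mulr_sumr; apply: eq_bigr => k _.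
by rewrite mxE cabsM exprMn.
Qed.

Lemma enormN z : enorm (- z) = enorm z.
Proof. by rewrite -scaleN1r enormZ cabsN cabs1 mul1r. Qed.

(** Cauchy-Schwarz, by summing [x y <= b x^2 / (2 a) + a y^2 / (2 b)] with [a] and [b] the two
    norms. *)
Lemma sum_cabs_prod z w :
  \sum_(k < n) cabs (z ord0 k) * cabs (w ord0 k) <= enorm z * enorm w.
Proof.
have zero (u : 'rV[R[i]]_n) : enorm u = 0 -> forall k, cabs (u ord0 k) = 0.
  move=> u0 k; apply/eqP; rewrite eq_le cabs_ge0 andbT.
  by rewrite (le_trans (cabs_le_enorm u k))// u0.
have [/zero z0|z0] := eqVneq (enorm z) 0.
  by rewrite big1 ?mulr_ge0 ?enorm_ge0// => k _; rewrite z0 mul0r.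
have [/zero w0|w0] := eqVneq (enorm w) 0.
  by rewrite big1 ?mulr_ge0 ?enorm_ge0// => k _; rewrite w0 mulr0.
have zp : 0 < enorm z by rewrite lt_def z0 enorm_ge0.
have wp : 0 < enorm w by rewrite lt_def w0 enorm_ge0.
set a := enorm z in z0 zp *; set b := enorm w in w0 wp *.
apply: (@le_trans _ _ (\sum_(k < n) (b / (2 * a) * cabs (z ord0 k) ^+ 2
    + a / (2 * b) * cabs (w ord0 k) ^+ 2))).
  apply: ler_sum => k _; set x := cabs (z _ _); set y := cabs (w _ _).
  rewrite -subr_ge0.
  have -> : b / (2 * a) * x ^+ 2 + a / (2 * b) * y ^+ 2 - x * y =
    (b * x - a * y) ^+ 2 / (2 * a * b) by field; rewrite z0 w0.
  by rewrite divr_ge0 ?sqr_ge0// !mulr_ge0// ltW.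
rewrite big_split/= -!mulr_sumr -!sqr_enorm -/a -/b le_eqVlt.
by apply/orP; left; apply/eqP; field; rewrite z0 w0.
Qed.

Lemma enormD z w : enorm (z + w) <= enorm z + enorm w.
Proof.
rewrite -(@ler_pXn2r _ 2%N) ?nnegrE ?addr_ge0 ?enorm_ge0//.
rewrite sqrrD !sqr_enorm.
apply: (@le_trans _ _ (\sum_(k < n) (cabs (z ord0 k) ^+ 2
    + 2 * (cabs (z ord0 k) * cabs (w ord0 k)) + cabs (w ord0 k) ^+ 2))).
  apply: ler_sum => k _; rewrite mxE.
  have := cabsD (z ord0 k) (w ord0 k); have := cabs_ge0 (z ord0 k + w ord0 k).
  nra.
rewrite !big_split/= -mulr_sumr lerD2r lerD2l -[leRHS]mulr_natl.
by rewrite ler_wpM2l//; exact: sum_cabs_prod.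
Qed.

Lemma enormB z w : enorm (z - w) <= enorm z + enorm w.
Proof. by rewrite -(enormN w) enormD. Qed.

Lemma enormC z w : enorm (z - w) = enorm (w - z).
Proof. by rewrite -enormN opprB. Qed.

Lemma enorm_segment z w (t r : R) : 0 <= t <= 1 -> enorm z <= r ->
  enorm (z + w) <= r -> enorm (z + t%:C *: w) <= r.
Proof.
move=> /andP[t0 t1] zr zwr.
have -> : z + t%:C *: w = (1 - t)%:C *: z + t%:C *: (z + w).
  by rewrite scalerDr addrA -scalerDl -rmorphD/= subrK rmorph1 scale1r.
apply: (le_trans (enormD _ _)); rewrite !enormZ !cabs_real !ger0_norm ?subr_ge0//.
have : (1 - t) * enorm z <= (1 - t) * r by rewrite ler_wpM2l// subr_ge0.
have : t * enorm (z + w) <= t * r by rewrite ler_wpM2l.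
lra.
Qed.

Lemma entry_le_mx_norm z k : `|z ord0 k| <= `|z|.
Proof.
rewrite [leRHS]mx_normE -[leLHS]nngE num_le.
exact: (@le_bigmax _ _ _ _ (fun i => `|z i.1 i.2|%:nng) (ord0, k)).
Qed.

(** The library norm takes its values in [R[i]]; this is the same number as a real one. *)
Definition supnorm z : R := complex.Re `|z|.

Lemma supnormE z : `|z| = (supnorm z)%:C.
Proof.
have [z0|] := eqVneq `|z| 0; first by rewrite /supnorm z0.
move=> /mx_norm_neq0[i zi].
have {}zi : `|z| = (cabs (z i.1 i.2))%:C := etrans zi (norm_cabs _).
by rewrite /supnorm zi.
Qed.

Lemma supnorm_ge0 z : 0 <= supnorm z.
Proof. by rewrite -lecR -supnormE normr_ge0. Qed.

Lemma supnorm_le_enorm z : supnorm z <= enorm z.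
Proof.
have [z0|] := eqVneq `|z| 0; first by rewrite /supnorm z0/= enorm_ge0.
move=> /mx_norm_neq0[[i k] /=]; rewrite ord1 => zi.
have {}zi : `|z| = (cabs (z ord0 k))%:C := etrans zi (norm_cabs _).
by rewrite /supnorm zi; exact: cabs_le_enorm.
Qed.

Lemma cabs_le_supnorm z k : cabs (z ord0 k) <= supnorm z.
Proof. by rewrite -lecR -supnormE -norm_cabs entry_le_mx_norm. Qed.

Lemma enorm_le_sum z : enorm z <= \sum_(k < n) cabs (z ord0 k).
Proof.
have s0 : 0 <= \sum_(k < n) cabs (z ord0 k).
  by apply: sumr_ge0 => k _; exact: cabs_ge0.
rewrite -(@ler_pXn2r _ 2%N) ?nnegrE ?enorm_ge0// sqr_enorm expr2 mulr_suml.
apply: ler_sum => k _; rewrite expr2 ler_wpM2l ?cabs_ge0//.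
by rewrite (bigD1 k)//= lerDl sumr_ge0// => j _; exact: cabs_ge0.
Qed.

Lemma enorm_le_supnorm z : enorm z <= n%:R * supnorm z.
Proof.
apply: (le_trans (enorm_le_sum z)).
apply: (@le_trans _ _ (\sum_(k < n) supnorm z)).
  by apply: ler_sum => k _; exact: cabs_le_supnorm.
by rewrite sumr_const card_ord mulr_natl.
Qed.

End euclidean_norm.

(** * Neighbourhoods, compactness and uniform convergence through real norms *)

Section complex_topology.
Variables (R : realType) (n : nat).
Implicit Types (z w h v : 'rV[R[i]]_n) (c : R[i]).

Lemma complex_gt0 c : 0 < c -> exists2 d : R, 0 < d & c = d%:C.
Proof.
by case: c => x y; rewrite ltcE/= => /andP[/eqP -> x0]; exists x.
Qed.

Lemma nbhs_cabs c (A : set R[i]) :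
  nbhs c A <-> exists2 d : R, 0 < d & forall a, cabs (a - c) < d -> A a.
Proof.
split=> [/nbhs_ballP[e /complex_gt0[d d0 ->] H]|[d d0 H]].
  exists d => // w wd; apply: H.
  by rewrite -ball_normE/= norm_cabs ltcR cabsC.
apply/nbhs_ballP; exists d%:C; first by rewrite /= ltcR.
move=> w; rewrite -ball_normE/= norm_cabs ltcR cabsC; exact: H.
Qed.

Lemma nbhs_enorm z (A : set 'rV[R[i]]_n) :
  nbhs z A <-> exists2 d : R, 0 < d & forall w, enorm (w - z) < d -> A w.
Proof.
split=> [/nbhs_ballP[e /complex_gt0[d d0 ->] H]|[d d0 H]].
  exists d => // w wd; apply: H; rewrite -ball_normE/= distrC supnormE ltcR.
  exact: le_lt_trans (supnorm_le_enorm _) wd.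
(* The added 1 keeps the divisor positive for [n = 0]. *)
have n0 : 0 < n%:R + 1 :> R by rewrite ltr_wpDl.
apply/nbhs_ballP; exists (d / (n%:R + 1))%:C.
  by rewrite /= ltcR divr_gt0.
move=> w; rewrite -ball_normE/= distrC supnormE ltcR ltr_pdivlMr// => wz.
apply: H; apply: le_lt_trans (enorm_le_supnorm _) _.
by have := supnorm_ge0 (w - z); nra.
Qed.

Lemma cvg_cabs (T : Type) (F : set_system T) (f : T -> R[i]) c : Filter F ->
  f @ F --> c <-> forall e, 0 < e -> F [set t | cabs (f t - c) < e].
Proof.
move=> FF; split=> [fc e e0|H A /nbhs_cabs[d d0 dA]].
  by apply: (fc [set a | cabs (a - c) < e]); apply/nbhs_cabs; exists e.
by rewrite /nbhs/=; apply: filterS (H d d0) => t /= /dA.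
Qed.

Lemma compact_cabs (r : R) : compact [set c : R[i] | cabs c <= r].
Proof.
pose f (p : R * R) : R[i] := p.1 +i* p.2.
have fc : continuous f.
  move=> p A /nbhs_cabs[d d0 dA].
  have d20 : 0 < d / 2 by rewrite divr_gt0.
  exists (ball p.1 (d / 2), ball p.2 (d / 2)); first by split; exact: nbhsx_ballx.
  move=> [x y] [/= hx hy]; apply: dA.
  apply: le_lt_trans (cabs_le_norms (x - p.1) (y - p.2)) _.
  move: hx hy; rewrite -ball_normE/= ![`|_ - x|]distrC ![`|_ - y|]distrC; lra.
have cK : compact (f @` (`[-r, r] `*` `[-r, r])).
  apply: continuous_compact; first exact/continuous_subspaceT.
  by apply: compact_setX; exact: segment_compact.
apply: subclosed_compact cK _.
  move=> c cc /=; rewrite leNgt; apply/negP => rc.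
  have : nbhs c [set a | r < cabs a].
    apply/nbhs_cabs; exists (cabs c - r); first by rewrite subr_gt0.
    by move=> w; have := cabs_subr c w; rewrite (cabsC w) /=; lra.
  by move=> /cc[w [/=]]; rewrite leNgt => /negP.
move=> [x y] /= h; exists (x, y) => //; split; rewrite /= in_itv/= -ler_norml.
  exact: le_trans (Re_le_cabs (x +i* y)) h.
exact: le_trans (Im_le_cabs (x +i* y)) h.
Qed.

Lemma compact_enorm (r : R) : compact [set z : 'rV[R[i]]_n | enorm z <= r].
Proof.
have cK := @rV_compact R[i] n (fun=> [set c : R[i] | cabs c <= r])
  (fun=> @compact_cabs r).
apply: subclosed_compact cK _.
  move=> c cc /=; rewrite leNgt; apply/negP => rc.
  have : nbhs c [set w | r < enorm w].
    apply/nbhs_enorm; exists (enorm c - r); first by rewrite subr_gt0.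
    move=> w; have := enormD w (c - w); rewrite addrC subrK (enormC w) /=; lra.
  by move=> /cc[w [/=]]; rewrite leNgt => /negP.
by move=> z zr k /=; exact: le_trans (cabs_le_enorm z k) zr.
Qed.

(** The filter is left open: the neighbourhoods of [+oo] serve to bound a function on a compact set,
    an ultrafilter to make pointwise convergence uniform. *)
Lemma compact_uniformly (I : Type) (F : set_system I)
    (P : I -> 'rV[R[i]]_n -> Prop) (K : set 'rV[R[i]]_n) : Filter F ->
  compact K ->
  (forall z, K z -> exists2 d, 0 < d & exists2 A, F A &
    forall i w, A i -> enorm (w - z) < d -> P i w) ->
  F [set i | forall z, K z -> P i z].
Proof.
move=> FF /compact_near_coveringP cK H; apply: cK => z /H[d d0 [A FA HA]].
exists ([set w | enorm (w - z) < d], A).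
  by split=> //=; apply/nbhs_enorm; exists d.
by move=> [w i] [/= wd Ai]; exact: HA.
Qed.

Lemma compact_bounded_above (phi : 'rV[R[i]]_n -> R) (K : set 'rV[R[i]]_n) :
  compact K ->
  (forall z, K z -> exists2 d, 0 < d & exists B,
     forall w, enorm (w - z) < d -> phi w <= B) ->
  exists B, forall z, K z -> phi z <= B.
Proof.
move=> cK H; have [//|N HN] := @filter_ex _ (pinfty_nbhs R) _ _
  (@compact_uniformly R (pinfty_nbhs R) (fun B z => phi z <= B) K _ cK _).
  move=> z /H[d d0 [B HB]]; exists d => //; exists [set b | B <= b].
    by apply: nbhs_pinfty_ge; exact: num_real.
  by move=> b w /= Bb /HB /le_trans; apply.
by exists N.
Qed.

Lemma uniform_cabs (f_ : nat -> 'rV[R[i]]_n -> R[i]) f (K : set 'rV[R[i]]_n) :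
  {uniform K, f_ @ \oo --> f} <-> forall e, 0 < e ->
    \forall j \near \oo, forall z, K z -> cabs (f_ j z - f z) < e.
Proof.
split=> [H e e0|H A /uniform_nbhs[E [entE EA]]].
  apply: (H [set g | forall z, K z -> cabs (g z - f z) < e]).
  apply/uniform_nbhs; exists [set p | ball p.1 e%:C p.2].
  split; first by rewrite -entourage_from_ballE; exists e%:C => //=; rewrite ltcR.
  by move=> g Hg z /Hg; rewrite -ball_normE/= norm_cabs ltcR cabsC.
have [e /complex_gt0[d d0 ->] Hd] : exists2 e : R[i], 0 < e &
    [set p | ball p.1 e p.2] `<=` E.
  by move: entE; rewrite -entourage_from_ballE => -[e e0 He]; exists e.
rewrite /nbhs/=; apply: filterS (H d d0) => j Hj; apply: EA => z /Hj.
by move=> h; apply: Hd; rewrite /= -ball_normE/= norm_cabs ltcR cabsC.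
Qed.

End complex_topology.

(** * Differentials and Cauchy estimates in several variables *)

Lemma linear_approx_differentiable (K : numFieldType) (V W : normedModType K)
    (f : V -> W) (L : {linear V -> W}) (z : V) : continuous L ->
  (forall e : K, 0 < e ->
    \forall h \near 0, `|f (h + z) - (f z + L h)| <= e * `|h|) ->
  differentiable f z.
Proof.
move=> cL H; have eqo : f \o shift z = cst (f z) + L +o_ 0 id by exact/eqaddoP.
by apply/diff_locallyP; rewrite (diff_unique cL eqo).
Qed.

Section several_variables.
Variables (R : realType) (n : nat).
Implicit Types (z w h v : 'rV[R[i]]_n) (c : R[i]) (f g : 'rV[R[i]]_n -> R[i]).

Lemma differentiable_estimate f z : differentiable f z ->
  forall e : R, 0 < e -> exists2 d : R, 0 < d & forall h, enorm h < d ->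
    cabs (f (z + h) - f z - 'd f z h) <= e * enorm h.
Proof.
move=> /diff_locallyP[_ /eqaddoP H] e e0.
have /H/nbhs_enorm[d d0 Hd] : 0 < e%:C by rewrite ltcR.
exists d => // h hd; have := Hd h; rewrite subr0 => /(_ hd).
rewrite /= norm_cabs supnormE -rmorphM/= lecR.
rewrite -[X in cabs X]/(f (h + z) - (f z + 'd f z h)) [h + z]addrC opprD addrA.
move/le_trans; apply; rewrite ler_pM2l//; exact: supnorm_le_enorm.
Qed.

(** Restriction to a complex line, through which the one-variable estimates reach several
    variables. *)
Lemma differentiable_line f z v c : differentiable f (z + c *: v) ->
  cderiv (fun s => f (z + s *: v)) c ('d f (z + c *: v) v).
Proof.
move=> /differentiable_estimate H e e0.
have v1 : 0 < enorm v + 1 by rewrite ltr_wpDl ?enorm_ge0.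
have [d d0 {}H] := H _ (divr_gt0 e0 v1).
have d20 : 0 < d / 2 by rewrite divr_gt0.
exists (d / 2 / (enorm v + 1)); first by rewrite divr_gt0.
move=> h; rewrite ler_pdivlMr// => hd.
have h0 := cabs_ge0 h; have v0 := enorm_ge0 v.
have := H (h *: v); rewrite enormZ => /(_ _)/wrap[]; first by nra.
have -> : z + c *: v + h *: v = z + (c + h) *: v by rewrite scalerDl addrA.
rewrite linearZ/=.
have -> : h *: 'd f (z + c *: v) v = 'd f (z + c *: v) v * h by rewrite mulrC.
move/le_trans; apply.
rewrite -mulrA ler_pM2l// ler_pdivrMl//; nra.
Qed.

Definition linform (a : 'I_n -> R[i]) h : R[i] := \sum_k h ord0 k * a k.

Lemma linform_is_linear a : linear (linform a).
Proof.
move=> c h k; rewrite /linform scaler_sumr -big_split/=; apply: eq_bigr => i _.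
by rewrite !mxE mulrDl -mulrA.
Qed.

HB.instance Definition _ a := GRing.isLinear.Build R[i] 'rV[R[i]]_n R[i] _
  (linform a) (linform_is_linear a).

Lemma cabs_linform a h : cabs (linform a h) <= (\sum_k cabs (a k)) * enorm h.
Proof.
rewrite /linform mulr_suml; elim/big_ind2 : _ => [|x1 x2 y1 y2 hx hy|k _].
- by rewrite cabs0.
- by apply: (le_trans (cabsD _ _)); exact: lerD.
- by rewrite cabsM mulrC ler_wpM2l ?cabs_ge0// cabs_le_enorm.
Qed.

Lemma linform_continuous a : continuous (linform a).
Proof.
move=> z; apply/(cvg_cabs _ _ (nbhs_filter z)) => e e0.
set s := \sum_k cabs (a k).
have s1 : 0 < s + 1 by rewrite ltr_wpDl// sumr_ge0// => k _; exact: cabs_ge0.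
apply/nbhs_enorm; exists (e / (s + 1)); first by rewrite divr_gt0.
move=> w; rewrite ltr_pdivlMr// => wz /=.
rewrite -linearB; apply: (le_lt_trans (cabs_linform _ _)); rewrite -/s.
by have := enorm_ge0 (w - z); nra.
Qed.

(** A quadratic remainder with fixed [C] and [d] survives pointwise limits, unlike differentiability
    itself; this is how limits of holomorphic functions are shown to be holomorphic. *)
Lemma taylor_differentiable f z (a : 'I_n -> R[i]) (C d : R) : 0 < d ->
  (forall h, enorm h < d ->
    cabs (f (z + h) - f z - linform a h) <= C * enorm h ^+ 2) ->
  differentiable f z.
Proof.
move=> d0 H.
apply: (@linear_approx_differentiable _ _ _ _ (linform a)).
  exact: linform_continuous.
move=> _ /complex_gt0[e' e'0 ->].
have M0 : 0 < `|C| * n%:R ^+ 2 + 1 by rewrite ltr_wpDl// mulr_ge0.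
apply/nbhs_enorm; exists (Num.min d (e' / (`|C| * n%:R ^+ 2 + 1))).
  by rewrite lt_min d0 divr_gt0.
move=> h; rewrite subr0 lt_min ltr_pdivlMr// => /andP[hd he].
rewrite /= norm_cabs supnormE -rmorphM/= lecR.
rewrite [h + z]addrC opprD addrA.
apply: (le_trans (H h hd)).
have := enorm_le_supnorm h; have := supnorm_le_enorm h.
have := supnorm_ge0 h; have := enorm_ge0 h; set s := supnorm h; set t := enorm h.
rewrite -/t in he => t0 s0 st tn.
apply: (@le_trans _ _ (`|C| * (n%:R * s) ^+ 2)).
  apply: (@le_trans _ _ (`|C| * t ^+ 2)).
    by rewrite ler_wpM2r ?sqr_ge0 ?ler_norm.
  by rewrite ler_wpM2l// ler_pXn2r// nnegrE// mulr_ge0.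
have -> : `|C| * (n%:R * s) ^+ 2 = (s * (`|C| * n%:R ^+ 2)) * s by ring.
rewrite ler_wpM2r//; move: M0 he; set M := `|C| * _ => M0 he.
by nra.
Qed.

Lemma diff_linform f z : differentiable f z ->
  'd f z =1 linform (fun k => 'd f z (delta_mx ord0 k)).
Proof.
move=> _ h; rewrite {1}[h]row_sum_delta linear_sum; apply: eq_bigr => k _.
by rewrite linearZ.
Qed.

Section estimates.
Variables (f : 'rV[R[i]]_n -> R[i]) (a : 'rV[R[i]]_n) (r K : R).
Hypothesis r0 : 0 < r.
Hypothesis df : forall z, enorm (z - a) < r -> differentiable f z.
Hypothesis fK : forall z, enorm (z - a) < r -> cabs (f z) <= K.

(** The points [a + c v] with [|c| < r / |v|] stay in the ball; this radius yields the factor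
    [|v|]. *)
Lemma diff_estimate v : cabs ('d f a v) <= 8 * K / r * enorm v.
Proof.
have [v0|v0] := eqVneq (enorm v) 0.
  have -> : v = 0.
    apply/rowP => k; rewrite mxE; apply/eqP; rewrite -cabs_eq0 eq_le cabs_ge0 andbT.
    by rewrite -v0 cabs_le_enorm.
  by rewrite linear0 enorm0 mulr0 cabs0.
have vp : 0 < enorm v by rewrite lt_def v0 enorm_ge0.
have sub c : cabs (c - 0) < r / enorm v -> enorm (a + c *: v - a) < r.
  by rewrite subr0 ltr_pdivlMr// addrC addKr enormZ.
have := @cauchy_estimate _ (fun c => f (a + c *: v))
  (fun c => 'd f (a + c *: v) v) 0 (r / enorm v) K (divr_gt0 r0 vp)
  (fun c cr => differentiable_line (df (sub c cr)))
  (fun c cr => fK (sub c cr)).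
rewrite scale0r addr0 => /le_trans; apply.
by rewrite le_eqVlt; apply/orP; left; apply/eqP; field; rewrite v0 gt_eqF.
Qed.

Lemma taylor_estimate h : enorm h <= r / 4 ->
  cabs (f (a + h) - f a - 'd f a h) <= 512 * K / r ^+ 2 * enorm h ^+ 2.
Proof.
move=> hr; have [h0|h0] := eqVneq (enorm h) 0.
  have -> : h = 0.
    apply/rowP => k; rewrite mxE; apply/eqP; rewrite -cabs_eq0 eq_le cabs_ge0 andbT.
    by rewrite -h0 cabs_le_enorm.
  by rewrite addr0 subrr linear0 subr0 cabs0 enorm0 expr0n/= mulr0.
have hp : 0 < enorm h by rewrite lt_def h0 enorm_ge0.
have sub c : cabs (c - 0) < r / enorm h -> enorm (a + c *: h - a) < r.
  by rewrite subr0 ltr_pdivlMr// addrC addKr enormZ.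
have := @cauchy_taylor _ (fun c => f (a + c *: h))
  (fun c => 'd f (a + c *: h) h) 0 (r / enorm h) K (divr_gt0 r0 hp)
  (fun c cr => differentiable_line (df (sub c cr)))
  (fun c cr => fK (sub c cr)) 1.
rewrite cabs1 add0r scale0r addr0 scale1r mulr1 => /(_ _)/wrap[].
  by rewrite ler_pdivlMr// ler_pdivlMr//; lra.
move/le_trans; apply; rewrite le_eqVlt; apply/orP; left; apply/eqP.
by field; rewrite h0 gt_eqF.
Qed.

End estimates.

Lemma lipschitz_estimate f a (r K : R) : 0 < r ->
  (forall z, enorm (z - a) < r -> differentiable f z) ->
  (forall z, enorm (z - a) < r -> cabs (f z) <= K) ->
  forall z w, enorm (z - a) <= r / 2 -> enorm (w - a) <= r / 2 ->
    cabs (f w - f z) <= 16 * K / r * enorm (w - z).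
Proof.
move=> r0 df fK z w zr wr; set h := w - z.
have wE : w = z + (1 : R[i]) *: h by rewrite scale1r addrC subrK.
have := @mean_value _ (fun c => f (z + c *: h)) (fun c => 'd f (z + c *: h) h) 0 1
  (16 * K / r * enorm h).
rewrite add0r -wE scale0r addr0 cabs1 mulr1; apply => t ht.
rewrite add0r mulr1; set u := z + _.
have ur : enorm (u - a) <= r / 2.
  rewrite /u addrAC; apply: enorm_segment => //.
  by rewrite addrAC /h [z + _]addrC subrK.
have sub v : enorm (v - u) < r / 2 -> enorm (v - a) < r.
  by move=> vu; have := enormD (v - u) (u - a); rewrite addrA subrK; lra.
split; first by apply/differentiable_line/df; lra.
have r20 : 0 < r / 2 by lra.
have := @diff_estimate f u (r / 2) K r20 (fun v vu => df v (sub v vu))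
  (fun v vu => fK v (sub v vu)) h.
by have -> : 8 * K / (r / 2) = 16 * K / r by field; rewrite gt_eqF.
Qed.

End several_variables.

(** * Montel's theorem *)

Section montel.
Variables (R : realType) (n : nat).
Implicit Types (z w h v : 'rV[R[i]]_n) (c : R[i]) (f g : 'rV[R[i]]_n -> R[i]).

Lemma ultra_limit (U : set_system nat) (u : nat -> R[i]) (B : R) :
  UltraFilter U -> U [set j | cabs (u j) <= B] ->
  exists c, forall e, 0 < e -> U [set j | cabs (u j - c) < e].
Proof.
move=> UU UB; have PU : ProperFilter U := ultra_proper.
have [c [_ cc]] := @compact_cabs R B (u @ U) _ UB.
exists c => e e0.
have [//|UC] := in_ultra_setVsetC [set j | cabs (u j - c) < e] UU.
have nc : nbhs c [set a | cabs (a - c) < e] by apply/nbhs_cabs; exists e.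
have uC : (u @ U) [set a | ~ cabs (a - c) < e] by exact: UC.
by have [a []] := cc _ _ uC nc.
Qed.

(* [g] is the limit of [f_] along an ultrafilter [U] finer than the cofinite
   one; by equicontinuity the sets [|f_ j - g| < 1/(k+1) on K_ k] all belong
   to [U], so that a subsequence can be drawn from them. *)
Theorem montel (D : set 'rV[R[i]]_n) (K_ : nat -> set 'rV[R[i]]_n)
    (f_ : nat -> 'rV[R[i]]_n -> R[i]) :
  (forall k, compact (K_ k)) -> (forall k, K_ k `<=` K_ k.+1) ->
  (forall k, K_ k `<=` D) ->
  (forall z, D z -> exists2 d, 0 < d & exists B : R, \forall j \near \oo,
    forall w, enorm (w - z) < d ->
      differentiable (f_ j) w /\ cabs (f_ j w) <= B) ->
  exists (s : nat -> nat) g, {homo s : i j / (i < j)%N} /\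
    (forall z, D z -> differentiable g z) /\
    forall k e, 0 < e -> \forall j \near \oo, forall z, K_ k z ->
      cabs (f_ (s j) z - g z) < e.
Proof.
move=> cK sK KD H.
have [U [UU finer]] := ultraFilterLemma eventually_filter.
have PU : ProperFilter U := ultra_proper.
have {}H z : D z -> exists2 d, 0 < d & exists2 B : R, 0 <= B &
    U [set j | forall w, enorm (w - z) < d ->
      differentiable (f_ j) w /\ cabs (f_ j w) <= B].
  move=> /H[d d0 [B HB]]; exists d => //; exists `|B| => //.
  apply: finer; apply: filterS HB => j Hj w /Hj[dw wB]; split => //.
  exact: le_trans wB (ler_norm _).
have [g Hg] : exists g, forall z B, U [set j | cabs (f_ j z) <= B] ->
    forall e, 0 < e -> U [set j | cabs (f_ j z - g z) < e].
  suff /choice[g Hg] : forall z, exists c,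
      forall B, U [set j | cabs (f_ j z) <= B] ->
      forall e, 0 < e -> U [set j | cabs (f_ j z - c) < e] by exists g.
  move=> z; have [[B UB]|nB] := pselect (exists B, U [set j | cabs (f_ j z) <= B]).
    by have [c Hc] := ultra_limit UU UB; exists c.
  (* Default value where the sequence is unbounded along [U], which happens at no point of [D]. *)
  by exists 0 => B UB; exfalso; apply: nB; exists B.
have gU z d B w : U [set j | forall w, enorm (w - z) < d ->
      differentiable (f_ j) w /\ cabs (f_ j w) <= B] -> enorm (w - z) < d ->
    forall e, 0 < e -> U [set j | cabs (f_ j w - g w) < e].
  move=> Hz wd; apply: (Hg w B); apply: filterS Hz => j Hj.
  by have [] := Hj w wd.
have dg z : D z -> differentiable g z.
  move=> /H[d d0 [B B0 HB]].
  (* Cauchy's estimate bounds the partial derivatives at [z]; their limits along [U] are the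
     coefficients of the differential of [g]. *)
  have [a Ha] : exists a : 'I_n -> R[i], forall k e, 0 < e ->
      U [set j | cabs ('d (f_ j) z (delta_mx ord0 k) - a k) < e].
    suff /choice[a Ha] : forall k : 'I_n, exists c, forall e, 0 < e ->
        U [set j | cabs ('d (f_ j) z (delta_mx ord0 k) - c) < e] by exists a.
    move=> k; apply: (@ultra_limit _ _
      (8 * B / d * enorm (delta_mx ord0 k : 'rV[R[i]]_n)) UU).
    apply: filterS HB => j Hj.
    by apply: diff_estimate d0 _ _ _ => w wd; have [] := Hj w wd.
  apply: (@taylor_differentiable _ _ _ _ a (512 * B / d ^+ 2) (d / 4)).
    by rewrite divr_gt0.
  move=> h hd; set C := 512 * B / d ^+ 2; set s := \sum_(k < n) cabs (h ord0 k).
  have s0 : 0 <= s by apply: sumr_ge0 => k _; exact: cabs_ge0.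
  (* The linear parts cost [s e'], the values at [z] and at [z + h] cost [e'] each. *)
  apply/ler_addgt0Pr => e e0; pose e' := e / (s + 2).
  have e'0 : 0 < e' by rewrite divr_gt0//; lra.
  have zd : enorm (z - z) < d by rewrite subrr enorm0.
  have hzd : enorm (z + h - z) < d by rewrite addrC addKr; lra.
  have U1 := gU z d B z HB zd e' e'0.
  have U2 := gU z d B (z + h) HB hzd e' e'0.
  have U3 : U [set j | forall k, cabs ('d (f_ j) z (delta_mx ord0 k) - a k) < e'].
    by apply: filter_forall => k; exact: Ha.
  have [j [[Hj [H1 H2]] H3]] := filter_ex (filterI (filterI HB (filterI U1 U2)) U3).
  have dj : differentiable (f_ j) z by have [] := Hj z zd.
  have T : cabs (f_ j (z + h) - f_ j z - 'd (f_ j) z h) <= C * enorm h ^+ 2.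
    exact: (taylor_estimate d0 (fun w wd => proj1 (Hj w wd))
      (fun w wd => proj2 (Hj w wd)) (ltW hd)).
  have L : cabs ('d (f_ j) z h - linform a h) <= s * e'.
    rewrite (diff_linform dj) /linform -sumrB /s mulr_suml.
    elim/big_ind2 : _ => [|x1 x2 y1 y2 hx hy|k _].
    - by rewrite cabs0.
    - by apply: (le_trans (cabsD _ _)); exact: lerD.
    - rewrite -mulrBr cabsM ler_wpM2l ?cabs_ge0//; exact: ltW (H3 k).
  have -> : g (z + h) - g z - linform a h =
     (f_ j (z + h) - f_ j z - 'd (f_ j) z h) + ('d (f_ j) z h - linform a h)
     + ((f_ j z - g z) - (f_ j (z + h) - g (z + h))) by ring.
  apply: (le_trans (cabsD _ _)).
  have := cabsD (f_ j (z + h) - f_ j z - 'd (f_ j) z h) ('d (f_ j) z h - linform a h).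
  have := cabsB (f_ j z - g z) (f_ j (z + h) - g (z + h)).
  have ee : s * e' + e' + e' = e by rewrite /e'; field; rewrite gt_eqF//; lra.
  move: H1 H2 => /= H1 H2; lra.
have near k e : 0 < e -> U [set j | forall z, K_ k z -> cabs (f_ j z - g z) < e].
  move=> e0; apply: (compact_uniformly (P := fun j z => cabs (f_ j z - g z) < e)) => //.
  move=> z /KD/H[d d0 [B B0 HB]].
  set L := 16 * B / d; have L0 : 0 <= L by rewrite divr_ge0 ?mulr_ge0// ltW.
  have L1 : 0 < L + 1 by rewrite ltr_wpDl.
  have e80 : 0 < e / 8 by rewrite divr_gt0.
  exists (Num.min (d / 2) (e / 8 / (L + 1))).
    by rewrite lt_min !divr_gt0.
  have zd : enorm (z - z) < d by rewrite subrr enorm0.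
  have U1 := gU z d B z HB zd _ e80.
  have lip j w : (forall w, enorm (w - z) < d ->
      differentiable (f_ j) w /\ cabs (f_ j w) <= B) ->
      enorm (w - z) <= d / 2 -> cabs (f_ j w - f_ j z) <= L * enorm (w - z).
    move=> Hj wd; apply: (@lipschitz_estimate _ _ _ z d B) => //.
    - by move=> v vd; have [] := Hj v vd.
    - by move=> v vd; have [] := Hj v vd.
    - by rewrite subrr enorm0; lra.
  exists ([set j | forall w, enorm (w - z) < d ->
      differentiable (f_ j) w /\ cabs (f_ j w) <= B] `&`
    [set j | cabs (f_ j z - g z) < e / 8]); first exact: filterI.
  move=> j w [/= Hj Hjz]; rewrite lt_min => /andP[wd].
  rewrite ltr_pdivlMr// => we.
  have wd' : enorm (w - z) < d by lra.
  have U2 := gU z d B w HB wd' _ e80.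
  (* No modulus of continuity of [g] is at hand: [g w] is reached through [f_ i w], with an index
     [i] that may depend on [w]. Five errors of at most [e / 8] result. *)
  have [i [[Hi Hiz] Hiw]] := filter_ex (filterI (filterI HB U1) U2).
  have := lip i w Hi (ltW wd); have := lip j w Hj (ltW wd).
  have small : L * enorm (w - z) <= e / 8.
    by have := enorm_ge0 (w - z); nra.
  move=> l1 l2; move: Hiz Hiw => /= Hiz Hiw.
  have -> : f_ j w - g w = ((f_ j w - f_ j z) + (f_ j z - g z)) -
     ((f_ i z - g z) + ((f_ i w - f_ i z) - (f_ i w - g w))) by ring.
  apply: (le_lt_trans (cabsB _ _)).
  have := cabsD (f_ j w - f_ j z) (f_ j z - g z).
  have := cabsD (f_ i z - g z) ((f_ i w - f_ i z) - (f_ i w - g w)).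
  have := cabsB (f_ i w - f_ i z) (f_ i w - g w).
  lra.
have pick p : exists j, (p.2 < j)%N /\
    forall z, K_ p.1 z -> cabs (f_ j z - g z) < p.1.+1%:R^-1.
  have U1 : U [set j | (p.2 < j)%N] by apply: (finer [set j | (p.2 < j)%N]); exact: nbhs_infty_gt.
  have U2 := near p.1 p.1.+1%:R^-1 ltac:(by rewrite invr_gt0).
  by have [j []] := filter_ex (filterI U1 U2); exists j.
have [F HF] := choice pick.
pose s := fix s k := if k is m.+1 then F (k, s m) else F (0%N, 0%N).
have HsK k : forall z, K_ k z -> cabs (f_ (s k) z - g z) < k.+1%:R^-1.
  case: k => [|k]; first by have [] := HF (0%N, 0%N).
  by have [] := HF (k.+1, s k).
exists s, g; split; last split => //.
  apply: (@homo_ltn _ _ (fun i j => (i < j)%N)) => [|k]; first exact: ltn_trans.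
  by have [] := HF (k.+1, s k).
move=> k e e0.
have mono i : K_ k `<=` K_ (k + i)%N.
  by elim: i => [|i IH]; rewrite ?addn0// addnS; exact: subset_trans IH (sK _).
near=> j => z Kz; have kj : (k <= j)%N by near: j; exact: nbhs_infty_ge.
have Kjz : K_ j z by rewrite -(subnKC kj); exact: mono.
apply: (lt_trans (HsK j z Kjz)); near: j.
exact: near_infty_natSinv_lt (PosNum e0).
Unshelve. all: by end_near. Qed.

End montel.

(** * A metric on the plane that is complete at infinity *)

Section complete_metric.
Variable R : realType.
Implicit Types (s C K : R).

(* The metric [lam |w| |dw|] is complete at infinity: a primitive of [lam] is
   [ln (1 + ln (1 + s))]. *)
Definition lam s : R := ((1 + s) * (1 + ln (1 + s)))^-1.

Lemma ln1D_ge0 s : 0 <= s -> 0 <= ln (1 + s).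
Proof. by move=> s0; rewrite ln_ge0// lerDl. Qed.

Lemma lam_gt0 s : 0 <= s -> 0 < lam s.
Proof.
by move=> s0; have := ln1D_ge0 s0; rewrite /lam invr_gt0 => h; rewrite mulr_gt0//; lra.
Qed.

(** The left side is the derivative of [ln (1 + ln (1 + s ^+ 2))], a primitive that stays
    differentiable along [|f|] at zeros of [f]. The 6 is 3 times 2: [2 s (1 + s) <= 3 (1 + s^2)] and
    [1 + ln (1 + s) <= 2 (1 + ln (1 + s^2))]. *)
Lemma lam_smooth s : 0 <= s ->
  2 * s / ((1 + s ^+ 2) * (1 + ln (1 + s ^+ 2))) <= 6 * lam s.
Proof.
move=> s0; have l1 := ln1D_ge0 s0; have l2 := ln1D_ge0 (sqr_ge0 s).
have s2 := sqr_ge0 s.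
have h1 : 2 * s * (1 + s) <= 3 * (1 + s ^+ 2) by rewrite expr2; nra.
have h2 : 1 + ln (1 + s) <= 2 * (1 + ln (1 + s ^+ 2)).
  have : ln ((1 + s) ^+ 2) <= ln (2 * (1 + s ^+ 2)).
    rewrite ler_ln ?posrE; [|by rewrite exprn_gt0//; lra|by lra].
    by have := sqr_ge0 (s - 1); rewrite !expr2; lra.
  rewrite lnXn ?ltr_wpDr// lnM ?posrE//; last by lra.
  have : ln (1 + 1 : R) <= 1 by apply: le_ln1Dx; lra.
  have -> : 1 + 1 = 2 :> R by lra.
  rewrite -[ln (1 + s) *+ 2]mulr_natr; lra.
rewrite /lam; set a := 1 + s in h1 *; set b := 1 + ln (1 + s) in h2 *.
set c := 1 + s ^+ 2 in h1 *; set d := 1 + ln c in h2 *.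
have a0 : 0 < a by rewrite /a; lra.
have b0 : 0 < b by rewrite /b /a; lra.
have c0 : 0 < c by rewrite /c; lra.
have d0 : 0 < d by rewrite /d /c; lra.
rewrite ler_pdivrMr ?mulr_gt0//.
have -> : 6 * (a * b)^-1 * (c * d) = 3 * c * (2 * d) / (a * b).
  by field; rewrite !gt_eqF.
rewrite ler_pdivlMr ?mulr_gt0// [leLHS]mulrA.
by apply: ler_pM; [rewrite !mulr_ge0// ltW|exact: ltW|exact: h1|exact: h2].
Qed.

(** Obtained by solving [ln (1 + ln (1 + |w|^2)) <= 6 C + ln (1 + ln (1 + K^2))] and using
    [|w| <= 1 + |w|^2]. *)
Definition growth C K : R := expR (expR (6 * C) * (1 + ln (1 + K ^+ 2))).

(** Completeness in quantitative form: [ln (1 + ln (1 + |f|^2))] has derivative at most [6 C] along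
    the segment. *)
Lemma metric_growth (f f' : R[i] -> R[i]) z h C K :
  (forall t : R, 0 <= t <= 1 -> cderiv f (z + t%:C * h) (f' (z + t%:C * h)) /\
    cabs (f' (z + t%:C * h) * h) * lam (cabs (f (z + t%:C * h))) <= C) ->
  cabs (f z) <= K -> cabs (f (z + h)) <= growth C K.
Proof.
move=> H fK.
pose a (t : R) := complex.Re (f (z + t%:C * h)).
pose b (t : R) := complex.Im (f (z + t%:C * h)).
pose N t := a t ^+ 2 + b t ^+ 2.
have NE t : N t = cabs (f (z + t%:C * h)) ^+ 2 by rewrite sqr_cabs.
have N0 t : 0 <= N t by rewrite NE sqr_ge0.
pose a' (t : R) := complex.Re (f' (z + t%:C * h) * h).
pose b' (t : R) := complex.Im (f' (z + t%:C * h) * h).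
pose N' t := 2 * (a t * a' t + b t * b' t).
have dP (t : R) : 0 <= t <= 1 ->
    is_derive t (1 : R) (fun s => ln (1 + ln (1 + N s)))
      ((1 + ln (1 + N t))^-1 * ((1 + N t)^-1 * N' t)).
  move=> /H[df _].
  have da : is_derive t (1 : R) a (a' t) := cderiv_is_derive_Re df.
  have db : is_derive t (1 : R) b (b' t) := cderiv_is_derive_Im df.
  have dN : is_derive t (1 : R) (fun s => 1 + N s) (N' t).
    apply: is_derive_eq; rewrite /GRing.scale/= /N'; ring.
  have p1 : 0 < 1 + N t by rewrite ltr_wpDr.
  have p2 : 0 < 1 + ln (1 + N t) by rewrite ltr_wpDr// ln1D_ge0.
  have dl1 := is_derive1_ln p1.
  have dL : is_derive t (1 : R) (fun s => ln (1 + N s)) ((1 + N t)^-1 * N' t).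
    exact: (@is_derive1_comp _ _ (fun s => 1 + N s)).
  have dL1 : is_derive t (1 : R) (fun s => 1 + ln (1 + N s)) ((1 + N t)^-1 * N' t).
    by have := is_deriveD (is_derive_cst (1 : R) t 1) dL; rewrite add0r.
  have dl2 := is_derive1_ln p2.
  exact: (@is_derive1_comp _ _ (fun s => 1 + ln (1 + N s))).
have [t ht E0] := real_mvt dP.
have [_ HC] := H t ht.
have N'le : N' t <= 2 * cabs (f (z + t%:C * h)) * cabs (f' (z + t%:C * h) * h).
  rewrite /N' /a /b /a' /b'; set u := f _; set v := f' _ * h.
  have -> : complex.Re u * complex.Re v + complex.Im u * complex.Im v =
     complex.Re (u^*%C * v) by case: (u) => ? ?; case: (v) => ? ? /=; ring.
  rewrite -mulrA ler_pM2l//; apply: le_trans (ler_norm _) _.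
  apply: le_trans (Re_le_cabs _) _; rewrite cabsM.
  by have -> : cabs u^*%C = cabs u by case: (u) => ? ?; rewrite !cabsE sqrrN.
set s := cabs (f (z + t%:C * h)) in HC N'le.
set v := cabs (f' (z + t%:C * h) * h) in HC N'le.
have s0 : 0 <= s by exact: cabs_ge0.
have v0 : 0 <= v by exact: cabs_ge0.
have der : (1 + ln (1 + N t))^-1 * ((1 + N t)^-1 * N' t) <= 6 * C.
  have := lam_smooth s0; rewrite NE -/s => sm.
  have l2 := ln1D_ge0 (sqr_ge0 s).
  have c0 : 0 < (1 + s ^+ 2) * (1 + ln (1 + s ^+ 2)).
    by rewrite mulr_gt0//; have := sqr_ge0 s; lra.
  rewrite mulrA -invfM [_ * (1 + s ^+ 2)]mulrC.
  apply: (@le_trans _ _ (((1 + s ^+ 2) * (1 + ln (1 + s ^+ 2)))^-1 * (2 * s * v))).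
    by rewrite ler_pM2l ?invr_gt0.
  set m := (_ * _)^-1 in sm *.
  have -> : m * (2 * s * v) = 2 * s * m * v by ring.
  apply: (@le_trans _ _ (6 * lam s * v)); first by rewrite ler_wpM2r.
  by rewrite -mulrA ler_pM2l// mulrC.
have E : ln (1 + ln (1 + N 1)) - ln (1 + ln (1 + N 0)) <= 6 * C.
  by move: E0 => /= ->.
have N1 : N 1 = cabs (f (z + h)) ^+ 2 by rewrite NE rmorph1 mul1r.
have N00 : N 0 = cabs (f z) ^+ 2 by rewrite NE rmorph0 mul0r addr0.
have q1 : 0 < 1 + ln (1 + N 1) by rewrite ltr_wpDr// ln1D_ge0.
have q0 : 0 < 1 + ln (1 + N 0) by rewrite ltr_wpDr// ln1D_ge0.
have step : 1 + ln (1 + N 1) <= expR (6 * C) * (1 + ln (1 + K ^+ 2)).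
  rewrite -[leLHS]lnK ?posrE//.
  have -> : ln (1 + ln (1 + N 1)) = ln (1 + ln (1 + N 0)) +
      (ln (1 + ln (1 + N 1)) - ln (1 + ln (1 + N 0))) by ring.
  rewrite expRD lnK ?posrE// mulrC; apply: ler_pM; rewrite ?expR_ge0 ?(ltW q0)//.
    by rewrite ler_expR.
  rewrite lerD2l ler_ln ?posrE ?ltr_wpDr ?sqr_ge0// lerD2l N00.
  by rewrite ler_pXn2r ?nnegrE ?cabs_ge0//; exact: le_trans (cabs_ge0 _) fK.
have {step} : ln (1 + N 1) <= expR (6 * C) * (1 + ln (1 + K ^+ 2)) by lra.
rewrite -ler_expR lnK ?posrE ?ltr_wpDr// -/(growth C K) N1.
by have := cabs_ge0 (f (z + h)); rewrite expr2; nra.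
Qed.

End complete_metric.

(** * Normality from locally bounded metric lengths *)

Section normality_criterion.
Variables (R : realType) (n : nat).
Implicit Types (z w h v : 'rV[R[i]]_n) (f g : 'rV[R[i]]_n -> R[i]) (C K : R).

Lemma growth_segment f z v C K :
  (forall t : R, 0 <= t <= 1 -> differentiable f (z + t%:C *: v) /\
    cabs ('d f (z + t%:C *: v) v) * lam (cabs (f (z + t%:C *: v))) <= C) ->
  cabs (f z) <= K -> cabs (f (z + v)) <= growth C K.
Proof.
move=> H fK.
have := @metric_growth _ (fun c => f (z + c *: v))
  (fun c => 'd f (z + c *: v) v) 0 1 C K.
rewrite add0r scale1r scale0r addr0; move/(_ _ fK); apply => t ht.
rewrite add0r !mulr1.
by have [df fC] := H t ht; split => //; exact: differentiable_line.
Qed.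

(** [1 / (1 - |z|)] is locally bounded in the ball, hence bounded on [K]. *)
Lemma unit_ball_compact (K : set 'rV[R[i]]_n) :
  compact K -> K `<=` @unit_ball R n ->
  exists2 r : R, 0 < r < 1 & forall z, K z -> enorm z <= r.
Proof.
move=> cK KD.
have [B HB] : exists B, forall z, K z -> (1 - enorm z)^-1 <= B.
  apply: compact_bounded_above cK _ => z /KD; rewrite /unit_ball/= => z1.
  exists ((1 - enorm z) / 2); first by lra.
  exists ((1 - enorm z) / 2)^-1 => w wz.
  have := enormD (w - z) z; rewrite subrK => wE.
  by rewrite lef_pV2 ?posrE; lra.
have B0 : 0 < `|B| + 2 by rewrite ltr_wpDl.
exists (1 - (`|B| + 2)^-1).
  have : 0 < (`|B| + 2)^-1 by rewrite invr_gt0.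
  have : (`|B| + 2)^-1 <= 2^-1 by rewrite lef_pV2 ?posrE// lerDr.
  have : (2 : R)^-1 < 1 by rewrite invf_lt1//; lra.
  lra.
move=> z Kz; have := HB z Kz; have : enorm z < 1 by exact: KD.
move=> z1 zB; have : (`|B| + 2)^-1 <= 1 - enorm z; last by lra.
rewrite -[leRHS]invrK lef_pV2 ?posrE ?invr_gt0//; last by lra.
by have := ler_norm B; lra.
Qed.

Lemma compact_enorm_bounded (K : set 'rV[R[i]]_n) :
  compact K -> exists B : R, forall z, K z -> enorm z <= B.
Proof.
move=> cK; apply: compact_bounded_above cK _ => z _.
exists 1 => //; exists (1 + enorm z) => w wz.
by have := enormD (w - z) z; rewrite subrK; lra.
Qed.

Definition exhaustion (k : nat) : set 'rV[R[i]]_n :=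
  [set z | enorm z <= 1 - k.+1%:R^-1].

Lemma exhaustionS k : exhaustion k `<=` exhaustion k.+1.
Proof.
move=> z; rewrite /exhaustion/= => /le_trans; apply.
by rewrite lerD2l lerN2 lef_pV2 ?posrE// ler_nat.
Qed.

Lemma sub_exhaustion (K : set 'rV[R[i]]_n) : compact K ->
  K `<=` @unit_ball R n -> exists k, K `<=` exhaustion k.
Proof.
move=> cK /(unit_ball_compact cK)[r /andP[_ r1] Kr].
have r10 : 0 < 1 - r by lra.
have [k hk] := filter_ex (near_infty_natSinv_lt (PosNum r10)).
have {}hk : k.+1%:R^-1 < 1 - r := hk.
exists k => z /Kr; rewrite /exhaustion/= => /le_trans; apply.
by rewrite lerBrDr -lerBrDl ltW.
Qed.

(** Dichotomy at the origin. If [f_ j 0] is bounded along a subsequence, [growth] bounds that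
    subsequence on compact sets and Montel's theorem applies. Otherwise [|f_ j 0|] tends to
    infinity, and [growth] read from [z] back to 0 shows that values of modulus at most [M] on a
    compact set eventually cease. *)
Theorem normal_of_metric_bound (F : set ('rV[R[i]]_n -> R[i])) :
  (forall f, F f -> holomorphic_on (@unit_ball R n) f) ->
  (forall r, 0 < r < 1 -> exists C, forall f z v, F f -> enorm z <= r ->
    enorm v <= 1 -> cabs ('d f z v) * lam (cabs (f z)) <= C) ->
  normal_family (@unit_ball R n) F.
Proof.
move=> hF HC f_ Ff.
have grow r C K j z w : 0 < r < 1 ->
    (forall f z v, F f -> enorm z <= r -> enorm v <= 1 ->
      cabs ('d f z v) * lam (cabs (f z)) <= C) ->
    enorm z <= r -> enorm w <= r -> enorm (w - z) <= 1 ->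
    cabs (f_ j z) <= K -> cabs (f_ j w) <= growth C K.
  move=> /andP[r0 r1] HrC zr wr wz fK.
  have wE : w = z + (w - z) by rewrite addrC subrK.
  rewrite wE; apply: growth_segment => // t ht.
  have zt : enorm (z + t%:C *: (w - z)) <= r.
    by apply: enorm_segment => //; rewrite -wE.
  split; last by apply: HrC.
  by apply: (hF _ (Ff j)); exact: le_lt_trans zt r1.
have [[K HK]|noK] := pselect (exists K, forall N, exists j,
    (N < j)%N /\ cabs (f_ j 0) <= K).
  have [p Hp] := choice HK.
  pose s0 := fix s0 k := if k is m.+1 then p (s0 m) else p 0%N.
  have s0homo : {homo s0 : i j / (i < j)%N}.
    apply: (@homo_ltn _ _ (fun i j => (i < j)%N)) => [|k]; first exact: ltn_trans.
    by have [] := Hp (s0 k).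
  have s0K k : cabs (f_ (s0 k) 0) <= K.
    by case: k => [|k]; [have [] := Hp 0%N|have [] := Hp (s0 k)].
  have loc z : unit_ball z -> exists2 d, 0 < d & exists B : R,
      \forall j \near \oo, forall w, enorm (w - z) < d ->
        differentiable (f_ (s0 j)) w /\ cabs (f_ (s0 j) w) <= B.
    rewrite /unit_ball/= => z1; have z0 := enorm_ge0 z.
    pose r := (1 + enorm z) / 2.
    have r01 : 0 < r < 1 by rewrite /r; lra.
    have [C HrC] := HC r r01.
    exists ((1 - enorm z) / 2); first by lra.
    exists (growth C K); apply: nearW => j w wz.
    have wr : enorm w <= r by have := enormD (w - z) z; rewrite subrK /r; lra.
    have /andP[r0 r1] := r01.
    split; first by apply: (hF _ (Ff _)); exact: le_lt_trans wr r1.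
    apply: (grow r C K (s0 j) 0 w) => //; first by rewrite enorm0 ltW.
    by rewrite subr0; lra.
  have sub k : exhaustion k `<=` @unit_ball R n.
    move=> z /le_lt_trans; apply.
    by rewrite ltrBlDr ltrDl invr_gt0.
  have [s [g [shomo [dg ug]]]] := @montel R n (@unit_ball R n) exhaustion
    (fun j => f_ (s0 j)) (fun k => @compact_enorm R n _) exhaustionS sub loc.
  exists (s0 \o s); first by move=> i j ij; exact/s0homo/shomo.
  left; exists g; first exact: dg.
  move=> L cL LD; apply/uniform_cabs => e e0.
  have [k Lk] := sub_exhaustion cL LD.
  by apply: filterS (ug k e e0) => j Hj z /Lk; exact: Hj.
exists id => //; right => L cL LD M.
have [r r01 Lr] := unit_ball_compact cL LD.
have [C HrC] := HC r r01.
have [N HN] : exists N, forall j, (N < j)%N -> growth C M < cabs (f_ j 0).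
  apply: contrapT => no; apply: noK; exists (growth C M) => N.
  apply: contrapT => no'; apply: no; exists N => j Nj.
  by rewrite ltNge; apply/negP => h; apply: no'; exists j.
exists N.+1 => // j /= Nj z Lz; rewrite ltNge; apply/negP => zM.
have := HN j Nj; rewrite ltNge => /negP; apply.
have zr := Lr z Lz; have /andP[r0 r1] := r01.
apply: (grow r C M j z 0) => //; first by rewrite enorm0 ltW.
by rewrite sub0r enormN; lra.
Qed.

End normality_criterion.

(** * The weight attached to a scale *)

Section rescaling.
Variables (R : realType) (gamma : R).
Hypotheses (gamma0 : 0 <= gamma) (gamma1 : gamma < 1).
Implicit Types (s t u e : R).

Definition kap t : R := t `^ (- gamma).

Lemma kap_gt0 t : 0 < t -> 0 < kap t.
Proof. exact: powR_gt0. Qed.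

Lemma kap1 : kap 1 = 1.
Proof. by rewrite /kap powR1. Qed.

Lemma mul_kap t : 0 < t -> t * kap t = t `^ (1 - gamma).
Proof.
by move=> t0; rewrite powRD ?powRr1 ?(ltW t0)//; apply/implyP => _; rewrite gt_eqF.
Qed.

Lemma kap_le u t : 0 < u -> u <= t -> kap t <= kap u.
Proof.
move=> u0 ut; have t0 := lt_le_trans u0 ut.
rewrite /kap !powRN lef_pV2 ?posrE ?powR_gt0//.
by rewrite ge0_ler_powR// nnegrE ltW.
Qed.

Lemma mul_kap_le u t : 0 < u -> u <= t -> u * kap u <= t * kap t.
Proof.
move=> u0 ut; have t0 := lt_le_trans u0 ut.
by rewrite !mul_kap// ge0_ler_powR ?nnegrE ?(ltW u0) ?(ltW t0)// subr_ge0 ltW.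
Qed.

Lemma mul_kap_small e : 0 < e ->
  exists2 d, 0 < d & forall t, 0 < t -> t <= d -> t * kap t <= e.
Proof.
move=> e0; have g1 : 0 < 1 - gamma by rewrite subr_gt0.
exists (e `^ (1 - gamma)^-1); first exact: powR_gt0.
move=> t t0 td; rewrite mul_kap//.
apply: (@le_trans _ _ ((e `^ (1 - gamma)^-1) `^ (1 - gamma))).
  by rewrite ge0_ler_powR ?nnegrE ?powR_ge0 ?(ltW t0) ?(ltW g1).
by rewrite -powRrM mulVf ?gt_eqF// powRr1// ltW.
Qed.

(* [weight (|f z|) t * |Df z|] is the length of the differential at 0 of
   [zeta |-> kap t * f (z + t zeta)] in the metric [lam]. *)
Definition weight s t : R := t * kap t * lam (kap t * s).

Lemma weight1 s : weight s 1 = lam s.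
Proof. by rewrite /weight kap1 !mul1r. Qed.

Lemma weight_ge0 s t : 0 < t -> 0 <= s -> 0 <= weight s t.
Proof.
move=> t0 s0; have k0 := kap_gt0 t0.
by rewrite /weight ltW// !mulr_gt0// lam_gt0// mulr_ge0// ltW.
Qed.

Lemma weight_le_mul_kap s t : 0 < t -> 0 <= s -> weight s t <= t * kap t.
Proof.
move=> t0 s0; have k0 := kap_gt0 t0.
have ks : 0 <= kap t * s by rewrite mulr_ge0// ltW.
rewrite /weight ler_piMr ?(ltW (mulr_gt0 t0 k0))//.
have := ln1D_ge0 ks; rewrite /lam => l0.
by rewrite invf_le1; nra.
Qed.

(** The numerator [t * kap t], which is t^(1 - gamma), increases since [gamma < 1]; the denominators
    do not, since [kap] is nonincreasing for [gamma >= 0]. *)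
Lemma weight_le u t s : 0 <= s -> 0 < u -> u <= t -> weight s u <= weight s t.
Proof.
move=> s0 u0 ut; have t0 := lt_le_trans u0 ut.
have ku := kap_gt0 u0; have kt := kap_gt0 t0.
have kk := kap_le u0 ut; have mm := mul_kap_le u0 ut.
have a0 : 0 <= kap u * s by rewrite mulr_ge0// ltW.
have b0 : 0 <= kap t * s by rewrite mulr_ge0// ltW.
have la := ln1D_ge0 a0; have lb := ln1D_ge0 b0.
have ab : kap t * s <= kap u * s by rewrite ler_wpM2r.
have lab : ln (1 + kap t * s) <= ln (1 + kap u * s).
  by rewrite ler_ln ?posrE; lra.
rewrite /weight /lam !invfM !mulrA; apply: ler_pM.
- by apply: mulr_ge0; [rewrite ltW ?mulr_gt0|rewrite invr_ge0; lra].
- by rewrite invr_ge0; lra.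
- rewrite ler_pdivrMr; last by lra.
  rewrite mulrAC ler_pdivlMr; last by lra.
  set A := kap u in ku kk mm a0 ab *; set B := kap t in kt kk mm b0 ab *.
  have : u * A * (B * s) <= t * B * (A * s).
    have -> : u * A * (B * s) = u * (A * (B * s)) by ring.
    have -> : t * B * (A * s) = t * (A * (B * s)) by ring.
    by rewrite ler_wpM2r// mulr_ge0// ltW.
  lra.
- by rewrite lef_pV2 ?posrE; lra.
Qed.

(** One factor 2 comes from [t], the other from the logarithms: as [kap (t / 2) <= 2 * kap t],
    halving adds at most [ln 2 <= 1] to the logarithm. *)
Lemma weight_half s t : 0 <= s -> 0 < t -> weight s t <= 4 * weight s (t / 2).
Proof.
move=> s0 t0; have h0 : 0 < t / 2 by rewrite divr_gt0.
have ht : t / 2 <= t by lra.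
have ku := kap_gt0 h0; have kt := kap_gt0 t0.
have kk := kap_le h0 ht; have mm := mul_kap_le h0 ht.
set A := kap (t / 2) in ku kk mm *; set B := kap t in kt kk mm *.
have A2 : A <= 2 * B.
  by move: mm; rewrite -subr_ge0 => mm; rewrite -subr_ge0 -(pmulr_rge0 _ h0); lra.
have a0 : 0 <= A * s by rewrite mulr_ge0// ltW.
have b0 : 0 <= B * s by rewrite mulr_ge0// ltW.
have la := ln1D_ge0 a0; have lb := ln1D_ge0 b0.
have lab : ln (1 + A * s) <= 1 + ln (1 + B * s).
  have : ln (1 + A * s) <= ln (2 * (1 + B * s)).
    rewrite ler_ln ?posrE; [|by lra|by lra].
    have ABs : A * s <= 2 * B * s by rewrite ler_wpM2r.
    lra.
  rewrite lnM ?posrE//; last by lra.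
  have : ln (1 + 1 : R) <= 1 by apply: le_ln1Dx; lra.
  have -> : 1 + 1 = 2 :> R by lra.
  lra.
have x0 : 0 < 1 + B * s by lra.
have y0 : 0 < 1 + ln (1 + B * s) by lra.
have z0 : 0 < 1 + A * s by lra.
have w0 : 0 < 1 + ln (1 + A * s) by lra.
rewrite /weight /lam -/A -/B.
set y := 1 + ln (1 + B * s) in y0 *; set w := 1 + ln (1 + A * s) in w0 *.
have wy : w <= 2 * y by rewrite /w /y; lra.
rewrite ler_pdivrMr ?mulr_gt0//.
have -> : 4 * (t / 2 * A / ((1 + A * s) * w)) * ((1 + B * s) * y) =
   t * (A * (1 + B * s)) * (2 * y) / ((1 + A * s) * w).
  by field; rewrite !gt_eqF.
rewrite ler_pdivlMr ?mulr_gt0// [leLHS]mulrA; apply: ler_pM.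
- by rewrite !mulr_ge0// ltW.
- exact: ltW.
- by rewrite -[leLHS]mulrA ler_pM2l//; lra.
- exact: wy.
Qed.

Lemma weight_dyadic s k : 0 <= s -> lam s <= 4 ^+ k * weight s (2^-1 ^+ k).
Proof.
move=> s0; elim: k => [|k IH]; first by rewrite !expr0 mul1r weight1.
apply: (le_trans IH); rewrite exprSr -mulrA ler_pM2l ?exprn_gt0//.
by rewrite exprSr weight_half// exprn_gt0// invr_gt0.
Qed.

End rescaling.

(** * Zalcman's choice of centres and scales *)

Section point_selection.
Variables (R : realType) (n : nat) (gamma : R).
Hypotheses (gamma0 : 0 <= gamma) (gamma1 : gamma < 1).
Implicit Types (z w v : 'rV[R[i]]_n) (f : 'rV[R[i]]_n -> R[i]).

Lemma holomorphic_bounded f (r : R) : r < 1 ->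
  holomorphic_on (@unit_ball R n) f ->
  exists B, forall z, enorm z <= r -> cabs (f z) <= B.
Proof.
move=> r1 hf; apply: (compact_bounded_above (@compact_enorm R n r)) => z /= zr.
have df : differentiable f z by apply: hf; exact: le_lt_trans zr r1.
have /(cvg_cabs _ _ (nbhs_filter z))/(_ 1 ltr01)/nbhs_enorm[d d0 Hd] :=
  differentiable_continuous df.
exists d => //; exists (1 + cabs (f z)) => w /Hd/= h.
by have := cabsD (f w - f z) (f z); rewrite subrK; lra.
Qed.

Lemma diff_bounded f (r : R) : 0 < r < 1 ->
  holomorphic_on (@unit_ball R n) f ->
  exists2 B, 0 <= B & forall z v, enorm z <= r -> enorm v <= 1 ->
    cabs ('d f z v) <= B.
Proof.
move=> /andP[r0 r1] hf; pose r' := (1 + r) / 2.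
have r'1 : r' < 1 by rewrite /r'; lra.
have [K HK] := holomorphic_bounded r'1 hf.
have K0 : 0 <= K.
  by apply: le_trans (cabs_ge0 (f 0)) (HK _ _); rewrite enorm0 /r'; lra.
pose d := (1 - r) / 2; have d0 : 0 < d by rewrite /d; lra.
have Kd : 0 <= 8 * K / d.
  by apply: divr_ge0; [apply: mulr_ge0; rewrite ?ler0n|exact: ltW].
exists (8 * K / d) => // z v zr v1.
have sub w : enorm (w - z) < d -> enorm w <= r'.
  by move=> wz; have := enormD (w - z) z; rewrite subrK /r' /d in wz *; lra.
apply: (@le_trans _ _ (8 * K / d * enorm v)); last by rewrite ler_piMr.
apply: (diff_estimate d0) => w /sub wr'; last exact: HK.
by apply: hf; exact: le_lt_trans wr' r'1.
Qed.

Lemma dyadic_small (e : R) : 0 < e ->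
  exists N : nat, forall k, (N <= k)%N -> (2^-1 : R) ^+ k < e.
Proof.
move=> e0; exists (Num.bound e^-1) => k Nk.
have := archi_boundP (ltW (etrans (invr_gt0 e) e0)) => he.
rewrite exprVn invf_plt ?posrE ?exprn_gt0//; apply: lt_le_trans he _.
rewrite -natrX ler_nat (leq_trans Nk)//; apply: ltnW; exact: ltn_expl.
Qed.

Lemma dyadic_gt0 k : 0 < (2^-1 : R) ^+ k.
Proof. by rewrite exprn_gt0// invr_gt0. Qed.

Lemma dyadic_le k m : (k <= m)%N -> (2^-1 : R) ^+ m <= 2^-1 ^+ k.
Proof. by move=> km; apply: ler_wiXn2l => //; lra. Qed.

(* The scale [2^-k (r - |z|)] vanishes on the sphere of radius [r]; [k] is the
   least exponent for which the weighted differential is at most 1 on the whole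
   ball, and [z] is a point where this fails for [k - 1]. *)
Lemma rescaling_points (F : set ('rV[R[i]]_n -> R[i])) :
  (forall f, F f -> holomorphic_on (@unit_ball R n) f) ->
  ~ normal_family (@unit_ball R n) F ->
  exists2 r : R, 0 < r < 1 & forall j, exists f z t v,
    [/\ F f, enorm z < r, 0 < t <= 2^-1 ^+ j & enorm v <= 1] /\
    [/\ 1 < 4 * (cabs ('d f z v) * weight gamma (cabs (f z)) t)
      & forall w u, enorm (w - z) <= 2 ^+ j / 2 * t -> enorm u <= 1 ->
        enorm w < r /\ cabs ('d f w u) * weight gamma (cabs (f w)) t <= 4].
Proof.
move=> hF nF.
have [r0 r01 unb] : exists2 r, 0 < r < 1 & forall C, exists f z v,
    [/\ F f, enorm z <= r, enorm v <= 1 & C < cabs ('d f z v) * lam (cabs (f z))].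
  apply: contrapT => no; apply: nF; apply: normal_of_metric_bound => // r r01.
  apply: contrapT => noC; apply: no; exists r => // C.
  apply: contrapT => nof; apply: noC; exists C => f z v Ff zr v1.
  by rewrite leNgt; apply/negP => lt; apply: nof; exists f, z, v.
(* Since [r > r0], the factor [r - |z|] of the scale stays above a fixed [2^-m] on the ball where
   the lengths are unbounded. *)
pose r := (1 + r0) / 2; have r01' : 0 < r < 1 by rewrite /r; lra.
exists r => // j.
have [m Hm] := @dyadic_small (r - r0) ltac:(rewrite /r; lra).
have {Hm}Hm := Hm m (leqnn m).
(* Halving the scale divides the weight by at most 4, so at [w0] all exponents up to [j] stay bad.
   The least good one exceeds [j], which gives [t <= 2^-j] and the growing balls. *)
have [f [w0 [v0 [Ff w0r v01 big]]]] := unb (4 ^+ (j + m)).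
pose good (k : nat) := `[< forall z v, enorm z < r -> enorm v <= 1 ->
  cabs ('d f z v) * weight gamma (cabs (f z)) (2^-1 ^+ k * (r - enorm z)) <= 1 >].
have bad k : (k <= j)%N -> ~~ good k.
  move=> kj; apply/negP => /asboolP good_k.
  have w0r' : enorm w0 < r by rewrite /r; lra.
  have := good_k w0 v0 w0r' v01; rewrite leNgt => /negP; apply.
  have le4 : (4 : R) ^+ (k + m) <= 4 ^+ (j + m).
    by apply: ler_weXn2l; [lra|rewrite leq_add2r].
  set s := cabs (f w0) in big *; have s0 : 0 <= s by exact: cabs_ge0.
  set D := cabs _ in big *; have D0 : 0 <= D by exact: cabs_ge0.
  have := @weight_dyadic _ gamma gamma0 gamma1 s (k + m) s0.
  have : weight gamma s (2^-1 ^+ (k + m)) <=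
      weight gamma s (2^-1 ^+ k * (r - enorm w0)).
    apply: (weight_le gamma0 gamma1 s0 (dyadic_gt0 _)).
    by rewrite exprD ler_pM2l ?dyadic_gt0//; lra.
  set W := weight _ _ (_ * _); set W' := weight _ _ _ => WW lW.
  have p4 : (0 : R) < 4 ^+ (k + m) by rewrite exprn_gt0.
  have : 4 ^+ (k + m) < 4 ^+ (k + m) * (D * W).
    apply: (le_lt_trans le4); apply: (lt_le_trans big).
    rewrite mulrCA ler_wpM2l//; apply: (le_trans lW).
    by rewrite ler_pM2l.
  by rewrite -[ltLHS]mulr1 ltr_pM2l.
(* The differential is bounded on the ball of radius [r < 1], and the weight is at most [t * kap t],
   which tends to 0. *)
have [k0 good0] : exists k, good k.
  have [B B0 HB] := diff_bounded r01' (hF f Ff).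
  have B1 : 0 < (B + 1)^-1 by rewrite invr_gt0; lra.
  have [d d0 Hd] := mul_kap_small gamma1 B1.
  have [k Hk] := dyadic_small d0.
  exists k; apply/asboolP => z v zr v1.
  have z0 := enorm_ge0 z; have kp := dyadic_gt0 k.
  have rz : 0 < r - enorm z by lra.
  set t := 2^-1 ^+ k * _; have t0 : 0 < t by rewrite mulr_gt0.
  have td : t <= d.
    apply: le_trans (ltW (Hk k (leqnn k))); rewrite /t ler_piMr ?(ltW kp)//.
    by lra.
  have := weight_le_mul_kap gamma t0 (cabs_ge0 (f z)).
  have := Hd t t0 td; set W := weight _ _ _ => W1 W2.
  have DB := HB z v (ltW zr) v1.
  have W0 : 0 <= W by apply: weight_ge0 => //; exact: cabs_ge0.
  apply: (@le_trans _ _ (B * (B + 1)^-1)).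
    by apply: ler_pM; rewrite ?cabs_ge0//; exact: le_trans W2 W1.
  by rewrite ler_pdivrMr ?mul1r//; lra.
case: (ex_minnP (ex_intro good k0 good0)) => k good_k min_k.
have jk : (j < k)%N by rewrite ltnNge; apply/negP => /bad; rewrite good_k.
case: k => // k in good_k min_k jk *.
have {min_k} : ~~ good k by apply/negP => /min_k; rewrite ltnn.
move=> /asboolPn/existsNP[z /existsNP[v]].
move=> /not_implyP[zr] /not_implyP[v1] /negP; rewrite -ltNge => Dz.
have z0 := enorm_ge0 z; have rz : 0 < r - enorm z by lra.
have kp := dyadic_gt0 k.+1.
pose t := 2^-1 ^+ k.+1 * (r - enorm z).
have t0 : 0 < t by rewrite mulr_gt0.
have t2 : 2^-1 ^+ k * (r - enorm z) = 2 * t.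
  by rewrite /t exprS !mulrA mulfV// mul1r.
exists f, z, t, v; split; first split => //.
  rewrite t0/=; apply: le_trans (dyadic_le (ltnW jk)).
  by rewrite /t ler_piMr ?(ltW kp)//; lra.
split.
  (* The bound fails at scale [2 t]; passing to [t] costs the factor 4. *)
  apply: (lt_le_trans Dz); rewrite t2 [leRHS]mulrCA ler_wpM2l ?cabs_ge0//.
  have -> : weight gamma (cabs (f z)) t = weight gamma (cabs (f z)) (2 * t / 2).
    by congr weight; field.
  by apply: weight_half => //; rewrite ?cabs_ge0// mulr_gt0.
move=> w u wz u1.
(* Because [j < k.+1], moving from [z] to [w] uses up at most half of [r - |z|]. The scale at [w] is
   then at least [t / 2], and [weight_half] gives the bound 4. *)
have wz2 : enorm (w - z) <= (r - enorm z) / 2.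
  apply: (le_trans wz); rewrite /t.
  have : 2 ^+ j * 2^-1 ^+ k.+1 <= (1 : R).
    apply: (@le_trans _ _ (2 ^+ j * 2^-1 ^+ j)).
      by rewrite ler_pM2l ?exprn_gt0// dyadic_le// ltnW.
    by rewrite -exprMn mulfV// expr1n.
  set p := 2^-1 ^+ k.+1; set q := 2 ^+ j => pq.
  have -> : q / 2 * (p * (r - enorm z)) = (q * p) * ((r - enorm z) / 2).
    by field.
  by rewrite ler_piMl//; lra.
have wE : enorm w <= enorm z + (r - enorm z) / 2.
  by have := enormD (w - z) z; rewrite subrK; lra.
have wr : enorm w < r by lra.
split => //; set s := cabs (f w); have s0 : 0 <= s by exact: cabs_ge0.
have D0 := cabs_ge0 ('d f w u).
have /asboolP/(_ w u wr u1) := good_k; rewrite -/s.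
have th : t / 2 <= 2^-1 ^+ k.+1 * (r - enorm w).
  by rewrite /t -mulrA ler_pM2l//; lra.
have th0 : 0 < t / 2 by rewrite divr_gt0.
have := weight_le gamma0 gamma1 s0 th0 th.
have := weight_half gamma0 gamma1 s0 t0.
set W1 := weight _ s t; set W2 := weight _ s (t / 2).
set W3 := weight _ s _ => h1 h2 h3.
apply: (@le_trans _ _ (cabs ('d f w u) * (4 * W3))); last by lra.
by rewrite ler_wpM2l//; move: h1 h2; clear; lra.
Qed.

End point_selection.

(** * Rescaled functions: metric lengths and the value at the centre *)

Lemma is_diff_affine_comp (K : numFieldType) (V W : normedModType K) (f : V -> W)
    (z w : V) (c t : K) : differentiable f (z + t *: w) ->
  is_diff w (fun x => c *: f (z + t *: x))
    (fun u => c *: (t *: 'd f (z + t *: w) u)).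
Proof.
move=> df; pose h x : V := z + t *: x.
have dh : is_diff w h ( *:%R t).
  have : is_diff w (cst z + *:%R t) (0 + *:%R t) by exact: is_diffD.
  by rewrite add0r.
have dF : is_diff (h w) f ('d f (h w)) by exact: DiffDef.
have -> : (fun x => c *: f (z + t *: x)) = c *: (f \o h) by [].
have <- : c *: ('d f (h w) \o *:%R t) = (fun u => c *: (t *: 'd f (z + t *: w) u)).
  by apply/funext => u; apply: (congr1 ( *:%R c)); rewrite -linearZ.
by apply: is_diffZ.
Qed.

Section rescaled_function.
Variables (R : realType) (n : nat).
Implicit Types (z w u v : 'rV[R[i]]_n) (f g : 'rV[R[i]]_n -> R[i]) (t : R).

Definition rescale (c t : R) z f w : R[i] := c%:C * f (z + t%:C *: w).

Lemma differentiable_rescale c t z f w :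
  differentiable f (z + t%:C *: w) -> differentiable (rescale c t z f) w.
Proof. by move=> /(is_diff_affine_comp c%:C)[]. Qed.

Lemma diff_rescale c t z f w u : differentiable f (z + t%:C *: w) ->
  'd (rescale c t z f) w u = c%:C * (t%:C * 'd f (z + t%:C *: w) u).
Proof.
move=> /(is_diff_affine_comp c%:C)[_ e].
exact: (congr1 (fun F : 'rV[R[i]]_n -> R[i] => F u) e).
Qed.

Lemma metric_rescale (gamma t : R) z f w u : 0 < t ->
  differentiable f (z + t%:C *: w) ->
  let g := rescale (kap gamma t) t z f in
  cabs ('d g w u) * lam (cabs (g w)) =
  cabs ('d f (z + t%:C *: w) u) * weight gamma (cabs (f (z + t%:C *: w))) t.
Proof.
move=> t0 df g; have k0 := kap_gt0 gamma t0.
apply: (etrans (congr1 (fun x => cabs x * lam (cabs (g w)))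
  (diff_rescale _ u df))).
rewrite /g /rescale !cabsM !cabs_real !gtr0_norm//.
by rewrite /weight; ring.
Qed.

Lemma growth_ball g (r C K : R) :
  (forall w, enorm w <= r -> differentiable g w) ->
  (forall w u, enorm w <= r -> enorm u <= 1 ->
    cabs ('d g w u) * lam (cabs (g w)) <= C) ->
  forall z w, enorm z <= r -> enorm w <= r -> cabs (g z) <= K ->
    cabs (g w) <= growth (2 * r * C) K.
Proof.
move=> dg gC z w zr wr gK.
have r0 : 0 <= r := le_trans (enorm_ge0 z) zr.
have Ev : enorm (w - z) <= 2 * r by have := enormB w z; lra.
have -> : w = z + (w - z) by rewrite addrC subrK.
apply: growth_segment gK => x hx.
have pr : enorm (z + x%:C *: (w - z)) <= r.
  by apply: enorm_segment => //; rewrite addrC subrK.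
split; first exact: dg.
set p := z + _ in pr *.
have L0 := lam_gt0 (cabs_ge0 (g p)).
have [e0|e0] := eqVneq (enorm (w - z)) 0.
  have -> : 'd g p (w - z) = 0.
    apply/eqP; rewrite -cabs_eq0 eq_le cabs_ge0 andbT.
    rewrite (diff_linform (dg _ pr)); apply: (le_trans (cabs_linform _ _)).
    by rewrite e0 mulr0.
  rewrite cabs0 mul0r mulr_ge0 ?(le_trans _ (gC p 0 pr _))//.
  - by rewrite mulr_ge0.
  - by rewrite mulr_ge0 ?cabs_ge0// ltW.
  - by rewrite enorm0.
have {e0}e0 : 0 < enorm (w - z) by rewrite lt_def e0 enorm_ge0.
set E := enorm _ in e0 Ev; pose u := (E^-1)%:C *: (w - z).
have u1 : enorm u = 1.
  by rewrite enormZ cabs_real gtr0_norm ?invr_gt0// mulVf ?gt_eqF.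
have -> : w - z = E%:C *: u.
  by rewrite scalerA -rmorphM/= mulfV ?gt_eqF// scale1r.
rewrite linearZ/= -[_ *: 'd g _ u]/(E%:C * 'd g p u).
rewrite cabsM cabs_real gtr0_norm//.
rewrite -mulrA; apply: ler_pM => //.
- exact: ltW.
- by rewrite mulr_ge0 ?cabs_ge0// ltW.
- by apply: gC; rewrite ?u1.
Qed.

(* If [|g 0|] were large then [1 < |g|] on a disc of radius 256, where Landau's
   estimate makes the metric derivative at 0 smaller than 1/4. *)
Lemma center_bounded g v :
  (forall w, enorm w <= 256 -> differentiable g w) ->
  (forall w u, enorm w <= 256 -> enorm u <= 1 ->
    cabs ('d g w u) * lam (cabs (g w)) <= 4) ->
  enorm v <= 1 -> 1 < 4 * (cabs ('d g 0 v) * lam (cabs (g 0))) ->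
  cabs (g 0) <= growth (2 * 256 * 4) 1.
Proof.
move=> dg gC v1 gv; rewrite leNgt; apply/negP => big.
have e0 : enorm (0 : 'rV[R[i]]_n) <= 256 by rewrite enorm0 ler0n.
have line s : cabs s < 256 -> enorm (s *: v) <= 256.
  by move=> s1; rewrite enormZ; have := cabs_ge0 s; have := enorm_ge0 v; nra.
(* [growth_ball] from [w] back to 0: a value of modulus at most 1 would contradict [big]. *)
have large w : enorm w <= 256 -> 1 < cabs (g w).
  move=> wr; rewrite ltNge; apply/negP => /(growth_ball dg gC wr e0).
  by rewrite leNgt big.
(* The radius 256 is 4 times Landau's 64. With [x = |g 0|] and [D] the modulus of the derivative, it
   leaves [4 D <= x ln x], short of the required [(1 + x) (1 + ln (1 + x))]. *)
have := @landau_estimate R (fun s => g (s *: v)) (fun s => 'd g (s *: v) v)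
  256 (growth (2 * 256 * 4) (cabs (g 0))) (ltr0Sn _ _).
rewrite scale0r => /(_ _ _)/wrap[||].
- move=> s /line sv; have := @differentiable_line R n g 0 v s.
  rewrite add0r => /(_ (dg _ sv)) H.
  by have -> : (fun s => g (s *: v)) = (fun s => g (0 + s *: v))
    by apply/funext => x; rewrite add0r.
- by move=> s /line sv; rewrite large//= (growth_ball dg gC e0 sv).
have x1 := large 0 e0; set x := cabs (g 0) in x1 gv *.
have l0 : 0 < ln x by rewrite ln_gt0.
have l1 : ln x <= ln (1 + x) by rewrite ler_ln ?posrE; lra.
move: gv; rewrite /lam mulrA ltr_pdivlMr ?mul1r; last by nra.
set D := cabs _; nra.
Qed.

End rescaled_function.

(** * Existence of a nonconstant limit *)

Section renormalization.
Variables (R : realType) (n : nat).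
Implicit Types (z w u v : 'rV[R[i]]_n) (f g : 'rV[R[i]]_n -> R[i]).

Lemma pow2_ge (B : R) : exists N : nat, forall j, (N <= j)%N -> B <= 2 ^+ j.
Proof.
exists (Num.bound B) => j Nj; apply: le_trans (ler_norm B) _.
have := archi_boundP (normr_ge0 B); rewrite /Num.bound normr_id => /ltW/le_trans.
apply; rewrite -natrX ler_nat; apply: leq_trans Nj (ltnW _); exact: ltn_expl.
Qed.

Lemma subseq_ge (s : nat -> nat) : {homo s : i j / (i < j)%N} ->
  forall j, (j <= s j)%N.
Proof. by move=> hs; elim=> // j /leq_ltn_trans; apply; exact: hs. Qed.

Lemma near_subseq (s : nat -> nat) (P : nat -> Prop) :
  {homo s : i j / (i < j)%N} ->
  (\forall j \near \oo, P j) -> \forall j \near \oo, P (s j).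
Proof.
move=> hs [N _ HN]; exists N => // j /= Nj; apply: HN => /=.
exact: leq_trans Nj (subseq_ge hs j).
Qed.

Lemma powR_dyadic_cvg0 (t_ : nat -> R) (b : R) : 0 < b ->
  (forall j, 0 < t_ j <= 2^-1 ^+ j) -> t_ j `^ b @[j --> \oo] --> 0.
Proof.
move=> b0 ht; apply/cvgrPdist_le => e e0.
have [N HN] := dyadic_small (powR_gt0 b^-1 e0).
exists N => // j /= Nj; have /andP[t0 tj] := ht j.
rewrite sub0r normrN ger0_norm ?powR_ge0//.
have -> : e = (e `^ b^-1) `^ b by rewrite -powRrM mulVf ?gt_eqF// powRr1// ltW.
rewrite ge0_ler_powR ?nnegrE ?powR_ge0 ?(ltW t0) ?(ltW b0)//.
exact: le_trans tj (ltW (HN j Nj)).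
Qed.

(** Since [lam <= 1], metric lengths never exceed Euclidean ones. *)
Lemma metric_lower (x y c : R) : 0 <= x -> 0 <= c -> c < y * lam x -> c < y.
Proof.
move=> x0 c0; have lx := ln1D_ge0 x0.
have P1 : 1 <= (1 + x) * (1 + ln (1 + x)) by nra.
rewrite /lam ltr_pdivlMr ?(lt_le_trans ltr01 P1)//; apply: le_lt_trans.
by rewrite ler_peMr.
Qed.

Lemma diff_near_cst g c v (K : R) :
  (forall w, enorm w <= 1 -> differentiable g w) ->
  (forall w, enorm w <= 1 -> cabs (g w - c) <= K) ->
  enorm v <= 1 -> cabs ('d g 0 v) <= 8 * K.
Proof.
move=> dg gK v1.
have line s : cabs (s - 0) < 1 -> enorm (0 + s *: v) <= 1.
  rewrite subr0 add0r enormZ => s1.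
  by have := cabs_ge0 s; have := enorm_ge0 v; nra.
pose D s := 'd g (0 + s *: v) v.
have -> : 'd g 0 v = D 0 by rewrite /D scale0r addr0.
rewrite -[leRHS]divr1.
apply: (@cauchy_estimate R (fun s => g (0 + s *: v) + - c) D 0 1 K ltr01).
  move=> s /line sv; rewrite -[D s]addr0.
  by apply: cderivD (cderiv_cst _ _); exact: differentiable_line (dg _ sv).
by move=> s /line sv; exact: gK.
Qed.

Lemma renormalized_limit (F : set ('rV[R[i]]_n -> R[i])) (gamma : R) :
  0 <= gamma -> gamma < 1 ->
  (forall f, F f -> holomorphic_on (@unit_ball R n) f) ->
  ~ normal_family (@unit_ball R n) F ->
  exists r : R, exists z_ : nat -> 'rV[R[i]]_n,
  exists f_ : nat -> 'rV[R[i]]_n -> R[i], exists t_ : nat -> R, exists g,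
  [/\ 0 < r < 1, forall j, enorm (z_ j) < r, forall j, F (f_ j) &
      forall j, 0 < t_ j <= 2^-1 ^+ j] /\
  [/\ entire g, ~ (exists c, forall w, g w = c) &
      cvg_loc_unif_partial (fun j => [set w | unit_ball (z_ j + (t_ j)%:C *: w)])
        (fun j => rescale (kap gamma (t_ j)) (t_ j) (z_ j) (f_ j)) g].
Proof.
move=> gamma0 gamma1 hF nF.
have [r /andP[r0 r1] pts] := rescaling_points gamma0 gamma1 hF nF.
have [f_ /choice[z_ /choice[t_ /choice[v_ Hp]]]] := choice pts.
have t0 j : 0 < t_ j by have [[_ _ /andP[]]] := Hp j.
pose g_ j := rescale (kap gamma (t_ j)) (t_ j) (z_ j) (f_ j).
have dom j w : enorm w <= 2 ^+ j / 2 ->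
    enorm (z_ j + (t_ j)%:C *: w - z_ j) <= 2 ^+ j / 2 * t_ j.
  move=> wj; rewrite addrC addKr enormZ cabs_real gtr0_norm// mulrC.
  by rewrite ler_pM2r.
have e0 : enorm (0 : 'rV[R[i]]_n) <= 1 by rewrite enorm0.
have inr j w : enorm w <= 2 ^+ j / 2 -> enorm (z_ j + (t_ j)%:C *: w) < r.
  by move=> /dom wj; have [_ [_ H]] := Hp j; have [] := H _ _ wj e0.
have df j w : enorm w <= 2 ^+ j / 2 ->
    differentiable (f_ j) (z_ j + (t_ j)%:C *: w).
  move=> /inr wr; have [[Ff _ _ _] _] := Hp j.
  by apply: (hF _ Ff); exact: lt_trans wr r1.
have dg j w : enorm w <= 2 ^+ j / 2 -> differentiable (g_ j) w.
  by move=> /df; exact: differentiable_rescale.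
have gC j w u : enorm w <= 2 ^+ j / 2 -> enorm u <= 1 ->
    cabs ('d (g_ j) w u) * lam (cabs (g_ j w)) <= 4.
  move=> wj u1; rewrite (metric_rescale gamma u (t0 j) (df j w wj)).
  by have [_ [_ H]] := Hp j; have [] := H _ _ (dom j w wj) u1.
have p2 j : 0 <= 2 ^+ j / 2 :> R by rewrite divr_ge0// exprn_ge0.
have e0' j : enorm (0 : 'rV[R[i]]_n) <= 2 ^+ j / 2 by rewrite enorm0.
have g0 j : 1 < 4 * (cabs ('d (g_ j) 0 (v_ j)) * lam (cabs (g_ j 0))).
  rewrite (metric_rescale gamma (v_ j) (t0 j) (df j 0 (e0' j))).
  by rewrite scaler0 addr0; have [_ []] := Hp j.
have v1 j : enorm (v_ j) <= 1 by have [[]] := Hp j.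
have [K0 [N0 HK0]] : exists (K0 : R) (N0 : nat), forall j, (N0 <= j)%N ->
    cabs (g_ j 0) <= K0.
  (* From this index on, the ball of radius [2^j / 2] that carries the metric bound contains the one
     required by [center_bounded]. *)
  have [N HN] := pow2_ge (256 * 2); exists (growth (2 * 256 * 4) 1), N => j Nj.
  have j256 : 256 <= 2 ^+ j / 2 :> R by rewrite ler_pdivlMr ?ltr0n// HN.
  apply: (center_bounded _ _ (v1 j) (g0 j)) => [w wj|w u wj].
    by apply: dg; exact: le_trans wj j256.
  by apply: gC; exact: le_trans wj j256.
pose K_ (k : nat) := [set w : 'rV[R[i]]_n | enorm w <= k%:R].
have KS k : K_ k `<=` K_ k.+1.
  by move=> w /le_trans; apply; rewrite ler_nat.
have loc z : [set: 'rV[R[i]]_n] z -> exists2 d, 0 < d & exists B : R,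
    \forall j \near \oo, forall w, enorm (w - z) < d ->
      differentiable (g_ j) w /\ cabs (g_ j w) <= B.
  move=> _; pose s := enorm z + 1.
  have s0 : 0 <= s by have := enorm_ge0 z; rewrite /s; lra.
  exists 1; rewrite ?ltr01//; exists (growth (2 * s * 4) K0).
  have [N HN] := pow2_ge (s * 2).
  exists (maxn N N0); first exact: I.
  move=> j /=; rewrite geq_max => /andP[Nj N0j] w wz.
  have js : s <= 2 ^+ j / 2 by rewrite ler_pdivlMr ?ltr0n// HN.
  have ws : enorm w <= s by have := enormD (w - z) z; rewrite subrK /s; lra.
  split; first by apply: dg; exact: le_trans ws js.
  have z0s : enorm (0 : 'rV[R[i]]_n) <= s by rewrite enorm0.
  apply: (growth_ball _ _ z0s ws (HK0 j N0j)) => [y ys|y u ys].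
    by apply: dg; exact: le_trans ys js.
  by apply: gC; exact: le_trans ys js.
have [s [g [hs [ge ug]]]] := @montel R n setT K_ g_
  (fun k => @compact_enorm R n _) KS (fun k => @subsetT _ _) loc.
exists r, (z_ \o s), (f_ \o s), (t_ \o s), g; split; first split.
- by rewrite r0.
- by move=> j; have [[]] := Hp (s j).
- by move=> j; have [[]] := Hp (s j).
- move=> j; rewrite t0/=; have [[_ _ /andP[_ tj] _] _] := Hp (s j).
  by apply: le_trans tj (dyadic_le _ _); exact: subseq_ge.
split.
- by move=> z _; exact: ge.
(* Values within 1/64 of a constant on the unit ball force the differential at 0 below 8/64 = 1/8,
   against the lower bound 1/4. An index at least 1 makes the radius [2^j / 2] at least 1. *)
- move=> [c gc]; have [N _ HN] := ug 1%N (2^-1 / 32) ltac:(by rewrite divr_gt0).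
  pose j := s (maxn N 1); have K1 w : enorm w <= 1 -> cabs (g_ j w - c) <= 2^-1 / 32.
    by move=> w1; rewrite -(gc w); exact: ltW (HN _ (leq_maxl N 1) w w1).
  have j1 : 1 <= 2 ^+ j / 2 :> R.
    rewrite ler_pdivlMr ?ltr0n// mul1r -[leLHS]expr1 ler_weXn2l ?ler1n//.
    exact: leq_trans (leq_maxr N 1) (subseq_ge hs _).
  have dg1 w : enorm w <= 1 -> differentiable (g_ j) w.
    by move=> w1; apply: dg; exact: le_trans w1 j1.
  have := diff_near_cst dg1 K1 (v1 j); set D := cabs _ => D8.
  have : 4^-1 < D.
    apply: (metric_lower (cabs_ge0 (g_ j 0))); first by rewrite invr_ge0.
    by have := g0 j; rewrite -/D; lra.
  lra.
move=> L cL; have [B HB] := compact_enorm_bounded cL.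
split.
  have [N HN] := pow2_ge (B * 2); apply: (@near_subseq s
    (fun j => L `<=` [set w | unit_ball (z_ j + (t_ j)%:C *: w)]) hs).
  exists N => // j /= Nj w /HB wB; rewrite /unit_ball/=.
  apply: lt_trans r1; apply: inr; apply: (le_trans wB).
  by rewrite ler_pdivlMr ?ltr0n// HN.
apply/uniform_cabs => e epos; have [k Bk] : exists k : nat, B <= k%:R.
  exists (Num.bound B); apply: le_trans (ler_norm B) _.
  by have := archi_boundP (normr_ge0 B); rewrite /Num.bound normr_id => /ltW.
have := ug k e epos; apply: filterS => j Hj w /HB wB.
by apply: Hj; exact: le_trans wB Bk.
Qed.

End renormalization.

(** * Rescaled limits of a normal family are constant *)

Section converse.
Variables (R : realType) (n : nat).
Implicit Types (z w : 'rV[R[i]]_n) (f g : 'rV[R[i]]_n -> R[i]).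

(** Of the exponents only [c_ >= 1] and [c_ * t_ --> 0] remain. As the centres stay in a fixed
    smaller ball, control on one compact ball suffices, and pointwise convergence of the rescaled
    functions is enough. *)
Lemma small_scale_limit_cst (F : set ('rV[R[i]]_n -> R[i])) (r : R)
    (z_ : nat -> 'rV[R[i]]_n) (f_ : nat -> 'rV[R[i]]_n -> R[i])
    (c_ t_ : nat -> R) g :
  (forall f, F f -> holomorphic_on (@unit_ball R n) f) ->
  normal_family (@unit_ball R n) F -> 0 < r < 1 ->
  (forall j, enorm (z_ j) < r) -> (forall j, F (f_ j)) ->
  (forall j, 1 <= c_ j) -> (forall j, 0 < t_ j) ->
  c_ j * t_ j @[j --> \oo] --> 0 ->
  (forall w e, 0 < e -> \forall j \near \oo,
    cabs (rescale (c_ j) (t_ j) (z_ j) (f_ j) w - g w) < e) ->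
  forall w, g w = g 0.
Proof.
move=> hF nF /andP[r0 r1] zr Ff c1 t0 ct0 gw w.
have [s hs [[f hf ff]|finf]] := nF f_ Ff; last first.
  have cK : compact [set z : 'rV[R[i]]_n | enorm z <= r] by exact: compact_enorm.
  have sK : [set z : 'rV[R[i]]_n | enorm z <= r] `<=` @unit_ball R n.
    by move=> z /le_lt_trans; exact.
  (* The contradiction appears at 0: as [c_ j >= 1], the rescaled value there has modulus above
     [|g 0| + 1], yet lies within 1 of [g 0]. *)
  have near_inf := finf _ cK sK (cabs (g 0) + 1).
  have near_g := near_subseq hs (gw 0 1 ltr01).
  have [N _ HN] : \forall j \near \oo,
      cabs (g 0) + 1 < cabs (f_ (s j) (z_ (s j))) /\
      cabs (rescale (c_ (s j)) (t_ (s j)) (z_ (s j)) (f_ (s j)) 0 - g 0) < 1.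
    apply: filterS2 near_inf near_g => j H1 H2; split; last exact: H2.
    by apply: H1; exact: ltW (zr _).
  exfalso; have [] := HN N (leqnn N); set j := s N.
  rewrite /rescale scaler0 addr0 => fN gN.
  have := cabs_subr (((c_ j)%:C : R[i]) * f_ j (z_ j)) (g 0).
  rewrite cabsM cabs_real ger0_norm; last exact: le_trans ler01 (c1 j).
  have : cabs (f_ j (z_ j)) <= c_ j * cabs (f_ j (z_ j)).
    by rewrite ler_peMl ?cabs_ge0 ?c1.
  by lra.
(* Balls of radius [d] about the centres stay in the ball of radius [r2 < 1], where the subsequence
   is eventually bounded by [B + 1]. *)
pose r2 := (1 + r) / 2; pose d := (1 - r) / 2.
have r21 : r2 < 1 by rewrite /r2; lra.
have d0 : 0 < d by rewrite /d; lra.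
have [B HB] := holomorphic_bounded r21 hf.
have sK : [set z : 'rV[R[i]]_n | enorm z <= r2] `<=` @unit_ball R n.
  by move=> z /le_lt_trans; exact.
have /uniform_cabs/(_ 1 ltr01) near_f := ff _ (@compact_enorm R n r2) sK.
have B0 : 0 <= B.
  by apply: le_trans (cabs_ge0 (f 0)) (HB _ _); rewrite enorm0 /r2; lra.
pose L := 16 * (B + 1) / d.
have L0 : 0 <= L.
  by rewrite /L divr_ge0 ?(ltW d0)// mulr_ge0 ?ler0n// addr_ge0.
have lip j : (forall z, enorm z <= r2 -> cabs (f_ j z) <= B + 1) ->
    t_ j * enorm w <= d / 2 ->
    cabs (rescale (c_ j) (t_ j) (z_ j) (f_ j) w -
          rescale (c_ j) (t_ j) (z_ j) (f_ j) 0) <= L * enorm w * (c_ j * t_ j).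
  move=> fB tw; rewrite /rescale scaler0 addr0 -mulrBr cabsM cabs_real.
  rewrite ger0_norm; last exact: le_trans ler01 (c1 j).
  have cj : 0 < c_ j := lt_le_trans ltr01 (c1 j).
  have Etw : enorm ((t_ j)%:C *: w) = t_ j * enorm w.
    by rewrite enormZ cabs_real gtr0_norm.
  have sub z : enorm (z - z_ j) < d -> enorm z <= r2.
    move=> zd; have := enormD (z - z_ j) (z_ j); have := zr j.
    by rewrite subrK /r2; rewrite /d in zd; lra.
  have := @lipschitz_estimate R n (f_ j) (z_ j) d (B + 1) d0.
  have -> : L * enorm w * (c_ j * t_ j) = c_ j * (L * (t_ j * enorm w)) by ring.
  rewrite -Etw ler_pM2l// => H.
  have -> : (t_ j)%:C *: w = (z_ j + (t_ j)%:C *: w) - z_ j.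
    by rewrite addrC addKr.
  rewrite [X in f_ j X]addrC subrK.
  apply: H => [z /sub zr2|z /sub|| ].
  - by apply: (hF _ (Ff j)); exact: le_lt_trans zr2 r21.
  - exact: fB.
  - by rewrite subrr enorm0; lra.
  - by rewrite addrC addKr Etw.
have small e : 0 < e -> \forall j \near \oo, c_ j * t_ j <= e.
  move=> e0; have /cvgrPdist_le/(_ e e0) := ct0; apply: filterS => j.
  by rewrite sub0r normrN; apply: le_trans; exact: ler_norm.
have w0 := enorm_ge0 w.
apply/eqP; rewrite -subr_eq0 -cabs_eq0 eq_le cabs_ge0 andbT leNgt.
apply/negP => gpos; set e := cabs (g w - g 0) in gpos.
have e3 : 0 < e / 3 by rewrite divr_gt0.
have E0 : 0 < e / 3 / (L * enorm w + 1) by rewrite divr_gt0// ltr_wpDl// mulr_ge0.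
have D0 : 0 < d / 2 / (enorm w + 1).
  by apply: divr_gt0; [exact: divr_gt0|exact: ltr_wpDl].
have [N _ HN] := filterI (filterI near_f (near_subseq hs (filterI (small _ E0)
  (small _ D0)))) (near_subseq hs (filterI (gw w _ e3) (gw 0 _ e3))).
have [[fN [ctE ctD]] [gwN g0N]] := HN N (leqnn N).
move: fN ctE ctD gwN g0N; rewrite [_ \o _]/=; set j := s N => fN ctE ctD gwN g0N.
have tj := t0 j; have cj := c1 j.
have tc : t_ j <= c_ j * t_ j by nra.
have tw : t_ j * enorm w <= d / 2.
  move: ctD; rewrite ler_pdivlMr ?ltr_wpDl// => ctD; nra.
have fB z : enorm z <= r2 -> cabs (f_ j z) <= B + 1.
  move=> zr2; have := cabsD (f_ j z - f z) (f z); rewrite subrK.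
  by have := fN z zr2; have := HB z zr2; rewrite -/j; lra.
have := lip j fB tw.
move: gwN g0N; set u := rescale _ _ _ _ w; set v := rescale _ _ _ _ 0 => gwN g0N.
have ctE' : L * enorm w * (c_ j * t_ j) <= e / 3.
  have Lw : 0 <= L * enorm w by rewrite mulr_ge0.
  by move: ctE; rewrite ler_pdivlMr ?ltr_wpDl// => ctE; nra.
have : e <= cabs (u - g w) + cabs (u - v) + cabs (v - g 0).
  rewrite /e; have -> : g w - g 0 = - (u - g w) + (u - v) + (v - g 0) by ring.
  apply: le_trans (cabsD _ _) _; rewrite lerD2r.
  by apply: le_trans (cabsD _ _) _; rewrite cabsN.
lra.
Qed.

End converse.

Theorem theorem2p2 (R : realType) (n : nat) (F : set ('rV[R[i]]_n -> R[i]))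
    (alpha beta : R) :
  (1 <= n)%N ->
  (forall f, F f -> holomorphic_on (@unit_ball R n) f) ->
  0 <= alpha -> alpha + 1 <= beta ->
  ~ normal_family (@unit_ball R n) F <->
  exists (r : R) (z_ : nat -> 'rV[R[i]]_n) (f_ : nat -> 'rV[R[i]]_n -> R[i])
    (rho_ : nat -> R),
    (0 < r < 1) /\
    (forall j, unit_ball (z_ j) /\ enorm (z_ j) < r) /\
    (forall j, F (f_ j)) /\
    (forall j, 0 < rho_ j <= 1) /\
    (rho_ j @[j --> \oo] --> 0) /\
    exists g : 'rV[R[i]]_n -> R[i],
      entire g /\ ~ (exists c : R[i], forall zeta, g zeta = c) /\
      cvg_loc_unif_partial
        (fun j => [set zeta | unit_ball (z_ j + (rho_ j `^ beta)%:C *: zeta)])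
        (fun j zeta => (rho_ j `^ (- alpha))%:C
                       * f_ j (z_ j + (rho_ j `^ beta)%:C *: zeta))
        g.
Proof.
move=> _ hF alpha0 ab; have b0 : 0 < beta by lra.
split=> [nF|[r [z_ [f_ [rho_ [r01 [zr [Ff [rho01 [rho0 [g [_ [gn gcv]]]]]]]]]]]]].
  have gamma0 : 0 <= alpha / beta by rewrite divr_ge0// ltW.
  have gamma1 : alpha / beta < 1 by rewrite ltr_pdivrMr// mul1r; lra.
  have [r [z_ [f_ [t_ [g [[r01 zr Ff tj] [ge gn gcv]]]]]]] :=
    renormalized_limit gamma0 gamma1 hF nF.
  (* Solves [rho^beta = t] and turns [rho^(- alpha)] into the prefactor [kap (alpha / beta) t]. *)
  pose rho_ j := t_ j `^ beta^-1.
  have tpos j : 0 < t_ j by have /andP[] := tj j.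
  have rho_beta j : rho_ j `^ beta = t_ j.
    by rewrite -powRrM mulVf ?gt_eqF// powRr1// ltW.
  have rho_alpha j : rho_ j `^ (- alpha) = kap (alpha / beta) (t_ j).
    by rewrite -powRrM /kap; congr (_ `^ _); field; rewrite gt_eqF.
  exists r, z_, f_, rho_; split; first exact: r01.
  split; first by move=> j; split=> //; have /andP[_ r1] := r01;
    exact: lt_trans (zr j) r1.
  split; first exact: Ff.
  split.
    move=> j; rewrite powR_gt0//=.
    have t1 : t_ j <= 1.
      have /andP[_ /le_trans] := tj j; apply.
      by rewrite exprn_ile1 ?invr_ge0// invf_le1// ler1n.
    have -> : 1 = 1 `^ beta^-1 by rewrite powR1.
    rewrite ge0_ler_powR ?nnegrE ?invr_ge0 ?(ltW b0)//.
    exact: ltW.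
  split; first by apply: powR_dyadic_cvg0 => //; rewrite invr_gt0.
  exists g; split; first exact: ge.
  split; first exact: gn.
  have -> : (fun j => [set zeta | unit_ball (z_ j + (rho_ j `^ beta)%:C *: zeta)]) =
      (fun j => [set zeta | unit_ball (z_ j + (t_ j)%:C *: zeta)]).
    by apply/funext => j; rewrite rho_beta.
  have -> : (fun j zeta => (rho_ j `^ (- alpha))%:C *
        f_ j (z_ j + (rho_ j `^ beta)%:C *: zeta)) =
      (fun j => rescale (kap (alpha / beta) (t_ j)) (t_ j) (z_ j) (f_ j)).
    by apply/funext => j; apply/funext => zeta; rewrite rho_alpha rho_beta.
  exact: gcv.
move=> normF; apply: gn; exists (g 0).
apply: (small_scale_limit_cst hF normF r01 (fun j => (zr j).2) Ff
  (c_ := fun j => rho_ j `^ (- alpha)) (t_ := fun j => rho_ j `^ beta)).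
- move=> j; have /andP[rpos r1] := rho01 j.
  rewrite powRN -invr1 lef_pV2 ?posrE ?powR_gt0//.
  have -> : 1 = 1 `^ alpha by rewrite powR1.
  rewrite ge0_ler_powR ?nnegrE// ltW//.
- by move=> j; apply: powR_gt0; have /andP[] := rho01 j.
(* The product of the two powers is [rho^(beta - alpha)], at most [rho] because [beta - alpha >= 1]
   and [rho <= 1]. *)
- apply: (@squeeze_cvgr _ _ _ _ (fun=> 0) rho_); last exact: rho0; last exact: cvg_cst.
  apply: nearW => j; have /andP[rpos r1] := rho01 j.
  rewrite mulr_ge0 ?powR_ge0//= -powRD; last by rewrite (gt_eqF rpos) implybT.
  by apply: ge1r_powR; [exact: rho01|lra].
move=> w e e0; have [_ /uniform_cabs/(_ e e0)] := gcv [set w] (compact_set1 (x:=w)).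
by apply: filterS => j; apply.
Qed.
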